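(* Let $n>k\ge 1$ be relatively prime integers and let $(\eta\,|\,\tau),(\eta'\,|\,\tau')\in\mathbb{C}\times\mathbb{H}$. Put $(E,\xi)=(E_\tau,\eta+\Lambda_\tau)$ and $(E',\xi')=(E_{\tau'},\eta'+\Lambda_{\tau'})$. If $\mu:E\to E'$ is an isomorphism of algebraic groups such that $\mu(x+\xi)=\mu(x)+\xi'$ for all $x\in E$, then $$Q_{n,k}(\eta\,|\,\tau)\;\cong\;Q_{n,k}(\eta'\,|\,\tau')$$ as graded $\mathbb{C}$-algebras.
   Context: Notation: $e(z):=e^{2\pi i z}$; $\mathbb{H}$ is the open upper half plane; $\mathbb{Z}_n:=\mathbb{Z}/n\mathbb{Z}$; for $\tau\in\mathbb{H}$, $\Lambda_\tau:=\mathbb{Z}+\mathbb{Z}\tau$ and $E_\tau:=\mathbb{C}/\Lambda_\tau$, an elliptic curve with identity the image of $0$. Theta functions. For $\tau\in\mathbb{H}$ put $\theta(z):=\sum_{m\in\mathbb{Z}}(-1)^m e\big(mz+\tfrac12 m(m-1)\tau\big)$ and, for $\alpha\in\mathbb{Z}$, $$\theta_\alpha(z):=e\Big(\alpha z+\tfrac{\alpha}{2n}+\tfrac{\alpha(\alpha-n)}{2n}\tau\Big)\prod_{m=0}^{n-1}\theta\Big(z+\tfrac{m}{n}+\tfrac{\alpha}{n}\tau\Big).$$ The function $\theta_\alpha$ depends only on $\alpha$ modulo $n$, and $\theta_0,\dots,\theta_{n-1}$ is a basis of the space $\Theta_n(\Lambda_\tau)$ of holomorphic $f:\mathbb{C}\to\mathbb{C}$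 with $f(z+1)=f(z)$ and $f(z+\tau)=-e(-nz)f(z)$. Indices are read in $\mathbb{Z}_n$. The operator $R$. Let $V$ be a complex vector space with basis $x_i$, $i\in\mathbb{Z}_n$. For $\eta\in\mathbb{C}\setminus\frac1n\Lambda_\tau$ and $z\in\mathbb{C}$, $R_{n,k}(z,\eta\,|\,\tau):V\otimes V\to V\otimes V$ is the linear operator, holomorphic in $z$ (apparent singularities are removable), given by $$R_{n,k}(z,\eta\,|\,\tau)(x_i\otimes x_j):=\frac{\theta_0(-z)\cdots\theta_{n-1}(-z)}{\theta_1(0)\cdots\theta_{n-1}(0)}\sum_{r\in\mathbb{Z}_n}\frac{\theta_{j-i+r(k-1)}(-z+\eta)}{\theta_{j-i-r}(-z)\,\theta_{kr}(\eta)}\;x_{j-r}\otimes x_{i+r}.$$ The function $\eta\mapsto R_{n,k}(\eta,\eta\,|\,\tau)$ on $\mathbb{C}\setminus\frac1n\Lambda_\tau$ extends uniquely to a holomorphic function $\mathbb{C}\to\mathrm{End}_{\mathbb{C}}(V^{\otimes2})$; the extension is also denoted $R_{n,k}(\eta,\eta\,|\,\tau)$. The algebra. For all $\eta\in\mathbb{C}$, $Q_{n,k}(\eta\,|\,\tau):=TV/(\text{image of }R_{n,k}(\eta,\eta\,|\,\tau))$, where $TV$ is the tensor algebra of $V$ and one quotients by the two-sided ideal generated by the image; it is graded with $V$ in degree one. *)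

(* Defs.v *)
From HB Require Import structures.
From mathcomp Require Import all_boot all_order all_algebra.
From mathcomp Require Import all_classical all_reals all_analysis.
From mathcomp Require Import complex.
(* The notations of monalg clash with those of mathcomp-analysis. *)
From mathcomp Require Import -(notations) monalg.

Set Implicit Arguments.
Unset Strict Implicit.
Unset Printing Implicit Defensive.

Import Order.TTheory GRing.Theory Num.Theory.
Import numFieldNormedType.Exports.

Local Open Scope ring_scope.
Local Open Scope classical_set_scope.
Local Open Scope quotient_scope.

Section TwoSidedQuotient.
Variables (K : comNzRingType) (A : lalgType K).

(* Stability under scalars is automatic, since a *: x = (a *: 1) * x. *)
Definition two_sided_ideal (I : set A) : Prop :=
  [/\ I 0,
      forall x y, I x -> I y -> I (x - y),
      forall a x, I x -> I (a * x)
    & forall a x, I x -> I (x * a)].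

Definition ideal_gen (S : set A) : {pred A} :=
  fun x => `[< forall I, two_sided_ideal I -> S `<=` I -> I x >].

Lemma ideal_genP S x :
  reflect (forall I, two_sided_ideal I -> S `<=` I -> I x) (x \in ideal_gen S).
Proof. exact: asboolP. Qed.

Lemma ideal_gen_zmod_closed S : zmod_closed (ideal_gen S).
Proof.
split=> [|x y /ideal_genP hx /ideal_genP hy]; apply/ideal_genP => I hI SI.
  by case: hI.
by case: (hI) => _ hB _ _; apply: hB; [apply: hx | apply: hy].
Qed.

HB.instance Definition _ S :=
  GRing.isZmodClosed.Build A (ideal_gen S) (ideal_gen_zmod_closed S).

Lemma ideal_genMl S a x : x \in ideal_gen S -> a * x \in ideal_gen S.
Proof.
move=> /ideal_genP hx; apply/ideal_genP => I hI SI.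
by case: (hI) => _ _ hl _; apply: hl; apply: hx.
Qed.

Lemma ideal_genMr S a x : x \in ideal_gen S -> x * a \in ideal_gen S.
Proof.
move=> /ideal_genP hx; apply/ideal_genP => I hI SI.
by case: (hI) => _ _ _ hr; apply: hr; apply: hx.
Qed.

Variable S : set A.

Definition quot_alg : Type := Quotient.quot (ideal_gen S).

HB.instance Definition _ := GRing.Zmodule.on quot_alg.

Definition quot_alg_pi (x : A) : quot_alg := \pi_(Quotient.quot (ideal_gen S)) x.

Lemma quot_alg_piE x y :
  (quot_alg_pi x == quot_alg_pi y) = (x - y \in ideal_gen S).
Proof. by rewrite [RHS](Quotient.idealrBE (ideal_gen S)). Qed.

Lemma quot_alg_piP x y :
  reflect (quot_alg_pi x = quot_alg_pi y) (x - y \in ideal_gen S).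
Proof. by rewrite -quot_alg_piE; apply: eqP. Qed.

Definition quot_alg_repr (x : quot_alg) : A :=
  repr (x : Quotient.quot (ideal_gen S)).

Lemma quot_alg_reprK : cancel quot_alg_repr quot_alg_pi.
Proof. by move=> x; rewrite /quot_alg_pi /quot_alg_repr reprK. Qed.

Lemma quot_alg_pi_zmod : zmod_morphism quot_alg_pi.
Proof. by move=> x y; rewrite /quot_alg_pi raddfB. Qed.

HB.instance Definition _ :=
  GRing.isZmodMorphism.Build A quot_alg quot_alg_pi quot_alg_pi_zmod.

Lemma quot_alg_repr_pi x : quot_alg_repr (quot_alg_pi x) - x \in ideal_gen S.
Proof. by apply/quot_alg_piP; rewrite quot_alg_reprK. Qed.

Definition quot_alg_one : quot_alg := quot_alg_pi 1.

Definition quot_alg_mul (x y : quot_alg) : quot_alg :=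
  quot_alg_pi (quot_alg_repr x * quot_alg_repr y).

Definition quot_alg_scale (a : K) (x : quot_alg) : quot_alg :=
  quot_alg_pi (a *: quot_alg_repr x).

Lemma quot_alg_mulE x y :
  quot_alg_mul (quot_alg_pi x) (quot_alg_pi y) = quot_alg_pi (x * y).
Proof.
apply/quot_alg_piP; set x' := quot_alg_repr _; set y' := quot_alg_repr _.
have -> : x' * y' - x * y = (x' - x) * y' + x * (y' - y).
  by rewrite mulrBl mulrBr addrA subrK.
by apply: rpredD; [apply: ideal_genMr | apply: ideal_genMl];
  apply: quot_alg_repr_pi.
Qed.

Lemma quot_alg_scaleE a x :
  quot_alg_scale a (quot_alg_pi x) = quot_alg_pi (a *: x).
Proof.
apply/quot_alg_piP; rewrite -scalerBr -[_ - x]mul1r scalerAl.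
by apply: ideal_genMl; apply: quot_alg_repr_pi.
Qed.

Lemma quot_alg_mulA : associative quot_alg_mul.
Proof.
move=> x y z; rewrite -[x]quot_alg_reprK -[y]quot_alg_reprK -[z]quot_alg_reprK.
by rewrite !quot_alg_mulE mulrA.
Qed.

Lemma quot_alg_mul1r : left_id quot_alg_one quot_alg_mul.
Proof. by move=> x; rewrite -[x]quot_alg_reprK quot_alg_mulE mul1r. Qed.

Lemma quot_alg_mulr1 : right_id quot_alg_one quot_alg_mul.
Proof. by move=> x; rewrite -[x]quot_alg_reprK quot_alg_mulE mulr1. Qed.

Lemma quot_alg_mulDl : left_distributive quot_alg_mul +%R.
Proof.
move=> x y z; rewrite -[x]quot_alg_reprK -[y]quot_alg_reprK -[z]quot_alg_reprK.
by rewrite -raddfD !quot_alg_mulE mulrDl raddfD.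
Qed.

Lemma quot_alg_mulDr : right_distributive quot_alg_mul +%R.
Proof.
move=> x y z; rewrite -[x]quot_alg_reprK -[y]quot_alg_reprK -[z]quot_alg_reprK.
by rewrite -raddfD !quot_alg_mulE mulrDr raddfD.
Qed.

HB.instance Definition _ := GRing.Zmodule_isPzRing.Build quot_alg
  quot_alg_mulA quot_alg_mul1r quot_alg_mulr1 quot_alg_mulDl quot_alg_mulDr.

Lemma quot_alg_scaleA a b x :
  quot_alg_scale a (quot_alg_scale b x) = quot_alg_scale (a * b) x.
Proof. by rewrite -[x]quot_alg_reprK !quot_alg_scaleE scalerA. Qed.

Lemma quot_alg_scale1 : left_id 1 quot_alg_scale.
Proof. by move=> x; rewrite -[x]quot_alg_reprK quot_alg_scaleE scale1r. Qed.

Lemma quot_alg_scaleDr : right_distributive quot_alg_scale +%R.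
Proof.
move=> a x y; rewrite -[x]quot_alg_reprK -[y]quot_alg_reprK.
by rewrite -raddfD !quot_alg_scaleE scalerDr raddfD.
Qed.

Lemma quot_alg_scaleDl x : {morph quot_alg_scale^~ x : a b / a + b}.
Proof.
move=> a b; rewrite -[x]quot_alg_reprK !quot_alg_scaleE.
by rewrite scalerDl raddfD.
Qed.

HB.instance Definition _ := GRing.Zmodule_isLmodule.Build K quot_alg
  quot_alg_scaleA quot_alg_scale1 quot_alg_scaleDr quot_alg_scaleDl.

Lemma quot_alg_scaleAl (a : K) (x y : quot_alg) : a *: (x * y) = a *: x * y.
Proof.
rewrite -[x]quot_alg_reprK -[y]quot_alg_reprK.
rewrite /GRing.scale /GRing.mul /=.
by rewrite !(quot_alg_mulE, quot_alg_scaleE) scalerAl.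
Qed.

End TwoSidedQuotient.

Section EllipticAlgebras.
Variable R : realType.
Local Notation C := R[i].
Implicit Types (tau eta z : C) (n k : nat).

Definition cexp (z : C) : C :=
  (expR (complex.Re z) * cos (complex.Im z)
     +i* (expR (complex.Re z) * sin (complex.Im z)))%C.

Definition e (z : C) : C := cexp ((0 +i* (2 * pi))%C * z).

Definition lattice tau : {pred C} :=
  fun z => `[< exists a b : int, z = a%:~R + b%:~R * tau >].

Lemma lattice_zmod_closed tau : zmod_closed (lattice tau).
Proof.
split=> [|x y /asboolP[a [b ->]] /asboolP[a' [b' ->]]]; apply/asboolP.
  by exists 0, 0; rewrite mul0r addr0.
exists (a - a'), (b - b').
by rewrite !rmorphB /= mulrBl opprD addrACA.
Qed.

HB.instance Definition _ tau :=
  GRing.isZmodClosed.Build C (lattice tau) (lattice_zmod_closed tau).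

Definition ell tau : zmodType := Quotient.quot (lattice tau).

Definition ell_pi tau z : ell tau := \pi_(Quotient.quot (lattice tau)) z.

(* Complex differentiability: C^o is a normed space over the field C. *)
Definition holo_at (f : C -> C) z : Prop :=
  derivable (f : C^o -> C^o) z 1.

(* The inverse branches of ell_pi are the charts of the complex torus, so a map
   of tori is holomorphic when it lifts locally to a holomorphic function. *)
Definition ell_holo tau tau' (f : ell tau -> ell tau') : Prop :=
  forall z, exists g : C -> C,
    \forall w \near (z : C^o), holo_at g w /\ f (ell_pi tau w) = ell_pi tau' (g w).

(* A homomorphism of elliptic curves over the complex numbers is algebraic if
   and only if it is holomorphic. *)
Definition ell_iso tau tau' (mu : {additive ell tau -> ell tau'}) : Prop :=
  exists nu : ell tau' -> ell tau,
    [/\ cancel mu nu, cancel nu mu, ell_holo mu & ell_holo nu].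

Definition theta_term tau z (m : int) : C :=
  (-1) ^ m * e (m%:~R * z + 2^-1 * (m * (m - 1))%:~R * tau).

Definition theta tau z : C :=
  limn (series (fun m : nat => theta_term tau z m%:Z) : nat -> C^o) +
  limn (series (fun m : nat => theta_term tau z (- m.+1%:Z)) : nat -> C^o).

Definition theta_ n tau (alpha : int) z : C :=
  e (alpha%:~R * z + alpha%:~R / (2 * n%:R)
     + (alpha * (alpha - n%:Z))%:~R / (2 * n%:R) * tau) *
  \prod_(0 <= m < n) theta tau (z + m%:R / n%:R + alpha%:~R / n%:R * tau).

(* 'Z_n is Z/nZ only for n > 1, which is the case when n > k >= 1.  An index in
   'Z_n is represented by an integer in [0, n[; theta_ n tau alpha depends only
   on alpha modulo n. *)
Definition thetaZ n tau (alpha : 'Z_n) z : C :=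
  theta_ n tau (nat_of_ord alpha)%:Z z.

(* V (x) V, as the coordinates on the basis x_a (x) x_b. *)
Definition V2 n := {ffun 'Z_n * 'Z_n -> C^o}.

Definition V2_basis n (a b : 'Z_n) : V2 n := [ffun p => (p == (a, b))%:R].

Definition R_coef n k tau z eta (i j r : 'Z_n) : C :=
  @thetaZ n tau (j - i + r * (k%:R - 1)) (- z + eta) /
  (@thetaZ n tau (j - i - r) (- z) * @thetaZ n tau (k%:R * r) eta).

Definition R_basis n k tau z eta (i j : 'Z_n) : V2 n :=
  ((\prod_(a : 'Z_n) @thetaZ n tau a (- z)) /
   (\prod_(a : 'Z_n | a != 0) @thetaZ n tau a 0)) *:
  \sum_(r : 'Z_n) R_coef k tau z eta i j r *: @V2_basis n (j - r) (i + r).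

Definition R_fun n k tau z eta (v : V2 n) : V2 n :=
  \sum_(p : 'Z_n * 'Z_n) v p *: R_basis k tau z eta p.1 p.2.

Lemma R_fun_is_linear n k tau z eta : linear (@R_fun n k tau z eta).
Proof.
move=> a u v; rewrite /R_fun scaler_sumr -big_split /=; apply: eq_bigr => p _.
by rewrite !ffunE scalerDl; congr (_ + _); rewrite [RHS]scalerA.
Qed.

HB.instance Definition _ n k tau z eta :=
  GRing.isLinear.Build C (V2 n) (V2 n) *:%R (R_fun k tau z eta)
    (R_fun_is_linear k tau z eta).

(* Since x / 0 = 0, the values where the formula is singular in z are junk. *)
Definition R_formula n k tau z eta : 'End(V2 n) := linfun (@R_fun n k tau z eta).

Definition entire n (F : C -> 'End(V2 n)) : Prop :=
  forall v p z, holo_at (fun w => F w v p) z.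

(* The entire function that coincides with f on D; it is unique when D is dense,
   and by convention it is f if there is none. *)
Definition entire_ext n (D : set C) (f : C -> 'End(V2 n)) : C -> 'End(V2 n) :=
  xget f [set F | entire F /\ forall z, D z -> F z = f z].

(* The complement of (1/n) lattice tau. *)
Definition regular_locus n tau : set C :=
  [set z | n%:R * z \notin lattice tau].

(* The singularities in z of the formula lie in (1/n) lattice tau. *)
Definition R_op n k tau z eta : 'End(V2 n) :=
  entire_ext (regular_locus n tau) (fun w => R_formula n k tau w eta) z.

Definition R_diag n k tau eta : 'End(V2 n) :=
  entire_ext (regular_locus n tau) (fun w => R_op n k tau w w) eta.

(* TV, as the free algebra on the x_i. *)
Definition TV n := malg (fmonom 'Z_n) C.

HB.instance Definition _ n := GRing.Lalgebra.on (TV n).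

Definition gen n (i : 'Z_n) : TV n := mkmalgU (fmu i) 1.

Definition TV_of_V2 n (v : V2 n) : TV n :=
  \sum_(p : 'Z_n * 'Z_n) v p *: (@gen n p.1 * @gen n p.2).

Definition TV_deg n (d : nat) : set (TV n) :=
  [set x | forall m, mcoeff m x != 0 -> fdeg m = d].

Definition Q_rel n k tau eta : set (TV n) :=
  [set TV_of_V2 v | v in [set v | v \in limg (R_diag n k tau eta)]].

Definition Q n k tau eta : Type := quot_alg (@Q_rel n k tau eta).

HB.instance Definition _ n k tau eta := GRing.PzRing.on (Q n k tau eta).
HB.instance Definition _ n k tau eta := GRing.Lmodule.on (Q n k tau eta).

Lemma Q_nonzero n k tau eta : (1 : Q n k tau eta) != 0.
Proof.
apply/negP; rewrite -(raddf0 (quot_alg_pi (Q_rel k tau eta))) quot_alg_piE subr0.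
move=> /ideal_genP /(_ [set x | mcoeff (fmone _) x = 0]) /= h.
suff h1 : mcoeff (fmone _) (1 : TV n) = 0.
  by move: h1; rewrite rmorph1 => /eqP; rewrite oner_eq0.
apply: h => [|_ [v _ <-]] /=.
  split=> /= [|x y hx hy|a x hx|a x hx].
  - by rewrite raddf0.
  - by rewrite raddfB /= hx hy subrr.
  - by rewrite rmorphM /= hx mulr0.
  - by rewrite rmorphM /= hx mul0r.
rewrite raddf_sum /= big1 // => p _.
rewrite mcoeffZ rmorphM /= /gen mcoeffU.
have -> : (fmu p.1 == fmone _) = false by rewrite fmP fmuE fmoneE.
by rewrite mul0r mulr0.
Qed.

HB.instance Definition _ n k tau eta :=
  GRing.PzSemiRing_isNonZero.Build (Q n k tau eta) (Q_nonzero n k tau eta).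

HB.instance Definition _ n k tau eta :=
  GRing.LSemiModule_isLSemiAlgebra.Build C (Q n k tau eta)
    (@quot_alg_scaleAl _ _ (Q_rel k tau eta)).

(* The image of TV_deg d. *)
Definition Q_deg n k tau eta (d : nat) : set (Q n k tau eta) :=
  [set quot_alg_pi (Q_rel k tau eta) x | x in @TV_deg n d].

End EllipticAlgebras.

Arguments Q_deg {R} n k tau eta d.

(* Main.v *)
Require Import Defs.
From HB Require Import structures.
From mathcomp Require Import -(notations) monalg.
From mathcomp Require Import all_boot all_order all_algebra.
From mathcomp Require Import all_classical all_reals all_analysis.
From mathcomp Require Import complex mxtens ring lra zify.

(** The operator R_{n,k}(z, eta) is governed by the Kronecker functions

      theta_(a+b)(x+y) / (theta_a(x) theta_b(y)),   x = - z,  y = eta.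

    In the variable x these are meromorphic, with simple poles at points of order n,
    and they are quasi-periodic under the points of order n: a shift by 1/n or tau/n
    amounts to a conjugation by Heisenberg operators acting on V, up to a factor that
    depends on y only (Mmx_shift).  Since n y is not a lattice point, a function with
    such multipliers and no poles vanishes, by Liouville's theorem
    (removable_quasi_periodic_eq0).  The operator is therefore determined by its
    residue at x = 0, which is a scalar (Mmx_residue).

    An isomorphism of elliptic curves is induced by the multiplication by a complex
    number c with c Lambda_tau = Lambda_tau', and expresses (c, c tau) in the basis
    (1, tau') by a matrix of determinant 1 (ell_isoP).  This matrix changes the pair
    of generating Heisenberg operators into another one with the same commutation
    relation, so that by the finite Stone-von Neumann theorem the two pairs are
    conjugate, up to scalars, by an invertible matrix P (intertwiner).  Then

      e(n q c x y) R'(c x, c y) (P (x) P)  and  (P (x) P) R(x, y),   c = p + q tau',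

    have the same multipliers in x, and proportional residues; the uniqueness statement
    above shows that they are proportional (Hmx_eq0, Mmx_transport).

    On the diagonal z = eta the apparent poles cancel against the scalar prefactor, and
    the extended operator is given by an explicit entire matrix (Emx, R_diagE), nowhere
    zero because at most one theta_alpha vanishes at a given point (Emx_neq0).  The
    proportionality extends to all eta by continuity of the 2 x 2 minors, and a
    translation by a lattice point changes the operator only by a scalar
    (Emx_transport).  As mu(x + xi) = mu(x) + xi' says that eta' - c eta is a lattice
    point, P (x) P carries the quadratic relations for (eta, tau) to those for
    (eta', tau').  The automorphism of the tensor algebra induced by P thus descends to
    an isomorphism of the graded quotients.

    The analytic input is developed for functions having Taylor expansions of all orders
    (expands), in which removable singularities are built in.  Liouville's theorem is
    proved through the maximum of |g|^2 + eps |z|^2 (no_interior_max), and the zeros of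
    theta are located by the Jacobi triple product, obtained as a limit of the q-binomial
    theorem with an explicit rate (triple_product_cvg). *)

Set Implicit Arguments.
Unset Strict Implicit.
Unset Printing Implicit Defensive.

Import Order.TTheory GRing.Theory Num.Theory.
Import numFieldNormedType.Exports.

Local Open Scope ring_scope.
Local Open Scope classical_set_scope.

(** * Moduli of complex numbers and Taylor expansions *)

Section Modulus.
Variable R : realType.
Local Notation C := R[i].
Implicit Types (z w : C).

(** The modulus as an element of the real field R; the library norm takes its
    values in the complex numbers. *)
Definition nrm z : R := Normc.normc z.

Lemma norm_nrm z : `|z| = (nrm z)%:C%C.
Proof. by case: z. Qed.

Lemma nrm_ge0 z : 0 <= nrm z.
Proof. by case: z => a b; rewrite /nrm /= sqrtr_ge0. Qed.

Lemma nrm0 : nrm 0 = 0. Proof. exact: Normc.normc0. Qed.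
Lemma nrm1 : nrm 1 = 1. Proof. exact: Normc.normc1. Qed.
Lemma nrmM z w : nrm (z * w) = nrm z * nrm w. Proof. exact: Normc.normcM. Qed.
Lemma nrmV z : nrm z^-1 = (nrm z)^-1. Proof. exact: Normc.normcV. Qed.
Lemma nrmN z : nrm (- z) = nrm z. Proof. exact: normcN. Qed.
Lemma nrmD z w : nrm (z + w) <= nrm z + nrm w. Proof. exact: le_normcD. Qed.
Lemma nrmB z w : nrm (z - w) <= nrm z + nrm w.
Proof. by rewrite -[nrm w]nrmN nrmD. Qed.

Lemma nrm_eq0 z : (nrm z == 0) = (z == 0).
Proof.
by apply/eqP/eqP => [/Normc.eq0_normc //|->]; exact: nrm0.
Qed.

Lemma nrm_gt0 z : (0 < nrm z) = (z != 0).
Proof. by rewrite lt_def nrm_ge0 andbT nrm_eq0. Qed.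

Lemma nrmX z m : nrm (z ^+ m) = nrm z ^+ m.
Proof. by elim: m => [|m IH]; rewrite ?expr0 ?nrm1 // !exprS nrmM IH. Qed.

Lemma nrm_real (r : R) : nrm r%:C%C = `|r|.
Proof. by rewrite /nrm /= expr0n /= addr0 sqrtr_sqr. Qed.

Lemma nrm_nat m : nrm (m%:R : C) = m%:R.
Proof. by rewrite -(rmorph_nat (real_complex R)) nrm_real ger0_norm. Qed.

Lemma nrm_int (m : int) : nrm (m%:~R : C) = `|m%:~R|.
Proof. by rewrite -(rmorph_int (real_complex R)) nrm_real. Qed.

Lemma nrm_sum (I : Type) (r : seq I) (P : pred I) (F : I -> C) :
  nrm (\sum_(i <- r | P i) F i) <= \sum_(i <- r | P i) nrm (F i).
Proof.
elim/big_ind2: _ => [|x1 x2 y1 y2 h1 h2|//]; first by rewrite nrm0.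
by apply: le_trans (nrmD _ _) _; apply: lerD.
Qed.

Lemma nrm_prod (I : Type) (r : seq I) (P : pred I) (F : I -> C) :
  nrm (\prod_(i <- r | P i) F i) = \prod_(i <- r | P i) nrm (F i).
Proof. by apply: (big_morph nrm nrmM nrm1). Qed.

Lemma nrm_triangle z w : nrm z - nrm w <= nrm (z - w).
Proof.
by rewrite lerBlDr; apply: le_trans (nrmD _ _); rewrite subrK.
Qed.

Lemma sqr_nrm z : nrm z ^+ 2 = complex.Re z ^+ 2 + complex.Im z ^+ 2.
Proof. by case: z => a b; rewrite /nrm /= sqr_sqrtr // addr_ge0 ?sqr_ge0. Qed.

Lemma Re_le_nrm z : `|complex.Re z| <= nrm z.
Proof.
rewrite -(@ler_pXn2r _ 2) ?nnegrE ?nrm_ge0 // sqr_nrm real_normK ?num_real //.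
by rewrite lerDl sqr_ge0.
Qed.

Lemma Im_le_nrm z : `|complex.Im z| <= nrm z.
Proof.
rewrite -(@ler_pXn2r _ 2) ?nnegrE ?nrm_ge0 // sqr_nrm real_normK ?num_real //.
by rewrite lerDr sqr_ge0.
Qed.

Lemma nrm_le_ReIm z : nrm z <= `|complex.Re z| + `|complex.Im z|.
Proof.
have h : 0 <= `|complex.Re z| + `|complex.Im z| by rewrite addr_ge0.
rewrite -(@ler_pXn2r _ 2) ?nnegrE ?nrm_ge0 // sqr_nrm sqrrD.
by rewrite !real_normK ?num_real // addrAC lerDl mulrn_wge0 // mulr_ge0.
Qed.

Lemma ReD z w : complex.Re (z + w) = complex.Re z + complex.Re w.
Proof. by case: z w => [? ?] [? ?]. Qed.
Lemma ImD z w : complex.Im (z + w) = complex.Im z + complex.Im w.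
Proof. by case: z w => [? ?] [? ?]. Qed.
Lemma ReN z : complex.Re (- z) = - complex.Re z.
Proof. by case: z. Qed.
Lemma ImN z : complex.Im (- z) = - complex.Im z.
Proof. by case: z. Qed.
Lemma ReM z w : complex.Re (z * w) =
  complex.Re z * complex.Re w - complex.Im z * complex.Im w.
Proof. by case: z w => [? ?] [? ?]. Qed.
Lemma ImM z w : complex.Im (z * w) =
  complex.Re z * complex.Im w + complex.Im z * complex.Re w.
Proof. by case: z w => [? ?] [? ?]. Qed.
Lemma Re_int (m : int) : complex.Re (m%:~R : C) = m%:~R.
Proof. by rewrite -(rmorph_int (real_complex R)). Qed.
Lemma Im_int (m : int) : complex.Im (m%:~R : C) = 0.
Proof. by rewrite -(rmorph_int (real_complex R)). Qed.

Lemma Re_nat (m : nat) : complex.Re (m%:R : C) = m%:R.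
Proof. exact: (Re_int m). Qed.
Lemma Im_nat (m : nat) : complex.Im (m%:R : C) = 0.
Proof. exact: (Im_int m). Qed.

Lemma ReIm_eq z w : complex.Re z = complex.Re w -> complex.Im z = complex.Im w -> z = w.
Proof. by case: z w => [? ?] [? ?] /= -> ->. Qed.

End Modulus.

Arguments nrm {R} z : simpl never.

Section Expansions.
Variable R : realType.
Local Notation C := R[i].
Implicit Types (f g h : C -> C) (x v c d : C) (m : nat) (P Q : {poly C}).

(** Punctured big-O at 0. *)
Definition bigO m h : Prop :=
  exists K r : R, 0 < r /\
    forall w : C, w != 0 -> nrm w <= r -> nrm (h w) <= K * nrm w ^+ m.

Lemma bigOP m h : bigO m h -> exists K r : R, [/\ 0 <= K, 0 < r, r <= 1 &
    forall w : C, w != 0 -> nrm w <= r -> nrm (h w) <= K * nrm w ^+ m].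
Proof.
move=> [K [r [r0 H]]]; exists `|K|, (Num.min r 1); split=> //.
- by rewrite lt_min r0 ltr01.
- by rewrite ge_min lexx orbT.
move=> w w0; rewrite le_min => /andP[wr _].
apply: le_trans (H w w0 wr) _; apply: ler_wpM2r; last exact: ler_norm.
by rewrite exprn_ge0 // nrm_ge0.
Qed.

Lemma bigO_congr m h g (r : R) : 0 < r ->
  (forall w, w != 0 -> nrm w <= r -> g w = h w) -> bigO m h -> bigO m g.
Proof.
move=> r0 E [K [s [s0 H]]]; exists K, (Num.min r s); split.
  by rewrite lt_min r0 s0.
move=> w w0; rewrite le_min => /andP[wr ws]; rewrite E //; exact: H.
Qed.

Lemma eq_bigO m h g : g =1 h -> bigO m h -> bigO m g.
Proof. by move=> E; apply: (@bigO_congr _ _ _ 1) => // w _ _; apply: E. Qed.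

Lemma bigO_weaken m m' h : (m' <= m)%N -> bigO m h -> bigO m' h.
Proof.
move=> le /bigOP[K [r [K0 r0 r1 H]]]; exists K, r; split=> // w w0 wr.
apply: le_trans (H w w0 wr) _; apply: ler_wpM2l => //.
by apply: ler_wiXn2l => //; [apply: nrm_ge0 | apply: le_trans r1].
Qed.

Lemma bigOD m h g : bigO m h -> bigO m g -> bigO m (fun w => h w + g w).
Proof.
move=> [K [r [r0 H]]] [K' [r' [r0' H']]].
exists (K + K'), (Num.min r r'); split; first by rewrite lt_min r0 r0'.
move=> w w0; rewrite le_min => /andP[wr wr']; rewrite mulrDl.
by apply: le_trans (nrmD _ _) _; apply: lerD; [apply: H | apply: H'].
Qed.

Lemma bigOM m m' h g : bigO m h -> bigO m' g ->
  bigO (m + m') (fun w => h w * g w).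
Proof.
move=> /bigOP[K [r [K0 r0 r1 H]]] /bigOP[K' [r' [K0' r0' r1' H']]].
exists (K * K'), (Num.min r r'); split; first by rewrite lt_min r0 r0'.
move=> w w0; rewrite le_min => /andP[wr wr']; rewrite nrmM exprD.
rewrite mulrACA; apply: ler_pM; rewrite ?nrm_ge0 //; [exact: H | exact: H'].
Qed.

Lemma bigON m h : bigO m h -> bigO m (fun w => - h w).
Proof.
move=> [K [r [r0 H]]]; exists K, r; split=> // w w0 wr; rewrite nrmN; exact: H.
Qed.

Lemma bigO_id : bigO 1 (fun w => w).
Proof. by exists 1, 1; split=> // w _ _; rewrite mul1r expr1. Qed.

Lemma bigO_cst c : bigO 0 (fun=> c).
Proof. by exists (nrm c), 1; split=> // w _ _; rewrite expr0 mulr1. Qed.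

Lemma bigO_poly P : bigO 0 (horner P).
Proof.
elim/poly_ind: P => [|P c IH].
  by apply: eq_bigO (bigO_cst 0) => w; rewrite horner0.
apply: (@eq_bigO _ (fun w => P.[w] * w + c)).
  by move=> w; rewrite hornerMXaddC.
apply: bigOD (bigO_cst _).
by apply: (@bigO_weaken (0 + 1)) => //; apply: bigOM IH bigO_id.
Qed.

Lemma poly_factorX P : P.[0] = 0 -> exists Q, P = Q * 'X.
Proof.
by move=> /eqP/factor_theorem[Q ->]; exists Q; rewrite subr0.
Qed.

Lemma bigO_poly0 P : P.[0] = 0 -> bigO 1 (horner P).
Proof.
move=> /poly_factorX[Q ->].
apply: (@eq_bigO _ (fun w => Q.[w] * w)); first by move=> w; rewrite hornerMX.
by rewrite -[1%N]add0n; apply: bigOM bigO_id; apply: bigO_poly.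
Qed.

Lemma bigOX m h k : bigO m h -> bigO (m * k) (fun w => h w ^+ k).
Proof.
move=> H; elim: k => [|k IH].
  by rewrite muln0; apply: eq_bigO (bigO_cst 1) => w; rewrite expr0.
rewrite mulnS; apply: eq_bigO (bigOM H IH) => w; exact: exprS.
Qed.

Lemma bigO_divX m h : bigO m.+1 h -> bigO m (fun w => h w / w).
Proof.
move=> [K [r [r0 H]]]; exists K, r; split=> // w w0 wr.
rewrite nrmM nrmV ler_pdivrMr ?nrm_gt0 // -mulrA -exprSr; exact: H.
Qed.

Lemma bigO_scale m h c : c != 0 -> bigO m h -> bigO m (fun w => h (c * w)).
Proof.
move=> c0 /bigOP[K [r [K0 r0 r1 H]]]; exists (K * nrm c ^+ m), (r / nrm c).
split; first by rewrite divr_gt0 ?nrm_gt0.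
move=> w w0; rewrite ler_pdivlMr ?nrm_gt0 // => wr.
rewrite -mulrA -exprMn -nrmM; apply: H; first by rewrite mulf_neq0.
by rewrite nrmM mulrC.
Qed.

Lemma bigO_cst_eq0 c : bigO 1 (fun=> c) -> c = 0.
Proof.
move=> /bigOP[K [r [K0 r0 r1 H]]]; apply: contrapT => /eqP c0.
have nc : 0 < nrm c by rewrite nrm_gt0.
pose s := Num.min r (nrm c / (2 * (K + 1))).
have K1 : 0 < 2 * (K + 1) by lra.
have s0 : 0 < s by rewrite lt_min r0 divr_gt0.
have := H s%:C%C; rewrite nrm_real ger0_norm ?(ltW s0) // expr1.
rewrite -nrm_gt0 nrm_real normr_gt0 gt_eqF // => /(_ isT).
rewrite ge_min lexx => /(_ isT) h.
have h2 : s <= nrm c / (2 * (K + 1)) by rewrite ge_min lexx orbT.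
have : K * s <= K * (nrm c / (2 * (K + 1))) by rewrite ler_wpM2l.
move: h2; rewrite ler_pdivlMr // => h2.
nra.
Qed.

(** f has at x Taylor expansions of all orders with constant term v, its own
    value at x being ignored: the removable-singularity version of being
    analytic at x, with value v. *)
Definition expands f x v : Prop :=
  forall m, exists2 P : {poly C}, P.[0] = v & bigO m (fun w => f (x + w) - P.[w]).

(** By bigO_cst_eq0, the constant terms agree at all positive orders. *)
Lemma expands_ex f x :
  (forall m, exists P : {poly C}, bigO m (fun w => f (x + w) - P.[w])) ->
  exists v, expands f x v.
Proof.
move=> H; have [P1 H1] := H 1%N; exists P1.[0] => m.
have [P HP] := H (maxn m 1); exists P; last first.
  by apply: bigO_weaken HP; rewrite leq_maxl.
apply/eqP; rewrite -subr_eq0; apply/eqP; apply: bigO_cst_eq0.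
have HP1 : bigO 1 (fun w => f (x + w) - P.[w]).
  by apply: bigO_weaken HP; rewrite leq_maxr.
have D : (P - P1 - (P.[0] - P1.[0])%:P).[0] = 0 by rewrite !hornerE; ring.
have H3 := bigOD (bigOD H1 (bigON HP1)) (bigON (bigO_poly0 D)).
by apply: eq_bigO H3 => w; rewrite /= !hornerE /=; ring.
Qed.

Lemma expands_uniq f x v v' : expands f x v -> expands f x v' -> v = v'.
Proof.
move=> /(_ 1%N)[P <- HP] /(_ 1%N)[Q <- HQ].
apply/eqP; rewrite -subr_eq0; apply/eqP; apply: bigO_cst_eq0.
have D : (P - Q - (P.[0] - Q.[0])%:P).[0] = 0 by rewrite !hornerE; ring.
have H3 := bigOD (bigOD HQ (bigON HP)) (bigON (bigO_poly0 D)).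
by apply: eq_bigO H3 => w; rewrite /= !hornerE /=; ring.
Qed.

Lemma expands_near f g x v (r : R) : 0 < r ->
  (forall w, w != 0 -> nrm w <= r -> g (x + w) = f (x + w)) ->
  expands f x v -> expands g x v.
Proof.
move=> r0 E H m; have [P Pv HP] := H m; exists P => //.
by apply: bigO_congr r0 _ HP => w w0 wr; rewrite E.
Qed.

Lemma eq_expands f g x v : g =1 f -> expands f x v -> expands g x v.
Proof. by move=> E; apply: (@expands_near _ _ _ _ 1) => // w _ _; apply: E. Qed.

Lemma expands_cst c x : expands (fun=> c) x c.
Proof.
move=> m; exists c%:P; first by rewrite hornerC.
exists 0, 1; split=> // w _ _.
by rewrite hornerC subrr nrm0 mul0r.
Qed.

Lemma expands_id x : expands (fun z => z) x x.
Proof.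
move=> m; exists ('X + x%:P); first by rewrite !hornerE.
exists 0, 1; split=> // w _ _.
by rewrite !hornerE [w + x]addrC subrr nrm0.
Qed.

Lemma expandsD f g x v v' : expands f x v -> expands g x v' ->
  expands (fun z => f z + g z) x (v + v').
Proof.
move=> Hf Hg m; have [P <- HP] := Hf m; have [Q <- HQ] := Hg m.
exists (P + Q); first by rewrite hornerD.
by apply: eq_bigO (bigOD HP HQ) => w; rewrite hornerD; ring.
Qed.

Lemma expandsM f g x v v' : expands f x v -> expands g x v' ->
  expands (fun z => f z * g z) x (v * v').
Proof.
move=> Hf Hg m; have [P <- HP] := Hf m; have [Q <- HQ] := Hg m.
exists (P * Q); first by rewrite hornerM.
have H1 := bigOM HP HQ.
have H2 := bigOM HP (bigO_poly Q).
have H3 := bigOM (bigO_poly P) HQ.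
rewrite addn0 in H2.
apply: eq_bigO (bigOD (bigO_weaken (leq_addr m m) H1) (bigOD H2 H3)) => w.
by rewrite hornerM; ring.
Qed.

Lemma expandsZ f x v c : expands f x v -> expands (fun z => c * f z) x (c * v).
Proof. exact/expandsM/expands_cst. Qed.

Lemma expandsN f x v : expands f x v -> expands (fun z => - f z) x (- v).
Proof.
by move=> /(expandsZ (-1)); rewrite mulN1r; apply: eq_expands => z; rewrite mulN1r.
Qed.

Lemma expandsB f g x v v' : expands f x v -> expands g x v' ->
  expands (fun z => f z - g z) x (v - v').
Proof. by move=> Hf Hg; apply: expandsD Hf _; apply: expandsN. Qed.

Lemma expands_sum (I : Type) (r : seq I) (p : pred I) (F : I -> C -> C)
    (V : I -> C) x : (forall i, p i -> expands (F i) x (V i)) ->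
  expands (fun z => \sum_(i <- r | p i) F i z) x (\sum_(i <- r | p i) V i).
Proof.
move=> H; elim: r => [|i r IH].
  rewrite big_nil; apply: eq_expands (expands_cst 0 x) => z; exact: big_nil.
rewrite big_cons; case: ifPn => pi; last first.
  by apply: eq_expands IH => z; rewrite big_cons (negbTE pi).
by apply: eq_expands (expandsD (H i pi) IH) => z; rewrite big_cons pi.
Qed.

Lemma expands_prod (I : Type) (r : seq I) (p : pred I) (F : I -> C -> C)
    (V : I -> C) x : (forall i, p i -> expands (F i) x (V i)) ->
  expands (fun z => \prod_(i <- r | p i) F i z) x (\prod_(i <- r | p i) V i).
Proof.
move=> H; elim: r => [|i r IH].
  rewrite big_nil; apply: eq_expands (expands_cst 1 x) => z; exact: big_nil.
rewrite big_cons; case: ifPn => pi; last first.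
  by apply: eq_expands IH => z; rewrite big_cons (negbTE pi).
by apply: eq_expands (expandsM (H i pi) IH) => z; rewrite big_cons pi.
Qed.

Lemma expands_affine f c d x v : c != 0 -> expands f (c * x + d) v ->
  expands (fun z => f (c * z + d)) x v.
Proof.
move=> c0 H m; have [P <- HP] := H m.
exists (P \Po (c *: 'X)); first by rewrite horner_comp !hornerE.
apply: eq_bigO (bigO_scale c0 HP) => w.
by rewrite horner_comp !hornerE; congr (f _ - _); ring.
Qed.

(* Geometric series: with u = 1 - P/v, the inverse of P is approximated by
   v^-1 times the sum of the powers of u. *)
Lemma expandsV f x v : v != 0 -> expands f x v ->
  expands (fun z => (f z)^-1) x v^-1.
Proof.
move=> v0 H m; have [P Pv HP] := H m.+1.
pose u : {poly C} := 1 - v^-1 *: P.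
have u0 : u.[0] = 0 by rewrite /u !hornerE Pv mulVf // subrr.
pose Q : {poly C} := v^-1 *: \sum_(k < m.+1) u ^+ k.
have PQ : P * Q = 1 - u ^+ m.+1.
  rewrite -opprB subrX1 /Q -scalerAr scalerAl -mulNr opprB; congr (_ * _).
  by rewrite /u opprB addrC subrK.
have Q0 : Q.[0] = v^-1.
  rewrite /Q hornerZ horner_sum big_ord_recl /= expr0 hornerC big1 ?addr0 ?mulr1 //.
  by move=> i _; rewrite horner_exp u0 expr0n.
exists Q => //.
have HP1 : bigO 1 (fun w => f (x + w) - P.[w]) by apply: bigO_weaken HP.
have Pv0 : (P - v%:P).[0] = 0 by rewrite !hornerE Pv; ring.
have Hv : bigO 1 (fun w => f (x + w) - v).
  apply: eq_bigO (bigOD HP1 (bigO_poly0 Pv0)) => w; rewrite /= !hornerE /=; ring.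
have nv : 0 < nrm v by rewrite nrm_gt0.
have [s s0 Hs] : exists2 s : R, 0 < s &
    forall w, w != 0 -> nrm w <= s -> nrm v / 2 <= nrm (f (x + w)).
  have [K [r [K0 r0 r1 HK]]] := bigOP Hv.
  have K1 : 0 < 2 * (K + 1) by lra.
  exists (Num.min r (nrm v / (2 * (K + 1)))); first by rewrite lt_min r0 divr_gt0.
  move=> w w0; rewrite le_min => /andP[wr]; rewrite ler_pdivlMr // => ws.
  have := HK w w0 wr; rewrite expr1 => h.
  have := nrm_triangle v (v - f (x + w)).
  have -> : v - (v - f (x + w)) = f (x + w) by ring.
  rewrite -[nrm (v - _)]nrmN opprB => h2.
  have : 0 <= nrm w by exact: nrm_ge0.
  nra.
have Hf : bigO 0 (fun w => (f (x + w))^-1).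
  exists (nrm v / 2)^-1, s; split=> // w w0 ws; rewrite expr0 mulr1 nrmV.
  have h := Hs w w0 ws.
  by rewrite lef_pV2 // posrE ?divr_gt0 //; apply: lt_le_trans h; rewrite divr_gt0.
have H1 : bigO m.+1 (fun w => u.[w] ^+ m.+1 - (f (x + w) - P.[w]) * Q.[w]).
  apply: bigOD; first by have := bigOX m.+1 (bigO_poly0 u0); rewrite mul1n.
  by apply: bigON; rewrite -[m.+1]addn0; apply: bigOM HP (bigO_poly _).
apply: (@bigO_weaken (m.+1 + 0)); first by rewrite addn0.
apply: bigO_congr s0 _ (bigOM H1 Hf) => w w0 ws /=.
have f0 : f (x + w) != 0.
  by rewrite -nrm_gt0; apply: lt_le_trans (Hs w w0 ws); rewrite divr_gt0.
have E : P.[w] * Q.[w] = 1 - u.[w] ^+ m.+1.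
  by rewrite -hornerM PQ hornerD hornerN horner_exp hornerC.
transitivity ((1 - P.[w] * Q.[w] - (f (x + w) - P.[w]) * Q.[w]) / f (x + w)).
  by field.
by congr ((_ - _) / _); rewrite E opprB addrC subrK.
Qed.

Lemma expands_div f g x v v' : v' != 0 -> expands f x v -> expands g x v' ->
  expands (fun z => f z / g z) x (v / v').
Proof. by move=> v0 Hf Hg; apply: expandsM Hf _; apply: expandsV. Qed.

(** A Taylor polynomial without constant term is divisible by 'X. *)
Lemma expands_divX f x : expands f x 0 ->
  exists v, expands (fun z => f z / (z - x)) x v.
Proof.
move=> H; apply: expands_ex => m; have [P /poly_factorX[Q ->] HP] := H m.+1.
exists Q; apply: bigO_congr (@ltr01 _) _ (bigO_divX HP) => w w0 _.
by rewrite addrAC subrr add0r hornerMX; field.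
Qed.

(** A bound from below near x passes to the limit v. *)
Lemma expands_divX_ge f x v (c r : R) : 0 < c -> 0 < r ->
  (forall w, w != 0 -> nrm w <= r -> c <= nrm (f (x + w))) ->
  expands f x v -> v != 0.
Proof.
move=> c0 r0 Hc /(_ 1%N)[P Pv HP].
have Pv0 : (P - v%:P).[0] = 0 by rewrite !hornerE Pv; ring.
have Hv : bigO 1 (fun w => f (x + w) - v).
  apply: eq_bigO (bigOD HP (bigO_poly0 Pv0)) => w; rewrite /= !hornerE /=; ring.
apply/eqP => v0; have [K [s [K0 s0 s1 H]]] := bigOP Hv.
pose t := Num.min (Num.min r s) (c / (2 * (K + 1))).
have K1 : 0 < 2 * (K + 1) by lra.
have t0 : 0 < t by rewrite !lt_min r0 s0 divr_gt0.
have nt : nrm t%:C%C = t by rewrite nrm_real ger0_norm // ltW.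
have tn0 : (t%:C%C : C) != 0 by rewrite -nrm_gt0 nt.
have tr : t <= r by rewrite !ge_min lexx.
have ts : t <= s by rewrite !ge_min lexx orbT.
have : t <= c / (2 * (K + 1)) by rewrite ge_min lexx orbT.
rewrite ler_pdivlMr // => tc.
have := H t%:C%C tn0; rewrite nt v0 subr0 expr1 => /(_ ts) h1.
have := Hc t%:C%C tn0; rewrite nt => /(_ tr) h2.
nra.
Qed.

End Expansions.

(** * The complex exponential *)

Section Exponential.
Variable R : realType.
Local Notation C := R[i].
Implicit Types (z w u : C) (m : nat) (P : {poly C}).

(** The addition formulas of cos and sin. *)
Lemma cexpD z w : cexp (z + w) = cexp z * cexp w.
Proof.
rewrite /cexp ReD ImD expRD cosD sinD.
by apply: ReIm_eq; rewrite ?(ReM, ImM) /=; ring.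
Qed.

Lemma cexp0 : cexp (0 : C) = 1.
Proof. by apply: ReIm_eq; rewrite /cexp /= ?sin0 ?cos0 expR0; ring. Qed.

Lemma nrm_cexp z : nrm (cexp z) = expR (complex.Re z).
Proof.
apply/eqP; rewrite -(@eqrXn2 _ 2) ?nrm_ge0 ?expR_ge0 // sqr_nrm /=.
by rewrite !exprMn -mulrDr cos2Dsin2 mulr1.
Qed.

(** F and F' stand for a curve in the complex plane and its velocity. *)
Definition cderiv (F F' : R -> C) : Prop := forall t : R,
  is_derive t 1 (fun s => complex.Re (F s)) (complex.Re (F' t)) /\
  is_derive t 1 (fun s => complex.Im (F s)) (complex.Im (F' t)).

Lemma cderivD F F' G G' : cderiv F F' -> cderiv G G' ->
  cderiv (fun t => F t + G t) (fun t => F' t + G' t).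
Proof.
move=> HF HG t; have [f1 f2] := HF t; have [g1 g2] := HG t.
split; [rewrite ReD|rewrite ImD].
  by rewrite (_ : (fun s => _) = (fun s => complex.Re (F s)) + (fun s => complex.Re (G s)));
    [exact: is_deriveD | apply/funext => s; rewrite ReD].
by rewrite (_ : (fun s => _) = (fun s => complex.Im (F s)) + (fun s => complex.Im (G s)));
    [exact: is_deriveD | apply/funext => s; rewrite ImD].
Qed.

Lemma cderivM F F' G G' : cderiv F F' -> cderiv G G' ->
  cderiv (fun t => F t * G t) (fun t => F' t * G t + F t * G' t).
Proof.
move=> HF HG t; have [f1 f2] := HF t; have [g1 g2] := HG t; split.
  rewrite (_ : (fun s => _) =
    (fun s => complex.Re (F s)) * (fun s => complex.Re (G s)) -
    (fun s => complex.Im (F s)) * (fun s => complex.Im (G s))); last first.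
    by apply/funext => s; rewrite ReM.
  apply: is_derive_eq; rewrite ReD !ReM /GRing.scale /=; ring.
rewrite (_ : (fun s => _) =
    (fun s => complex.Re (F s)) * (fun s => complex.Im (G s)) +
    (fun s => complex.Im (F s)) * (fun s => complex.Re (G s))); last first.
  by apply/funext => s; rewrite ImM.
apply: is_derive_eq; rewrite ImD !ImM /GRing.scale /=; ring.
Qed.

Lemma cderiv_cst c : cderiv (fun=> c) (fun=> 0).
Proof. by move=> t; split; exact: is_derive_cst. Qed.

Lemma cderiv_line u : cderiv (fun t => t%:C%C * u) (fun=> u).
Proof.
move=> t; split.
  rewrite (_ : (fun s => _) = complex.Re u \*: (id : R -> R)).
    by apply: is_derive_eq; rewrite /GRing.scale /= mulr1.
  by apply/funext => s; rewrite ReM /= mul0r subr0 mulrC.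
rewrite (_ : (fun s => _) = complex.Im u \*: (id : R -> R)).
  by apply: is_derive_eq; rewrite /GRing.scale /= mulr1.
by apply/funext => s; rewrite ImM /= mul0r addr0 mulrC.
Qed.

Lemma eq_cderiv F G F' G' : F =1 G -> F' =1 G' -> cderiv F F' -> cderiv G G'.
Proof. by move=> /funext -> /funext ->. Qed.

Lemma cderiv_poly P u :
  cderiv (fun t => P.[t%:C%C * u]) (fun t => u * (deriv P).[t%:C%C * u]).
Proof.
elim/poly_ind: P => [|P c IH].
  apply: eq_cderiv (cderiv_cst 0) => t; first by rewrite horner0.
  by rewrite deriv0 horner0 mulr0.
apply: eq_cderiv (cderivD (cderivM IH (cderiv_line u)) (cderiv_cst c)) => t /=.
  by rewrite hornerMXaddC.
rewrite derivD derivM derivX derivC !hornerE /=; ring.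
Qed.

Lemma cderiv_cexp u :
  cderiv (fun t => cexp (t%:C%C * u)) (fun t => u * cexp (t%:C%C * u)).
Proof.
move=> t.
have [+ +] := cderiv_line u t; set f := fun s => _; set g := fun s => _ => df dg.
have d1 : is_derive t 1 (expR \o f) (expR (f t) * complex.Re u).
  exact: is_derive1_comp.
have d2 : is_derive t 1 (cos \o g) (- sin (g t) * complex.Im u).
  exact: is_derive1_comp.
have d3 : is_derive t 1 (sin \o g) (cos (g t) * complex.Im u).
  exact: is_derive1_comp.
split.
  rewrite (_ : (fun s => _) = (expR \o f) * (cos \o g)) //.
  by apply: is_derive_eq; rewrite ReM /GRing.scale /= -/(f t) -/(g t); ring.
rewrite (_ : (fun s => _) = (expR \o f) * (sin \o g)) //.
by apply: is_derive_eq; rewrite ImM /GRing.scale /= -/(f t) -/(g t); ring.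
Qed.

Lemma mean_value (f df : R -> R) (B : R) :
  (forall t : R, is_derive t 1 f (df t)) ->
  (forall t, 0 <= t <= 1 -> `|df t| <= B) -> `|f 1 - f 0| <= B.
Proof.
move=> H HB.
have cf : {within `[0, 1], continuous f}.
  by apply: derivable_within_continuous => x _; case: (H x).
have [t] := MVT ltr01 (fun t _ => H t) cf.
by rewrite in_itv /= => /andP[t0 t1] ->; rewrite subr0 mulr1; apply: HB; lra.
Qed.

(** The factor 2 comes from the mean value theorem for the real and imaginary
    parts separately. *)
Lemma cderiv_le F F' (B : R) : cderiv F F' ->
  (forall t, 0 <= t <= 1 -> nrm (F' t) <= B) -> nrm (F 1 - F 0) <= 2 * B.
Proof.
move=> H HB; apply: le_trans (nrm_le_ReIm _) _.
rewrite ReD ReN ImD ImN mulr2n mulrDl mul1r; apply: lerD.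
  apply: (mean_value (fun t => (H t).1)) => t /HB; exact/le_trans/Re_le_nrm.
apply: (mean_value (fun t => (H t).2)) => t /HB; exact/le_trans/Im_le_nrm.
Qed.

Definition exp_poly m : {poly C} := \poly_(k < m) (k`!%:R)^-1.

Lemma exp_poly0 m : (exp_poly m.+1).[0] = 1.
Proof. by rewrite horner_coef0 coef_poly /= fact0 invr1. Qed.

Lemma deriv_exp_poly m : deriv (exp_poly m.+1) = exp_poly m.
Proof.
apply/polyP => k; rewrite coef_deriv !coef_poly ltnS; case: ifP => _.
  rewrite factS natrM invfM -[_ *+ _]mulr_natr mulrAC mulVf ?mul1r //.
by rewrite mul0rn.
Qed.

(* The Taylor remainder of order m+1 has derivative u times the one of order m
   along the ray through u. *)
Lemma cexp_taylor m u :
  nrm (cexp u - (exp_poly m).[u]) <= (2 * nrm u) ^+ m * expR (nrm u).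
Proof.
elim: m u => [|m IH] u.
  rewrite /exp_poly poly_def big_ord0 horner0 subr0 expr0 mul1r nrm_cexp.
  by rewrite ler_expR; apply: le_trans (Re_le_nrm _); exact: ler_norm.
have H := cderivD (cderiv_cexp u) (cderiv_poly (- exp_poly m.+1) u).
have := @cderiv_le _ _ (nrm u * ((2 * nrm u) ^+ m * expR (nrm u))) H.
rewrite /= !rmorph1 !rmorph0 !mul1r !mul0r !hornerN exp_poly0 cexp0 subrr subr0.
move=> H1; rewrite exprS -!mulrA; apply: H1 => t /andP[t0 t1].
have t1' : nrm (t%:C%C * u) <= nrm u.
  by rewrite nrmM nrm_real ger0_norm // ler_piMl // nrm_ge0.
rewrite derivN deriv_exp_poly hornerN mulrN -mulrBr nrmM.
apply: ler_wpM2l; first exact: nrm_ge0.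
apply: le_trans (IH _) _; apply: ler_pM; rewrite ?ler_expR ?expR_ge0 //.
  by rewrite exprn_ge0 // mulr_ge0 // nrm_ge0.
by apply: lerXn2r; rewrite ?nnegrE ?mulr_ge0 ?nrm_ge0 // ler_wpM2l.
Qed.

Definition twopii : C := (0 +i* (2 * pi))%C.

Lemma eE z : e z = cexp (twopii * z). Proof. by []. Qed.

Lemma nrm_twopii : nrm twopii = 2 * pi.
Proof.
rewrite /nrm /= expr0n /= add0r sqrtr_sqr ger0_norm // mulr_ge0 //.
exact: pi_ge0.
Qed.

Lemma eD z w : e (z + w) = e z * e w.
Proof. by rewrite !eE mulrDr cexpD. Qed.

Lemma e0 : e (0 : C) = 1.
Proof. by rewrite eE mulr0 cexp0. Qed.

Lemma e_neq0 z : e z != 0.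
Proof. by rewrite eE -nrm_gt0 nrm_cexp expR_gt0. Qed.

Lemma eN z : e (- z) = (e z)^-1.
Proof.
by apply: (mulfI (e_neq0 z)); rewrite -eD subrr e0 divff // e_neq0.
Qed.

Lemma eB z w : e (z - w) = e z / e w.
Proof. by rewrite eD eN. Qed.

Lemma e_nat (m : nat) : e (m%:R : C) = 1.
Proof.
elim: m => [|m IH]; first exact: e0.
rewrite -addn1 natrD eD IH mul1r eE mulr1 /cexp /twopii /= expR0 mul1r mul1r.
by rewrite mulr_natl cos2pi sin2pi.
Qed.

Lemma e_int (m : int) : e (m%:~R : C) = 1.
Proof.
case: m => m; first exact: e_nat.
by rewrite NegzE rmorphN /= eN e_nat invr1.
Qed.

Lemma eX z (m : nat) : e z ^+ m = e (m%:R * z).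
Proof.
elim: m => [|m IH]; first by rewrite mul0r e0.
by rewrite exprS IH -eD -[m.+1]addn1 natrD mulrDl mul1r addrC.
Qed.

Lemma nrm_e z : nrm (e z) = expR (- (2 * pi * complex.Im z)).
Proof. by rewrite eE nrm_cexp ReM /= mul0r sub0r. Qed.

Lemma cos_eq1 (t : R) : 0 <= t < 1 -> cos (2 * pi * t) = 1 -> t = 0.
Proof.
move=> /andP[t0 t1] h; have p0 := pi_gt0 R.
have inj (s : R) : 0 <= s <= 2^-1 -> cos (2 * pi * s) = 1 -> s = 0.
  move=> /andP[s0 s1]; rewrite -[RHS]cos0 => /cos_inj.
  rewrite !in_itv /= lexx (ltW p0) => E.
  have : 2 * pi * s = 0 by apply: E => //; apply/andP; split; nra.
  by move=> E2; nra.
have [t2|t2] := leP t 2^-1; first by apply: inj; rewrite ?t0.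
have : 1 - t = 0.
  apply: inj; first by lra.
  have -> : 2 * pi * (1 - t) = - (2 * pi * t) + pi *+ 2 :> R.
    by rewrite -mulr_natl; ring.
  by rewrite cosD2pi cosN h.
by lra.
Qed.

Lemma e_eq1 z : e z = 1 -> exists m : int, z = m%:~R.
Proof.
move=> h; have p0 := pi_gt0 R.
have z0 : complex.Im z = 0.
  have := congr1 (@nrm R) h; rewrite nrm_e nrm1 -[in RHS]expR0 => /expR_inj E.
  nra.
exists (Num.floor (complex.Re z)); pose x := complex.Re z.
pose t := x - (Num.floor x)%:~R.
have tI : 0 <= t < 1.
  have /andP[a b] := floor_itv x; rewrite rmorphD /= in b.
  by rewrite /t; lra.
have zE : z = (Num.floor x)%:~R + t%:C%C.
  apply: ReIm_eq; rewrite ?(ReD, ImD) ?(Re_int, Im_int) /=; last by rewrite z0 addr0.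
  by rewrite /t /x addrC subrK.
have : t = 0.
  apply: (cos_eq1 tI); have := h; rewrite zE eD e_int mul1r eE.
  move=> /(congr1 (@complex.Re R)); rewrite /cexp /twopii /=.
  by rewrite !mulr0 mul0r subr0 expR0 mul1r add0r.
by move=> t0; rewrite [LHS]zE t0 addr0.
Qed.

Lemma e_half : e (2^-1 : C) = -1.
Proof.
have h : (e 2^-1 - 1) * (e 2^-1 + 1) = 0 :> C.
  by rewrite -subr_sqr_1 eX mulfV ?pnatr_eq0 // (e_nat 1) subrr.
move/eqP: h; rewrite mulf_eq0 subr_eq0 addr_eq0 => /orP[/eqP/e_eq1[m]|/eqP //].
move=> /(congr1 ( *%R 2)); rewrite mulfV ?pnatr_eq0 // => h.
have : (1 = 2 * m :> int) by apply: (@intr_inj C); rewrite intrM.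
by lia.
Qed.

Lemma e_addz z (m : int) : e (z + m%:~R) = e z.
Proof. by rewrite eD e_int mulr1. Qed.

Lemma e_taylor m z : nrm (e z - (exp_poly m).[twopii * z]) <=
  (4 * pi * nrm z) ^+ m * expR (2 * pi * nrm z).
Proof.
rewrite eE; apply: le_trans (cexp_taylor _ _) _.
rewrite nrmM nrm_twopii.
by rewrite (_ : 2 * (2 * pi * nrm z) = 4 * pi * nrm z) //; ring.
Qed.

Lemma expands_e z : expands (@e R) z (e z).
Proof.
case=> [|m].
  exists (e z)%:P; first by rewrite hornerC.
  pose B : R := expR (2 * pi) + 1.
  exists (nrm (e z) * B), 1; split=> // w _ w1.
  rewrite expr0 mulr1 hornerC eD -{2}[e z]mulr1 -mulrBr nrmM.
  apply: ler_wpM2l; first exact: nrm_ge0.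
  apply: le_trans (nrmB _ _) _; rewrite nrm1 lerD2r nrm_e ler_expR.
  have := Im_le_nrm w; have := pi_gt0 R; rewrite ler_norml => p /andP[a _].
  nra.
exists (e z *: (exp_poly m.+1 \Po (twopii *: 'X))).
  by rewrite !hornerE horner_comp !hornerE exp_poly0 mulr1.
exists (nrm (e z) * ((4 * (pi : R)) ^+ m.+1 * expR (2 * pi))), 1; split=> // w _ w1.
rewrite eD !hornerE horner_comp !hornerE -mulrBr nrmM -!mulrA.
apply: ler_wpM2l; first exact: nrm_ge0.
apply: le_trans (e_taylor _ _) _; rewrite exprMn -!mulrA.
apply: ler_wpM2l; first by rewrite exprn_ge0 // mulr_ge0 // pi_ge0.
rewrite mulrC; apply: ler_wpM2r; first by rewrite exprn_ge0 // nrm_ge0.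
rewrite ler_expR; have := pi_gt0 R; nra.
Qed.

End Exponential.

(** * Liouville's theorem *)

Section Liouville.
Variable R : realType.
Local Notation C := R[i].
Implicit Types (z w x : C) (G g : C -> C) (f : C -> R).

(** Real-valued functions are compared with a maximum on a square, for which
    continuity at a point is needed in terms of the modulus. *)
Definition ccont f x : Prop := forall eps : R, 0 < eps ->
  exists2 d : R, 0 < d & forall w, nrm w <= d -> `|f (x + w) - f x| <= eps.

Lemma ccont_comp_affine f (L : C -> C) (k : R) x : 
  (forall w, L (x + w) = L x + (L w - L 0)) ->
  (forall w, nrm (L w - L 0) <= k * nrm w) ->
  ccont f (L x) -> ccont (f \o L) x.
Proof.
move=> HL Hk H eps e0; have [d d0 Hd] := H eps e0.
have k1 : 0 < `|k| + 1 by rewrite ltr_wpDl.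
exists (d / (`|k| + 1)); first by rewrite divr_gt0.
move=> w; rewrite ler_pdivlMr // => wd /=; rewrite HL; apply: Hd.
apply: le_trans (Hk w) _; apply: le_trans wd.
rewrite mulrC; apply: ler_wpM2l; first exact: nrm_ge0.
by apply: le_trans (ler_norm _) _; rewrite lerDl.
Qed.

(** Compactness of the rectangle, seen in the real plane. *)
Lemma rect_max f (a b : R) : a <= b -> (forall x, ccont f x) ->
  exists2 z0 : C, (a <= complex.Re z0 <= b) && (a <= complex.Im z0 <= b) &
    forall z, (a <= complex.Re z <= b) && (a <= complex.Im z <= b) -> f z <= f z0.
Proof.
move=> ab fc; pose u (p : R * R) := f (p.1 +i* p.2)%C.
pose A : set (R * R) := `[a, b]%classic `*` `[a, b]%classic.
have A0 : A !=set0 by exists (a, a); split; rewrite /= in_itv /= lexx.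
have cA : compact A by apply: compact_setX; apply: segment_compact.
have cu : continuous u.
  move=> [p q]; apply/cvgrPdist_le => eps e0.
  have [d d0 Hd] := fc (p +i* q)%C eps e0.
  have d2 : 0 < d / 2 by rewrite divr_gt0.
  have n1 : \forall x \near nbhs p, `|p - x| < d / 2.
    by have /cvgrPdist_lt := @cvg_id _ (nbhs p); apply.
  have n2 : \forall x \near nbhs q, `|q - x| < d / 2.
    by have /cvgrPdist_lt := @cvg_id _ (nbhs q); apply.
  exists ([set x | `|p - x| < d / 2], [set x | `|q - x| < d / 2]) => //.
  move=> [p' q'] [/= h1 h2].
  rewrite /u /= distrC.
  have -> : (p' +i* q')%C = (p +i* q)%C + ((p' - p) +i* (q' - q))%C.
    by apply: ReIm_eq; rewrite ?(ReD, ImD) /= addrC subrK.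
  apply: Hd; apply: le_trans (nrm_le_ReIm _) _ => /=.
  by rewrite distrC [`|q' - q|]distrC; lra.
have cuA : {within A, continuous u} by exact: continuous_subspaceT.
have [[p q]] := compact_EVT_max A0 cA cuA.
rewrite inE => -[/= p1 p2] H.
exists (p +i* q)%C; first by move: p1 p2; rewrite !in_itv /= => -> ->.
case=> x y /= /andP[hx hy]; apply: (H (x, y)).
by rewrite inE; split; rewrite /= in_itv.
Qed.

Lemma expands_near3 g x : expands g x (g x) -> exists a b : C, exists K d : R,
  [/\ 0 <= K, 0 < d, d <= 1 & forall w, nrm w <= d ->
    nrm (g (x + w) - (g x + a * w + b * w ^+ 2)) <= K * nrm w ^+ 3].
Proof.
move=> H; have [P P0 HP] := H 3%N.
have [P1 E1] : exists Q, P - (g x)%:P = Q * 'X.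
  by apply: poly_factorX; rewrite !hornerE P0 /=; ring.
have [P2 E2] : exists Q, P1 - (P1.[0])%:P = Q * 'X.
  by apply: poly_factorX; rewrite !hornerE /=; ring.
have [P3 E3] : exists Q, P2 - (P2.[0])%:P = Q * 'X.
  by apply: poly_factorX; rewrite !hornerE /=; ring.
have PE w : P.[w] = g x + P1.[0] * w + P2.[0] * w ^+ 2 + P3.[w] * w ^+ 3.
  move: E1 E2 E3 => /(congr1 (horner^~ w)) + /(congr1 (horner^~ w)) +
    /(congr1 (horner^~ w)).
  rewrite /= !hornerD !hornerN !hornerC !hornerMX.
  move=> /eqP; rewrite subr_eq => /eqP -> /eqP; rewrite subr_eq => /eqP ->.
  by move=> /eqP; rewrite subr_eq => /eqP ->; ring.
have H3 : bigO 3 (fun w => P3.[w] * w ^+ 3).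
  by apply: (bigOM (bigO_poly P3)); have := bigOX 3 (@bigO_id R); rewrite mul1n.
have [K [d [K0 d0 d1 Hd]]] := bigOP (bigOD HP H3).
exists P1.[0], P2.[0], K, d; split=> // w wd.
have [->|w0] := eqVneq w 0.
  have -> : g (x + 0) - (g x + P1.[0] * 0 + P2.[0] * 0 ^+ 2) = 0 by rewrite addr0; ring.
  by rewrite nrm0 mulr_ge0 // exprn_ge0.
have := Hd w w0 wd; rewrite /= PE; apply: le_trans.
by rewrite le_eqVlt; apply/orP; left; apply/eqP; congr nrm; ring.
Qed.

Lemma expands_ccont g x : expands g x (g x) -> ccont (@nrm R \o g) x.
Proof.
move=> /expands_near3[a [b [K [d [K0 d0 d1 H]]]]] eps e0.
pose B := nrm a + nrm b + K + 1.
have B0 : 0 < B.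
  by rewrite /B; have := nrm_ge0 a; have := nrm_ge0 b; lra.
exists (Num.min d (eps / B)); first by rewrite lt_min d0 divr_gt0.
move=> w; rewrite le_min => /andP[wd]; rewrite ler_pdivlMr // => we /=.
have w1 : nrm w <= 1 by apply: le_trans d1.
have nw := nrm_ge0 w.
have h : nrm (g (x + w) - g x) <= eps.
  have -> : g (x + w) - g x = (g (x + w) - (g x + a * w + b * w ^+ 2)) +
    (a * w + b * w ^+ 2) by ring.
  apply: le_trans (nrmD _ _) _; apply: le_trans we.
  apply: le_trans (lerD (H w wd) (nrmD _ _)) _.
  rewrite (nrmM a) (nrmM b) nrmX /B.
  have w2 : nrm w ^+ 2 <= nrm w by rewrite expr2; nra.
  have w3 : nrm w ^+ 3 <= nrm w by rewrite exprS; nra.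
  have := nrm_ge0 a; have := nrm_ge0 b; nra.
rewrite ler_norml; apply/andP; split.
  have := nrm_triangle (g x) (g x - g (x + w)).
  have -> : g x - (g x - g (x + w)) = g (x + w) by ring.
  by rewrite -[nrm (g x - _)]nrmN opprB; lra.
have := nrm_triangle (g (x + w)) (g (x + w) - g x).
have -> : g (x + w) - (g (x + w) - g x) = g x by ring.
by lra.
Qed.

(** The cross terms cancel, because 1, i, -1, -i and their squares sum to zero. *)
Lemma square_vertices_sum (p a b : C) (s : R) (A := fun w => p + a * w + b * w ^+ 2) :
  nrm (A s%:C%C) ^+ 2 + nrm (A (0 +i* s)%C) ^+ 2 +
  nrm (A (- s%:C%C)) ^+ 2 + nrm (A (- (0 +i* s)%C)) ^+ 2 =
  4 * nrm p ^+ 2 + 4 * nrm a ^+ 2 * s ^+ 2 + 4 * nrm b ^+ 2 * s ^+ 4.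
Proof.
rewrite /A !sqr_nrm; case: p a b {A} => [x1 x2] [a1 a2] [b1 b2].
by rewrite /=; ring.
Qed.

(** |g|^2 + eps |z|^2 is strictly subharmonic: its mean over the vertices of a
    small square centred at z exceeds its value at z, because 1, i, -1, -i and
    their squares sum to zero. *)
Lemma no_interior_max g z (eps r : R) : 0 < eps -> 0 < r ->
  expands g z (g z) ->
  exists2 w, nrm w <= r &
    nrm (g z) ^+ 2 + eps * nrm z ^+ 2 <
    nrm (g (z + w)) ^+ 2 + eps * nrm (z + w) ^+ 2.
Proof.
move=> e0 r0 /expands_near3[a [b [K [d [K0 d0 d1 H]]]]].
pose B := nrm (g z) + nrm a + nrm b.
have B0 : 0 <= B by rewrite !addr_ge0 ?nrm_ge0.
have BK1 : 0 < 2 * (B * K + 1) by have := mulr_ge0 B0 K0; lra.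
(* The cubic error terms must stay below the gain 4 eps s^2 of the mean. *)
pose s := Num.min (Num.min d r) (eps / (2 * (B * K + 1))).
have s0 : 0 < s by rewrite !lt_min d0 r0 divr_gt0.
have sd : s <= d by rewrite !ge_min lexx.
have sr : s <= r by rewrite !ge_min lexx orbT.
have s1 : s <= 1 by apply: le_trans d1.
have se : s * (2 * (B * K + 1)) <= eps.
  by rewrite -ler_pdivlMr // ge_min lexx orbT.
pose A w := g z + a * w + b * w ^+ 2.
have near w : nrm w = s -> nrm (g (z + w)) ^+ 2 >= nrm (A w) ^+ 2 - 2 * B * K * s ^+ 3.
  move=> ws; have := H w; rewrite ws -/(A w) => /(_ sd) h.
  have hA : nrm (A w) <= B.
    apply: le_trans (nrmD _ _) _.
    apply: (@le_trans _ _ (nrm (g z) + nrm (a * w) + nrm (b * w ^+ 2))).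
      by rewrite lerD2r; exact: nrmD.
    rewrite (nrmM a) (nrmM b) nrmX ws /B.
    have s2 : s ^+ 2 <= 1 by rewrite expr2; nra.
    have := nrm_ge0 a; have := nrm_ge0 b; nra.
  have h2 := nrm_triangle (A w) (A w - g (z + w)).
  have E : A w - (A w - g (z + w)) = g (z + w) by ring.
  rewrite E -[nrm (A w - g _)]nrmN opprB in h2.
  set p := nrm (A w) in h2 hA *; set q := nrm (g (z + w)) in h2 *.
  set t := nrm (_ - _) in h h2; set S := K * s ^+ 3 in h.
  have p0 : 0 <= p by exact: nrm_ge0.
  have q0 : 0 <= q by exact: nrm_ge0.
  have t0 : 0 <= t by exact: nrm_ge0.
  have -> : 2 * B * K * s ^+ 3 = 2 * B * S by rewrite /S; ring.
  have pq : p - S <= q by lra.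
  have S0 : 0 <= S by lra.
  have [pS|pS] := leP p S; first by nra.
  nra.
have sC : nrm (s%:C%C : C) = s by rewrite nrm_real gtr0_norm.
have sI : nrm ((0 +i* s)%C : C) = s.
  by rewrite /nrm /= expr0n /= add0r sqrtr_sqr gtr0_norm.
have sC' := sC; rewrite -nrmN in sC'.
have sI' := sI; rewrite -nrmN in sI'.
have n1 := near _ sC; have n2 := near _ sI.
have n3 := near _ sC'; have n4 := near _ sI'.
have SA : nrm (A s%:C%C) ^+ 2 + nrm (A (0 +i* s)%C) ^+ 2 +
  nrm (A (- s%:C%C)) ^+ 2 + nrm (A (- (0 +i* s)%C)) ^+ 2 =
  4 * nrm (g z) ^+ 2 + 4 * nrm a ^+ 2 * s ^+ 2 + 4 * nrm b ^+ 2 * s ^+ 4.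
  exact: square_vertices_sum.
have SZ : nrm (z + s%:C%C) ^+ 2 + nrm (z + (0 +i* s)%C) ^+ 2 +
  nrm (z + (- s%:C%C)) ^+ 2 + nrm (z + (- (0 +i* s)%C)) ^+ 2 =
  4 * nrm z ^+ 2 + 4 * s ^+ 2.
  have := square_vertices_sum z 1 0 s; rewrite /= !mul1r !mul0r !addr0 => ->.
  by rewrite nrm0 nrm1 expr1n expr0n /= mulr1 mulr0 mul0r addr0.
apply: contrapT => N.
have le w : nrm w = s -> nrm (g (z + w)) ^+ 2 + eps * nrm (z + w) ^+ 2 <=
    nrm (g z) ^+ 2 + eps * nrm z ^+ 2.
  by move=> ws; rewrite leNgt; apply/negP => lt; apply: N; exists w => //; rewrite ws.
have l1 := le _ sC; have l2 := le _ sI; have l3 := le _ sC'; have l4 := le _ sI'.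
have na : 0 <= nrm a ^+ 2 * s ^+ 2 by rewrite mulr_ge0 ?sqr_ge0.
have nb : 0 <= nrm b ^+ 2 * s ^+ 4 by rewrite mulr_ge0 ?sqr_ge0 // exprn_ge0 // ltW.
have : eps * (4 * s ^+ 2) <= 8 * B * K * s ^+ 3.
  have : eps * (4 * nrm z ^+ 2 + 4 * s ^+ 2) - 8 * B * K * s ^+ 3 <=
    4 * (eps * nrm z ^+ 2) by rewrite -SZ; lra.
  by lra.
have -> : eps * (4 * s ^+ 2) = (4 * s ^+ 2) * eps by ring.
have -> : 8 * B * K * s ^+ 3 = (4 * s ^+ 2) * (2 * B * K * s) by ring.
rewrite ler_pM2l; last by rewrite mulr_gt0 // exprn_gt0.
nra.
Qed.

(** Liouville: the difference quotient g at 0 is bounded by a multiple of 1/|z|;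
    on a square of half side rho, |g|^2 + eps |z|^2 has its maximum on the
    boundary, so that g vanishes when eps = rho^-4 and rho grows. *)
Lemma liouville G (M : R) : (forall x, expands G x (G x)) ->
  (forall x, nrm (G x) <= M) -> forall x, G x = G 0.
Proof.
move=> HG HM q; apply: contrapT => Gq.
have q0 : q != 0 by apply/eqP => q0; apply: Gq; rewrite q0.
have [v Hv] : exists v, expands (fun z => (G z - G 0) / (z - 0)) 0 v.
  apply: expands_divX; have := expandsB (HG 0) (expands_cst (G 0) 0).
  by rewrite subrr.
pose g z := if z == 0 then v else (G z - G 0) / z.
have Hg z : expands g z (g z).
  rewrite {2}/g; case: eqVneq => [->|z0].
    apply: expands_near ltr01 _ Hv => w w0 _.
    by rewrite /g add0r (negbTE w0) subr0.
  apply: (@expands_near _ (fun z => (G z - G 0) / z) _ _ _ (nrm z / 2)).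
  - by rewrite divr_gt0 // nrm_gt0.
  - move=> w w0 wz; rewrite /g ifF //; apply/eqP => E.
    have E2 : nrm z = nrm w by rewrite -nrmN (_ : - z = w) // -[w](addKr z) E addr0.
    have z1 : 0 < nrm z by rewrite nrm_gt0.
    by suff : nrm z <= 0; [rewrite leNgt z1 | clear E; lra].
  apply: expands_div z0 _ (expands_id z).
  by apply: expandsB (HG z) _; apply: expands_cst.
have M0 : 0 <= M by apply: le_trans (HM 0); exact: nrm_ge0.
pose c := nrm (g q) ^+ 2.
have c0 : 0 < c.
  rewrite /c exprn_gt0 // nrm_gt0 /g (negbTE q0) mulf_neq0 ?invr_eq0 //.
  by rewrite subr_eq0; apply/eqP.
(* The values of u on the boundary are at most (4 M^2 + 2) / rho^2, less than c. *)
pose rho := 1 + nrm q + (4 * M ^+ 2 + 2) / c.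
have D0 : 0 < 4 * M ^+ 2 + 2 by have := sqr_ge0 M; lra.
have nq := nrm_ge0 q.
have Dc : 0 < (4 * M ^+ 2 + 2) / c by rewrite divr_gt0.
have rho1 : 1 <= rho by rewrite /rho; lra.
have rq : nrm q <= rho by rewrite /rho; lra.
have rho0 : 0 < rho by lra.
pose eps := rho ^- 4.
have eps0 : 0 < eps by rewrite invr_gt0 exprn_gt0.
pose u z := nrm (g z) ^+ 2 + eps * nrm z ^+ 2.
have ucont x : ccont u x.
  have sq h y : ccont (@nrm R \o h) y -> ccont (fun z => nrm (h z) ^+ 2) y.
    move=> Hh ep ep0; pose B := 2 * nrm (h y) + 1.
    have B0 : 0 < B by rewrite /B; have := nrm_ge0 (h y); lra.
    have mn : 0 < Num.min 1 (ep / B) by rewrite lt_min ltr01 divr_gt0.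
    have [d d0 Hd] := Hh _ mn; exists d => // w /Hd /=.
    rewrite le_min => /andP[w1]; rewrite ler_pdivlMr // => w2.
    rewrite subr_sqr normrM; apply: le_trans w2; apply: ler_wpM2l => //.
    move: w1; rewrite ler_norml ger0_norm ?addr_ge0 ?nrm_ge0 // /B; lra.
  move=> ep ep0; have e2 : 0 < ep / 2 by rewrite divr_gt0.
  have e3 : 0 < ep / 2 / eps by rewrite divr_gt0.
  have [d1 d10 H1] := sq _ _ (expands_ccont (Hg x)) _ e2.
  have [d2 d20 H2] := sq _ _ (expands_ccont (expands_id x)) _ e3.
  exists (Num.min d1 d2); first by rewrite lt_min d10 d20.
  move=> w; rewrite le_min => /andP[/H1 h1 /H2 h2].
  rewrite /u opprD addrACA -mulrBr.
  apply: le_trans (ler_normD _ _) _; rewrite normrM (gtr0_norm eps0).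
  by move: h2; rewrite ler_pdivlMr // => h2; lra.
have rr : - rho <= rho by lra.
have [z0 z0r Hmax] := rect_max rr ucont.
have z0b : rho <= nrm z0.
  rewrite leNgt; apply/negP => lt.
  pose r := rho - nrm z0; have r0 : 0 < r by rewrite subr_gt0.
  have [w wr] := no_interior_max eps0 r0 (Hg z0).
  rewrite ltNge => /negP; apply; apply: Hmax.
  have : nrm (z0 + w) <= rho.
    by apply: le_trans (nrmD _ _) _; rewrite /r in wr; lra.
  move=> h; rewrite -!ler_norml.
  by rewrite (le_trans (Re_le_nrm _) h) (le_trans (Im_le_nrm _) h).
have gz0 : nrm (g z0) <= 2 * M / rho.
  have z00 : z0 != 0 by rewrite -nrm_gt0; apply: lt_le_trans z0b.
  rewrite /g (negbTE z00) nrmM nrmV; apply: ler_pM.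
  - exact: nrm_ge0.
  - by rewrite invr_ge0 nrm_ge0.
  - by apply: le_trans (nrmB _ _) _; have := HM z0; have := HM 0; lra.
  by rewrite lef_pV2 ?posrE // nrm_gt0.
have nz0 : nrm z0 ^+ 2 <= 2 * rho ^+ 2.
  move: z0r => /andP[]; rewrite -!ler_norml sqr_nrm => h1 h2.
  rewrite mulr2n mulrDl mul1r; apply: lerD.
    by rewrite -(real_normK (num_real (complex.Re z0))) lerXn2r ?nnegrE ?(ltW rho0).
  by rewrite -(real_normK (num_real (complex.Im z0))) lerXn2r ?nnegrE ?(ltW rho0).
have uq : u q <= u z0.
  apply: Hmax; rewrite -!ler_norml.
  by rewrite (le_trans (Re_le_nrm _) rq) (le_trans (Im_le_nrm _) rq).
have h1 : c <= (4 * M ^+ 2 + 2) / rho ^+ 2.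
  have h2 : c <= u q by rewrite /u lerDl mulr_ge0 ?sqr_ge0 // ltW.
  apply: le_trans h2 (le_trans uq _); rewrite mulrDl /u; apply: lerD.
    have -> : 4 * M ^+ 2 / rho ^+ 2 = (2 * M / rho) ^+ 2.
      by rewrite expr_div_n exprMn -natrX.
    by apply: lerXn2r => //; rewrite nnegrE ?nrm_ge0 // divr_ge0 ?mulr_ge0 ?(ltW rho0).
  have -> : 2 / rho ^+ 2 = eps * (2 * rho ^+ 2).
    by rewrite /eps; field; rewrite gt_eqF.
  by apply: ler_wpM2l => //; exact: ltW.
have h2 : c * rho ^+ 2 <= 4 * M ^+ 2 + 2 by rewrite -ler_pdivlMr // exprn_gt0.
have h3 : 4 * M ^+ 2 + 2 < c * rho.
  have : (4 * M ^+ 2 + 2) / c < rho by rewrite /rho; lra.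
  by rewrite ltr_pdivrMr // [rho * _]mulrC.
have : c * rho <= c * rho ^+ 2 by rewrite ler_pM2l // expr2; nra.
by lra.
Qed.

End Liouville.

(** * Lattices and quasi-periodic functions *)

Section Lattices.
Variable R : realType.
Local Notation C := R[i].
Implicit Types (z w x tau : C) (G : C -> C).

Lemma latticeP tau z :
  reflect (exists a b : int, z = a%:~R + b%:~R * tau) (z \in lattice tau).
Proof. exact: asboolP. Qed.

Lemma lattice1 tau : 1 \in lattice tau.
Proof. by apply/latticeP; exists 1, 0; rewrite mul0r addr0. Qed.

Lemma lattice_tau tau : tau \in lattice tau.
Proof. by apply/latticeP; exists 0, 1; rewrite mul1r add0r. Qed.

Lemma lattice_int tau (m : int) z : z \in lattice tau -> m%:~R * z \in lattice tau.
Proof. by move=> zL; rewrite mulrzl rpredMz. Qed.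

Lemma lattice_discrete tau : 0 < complex.Im tau ->
  exists2 d : R, 0 < d & forall z, z \in lattice tau -> nrm z < d -> z = 0.
Proof.
move=> t0; exists (Num.min 1 (complex.Im tau)); first by rewrite lt_min ltr01.
move=> z /latticeP[a [b ->]]; rewrite lt_min => /andP[z1 z2].
have int1 (m : int) : `|m%:~R| < 1 :> R -> m = 0.
  by rewrite -intr_norm -[1]/(1%:~R) ltr_int; lia.
have b0 : b = 0.
  apply: int1; have := le_lt_trans (Im_le_nrm _) z2.
  rewrite ImD ImM Im_int Re_int Im_int add0r mul0r addr0 normrM (gtr0_norm t0).
  by rewrite gtr_pMl.
move: z1; rewrite b0 mul0r addr0 => z1; suff -> : a = 0 by [].
by apply: int1; move: z1; rewrite nrm_int.
Qed.

(** The fundamental parallelogram. *)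
Lemma lattice_reduce tau x : 0 < complex.Im tau ->
  exists a b : int, exists s t : R, [/\ 0 <= s <= 1, 0 <= t <= 1 &
    x = (s%:C%C + t%:C%C * tau) + (a%:~R + b%:~R * tau)].
Proof.
move=> t0; have frac (r : R) : exists (m : int) (u : R), 0 <= u <= 1 /\ r = u + m%:~R.
  exists (Num.floor r), (r - (Num.floor r)%:~R); split; last by rewrite subrK.
  by have /andP[] := floor_itv r; rewrite rmorphD /=; lra.
have [b [t [tI tE]]] := frac (complex.Im x / complex.Im tau).
have [a [s [sI sE]]] :=
  frac (complex.Re x - complex.Im x / complex.Im tau * complex.Re tau).
exists a, b, s, t; split=> //; apply: ReIm_eq.
  rewrite !(ReD, ReM, Re_int, Im_int) /= !mul0r !subr0.
  have -> : complex.Re x = complex.Re x -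
     complex.Im x / complex.Im tau * complex.Re tau +
     complex.Im x / complex.Im tau * complex.Re tau by rewrite subrK.
  by rewrite sE tE; ring.
rewrite !(ImD, ImM, Re_int, Im_int) /= !mul0r !addr0 !add0r -mulrDl -tE.
by rewrite divfK // gt_eqF.
Qed.

(** Two points of a discrete set differ by more than some constant. *)
Lemma lattice_regular_near tau z : 0 < complex.Im tau -> forall (n : nat), (0 < n)%N ->
  exists2 d : R, 0 < d & forall w, w != 0 -> nrm w <= d ->
    n%:R * (z + w) \notin lattice tau.
Proof.
move=> t0 n n0; have [d d0 Hd] := lattice_discrete t0.
have n0' : 0 < n%:R :> R by rewrite ltr0n.
have [zL|zL] := boolP (n%:R * z \in lattice tau).
  exists (d / (2 * n%:R)); first by rewrite divr_gt0 // mulr_gt0.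
  move=> w w0; rewrite ler_pdivlMr ?mulr_gt0 // => wd.
  apply/negP; rewrite mulrDr rpredDl // => /Hd E.
  have : n%:R * w = 0 by apply: E; rewrite nrmM nrm_nat; lra.
  by move/eqP; rewrite mulf_eq0 pnatr_eq0 -leqn0 leqNgt n0 /= (negbTE w0).
apply: contrapT => N.
have N' (r : R) : 0 < r -> exists w, [/\ w != 0, nrm w <= r & n%:R * (z + w) \in lattice tau].
  move=> r0; apply: contrapT => M; apply: N; exists r => // w w0 wr.
  by apply/negP => wL; apply: M; exists w.
have [w1 [w10 w1d w1L]] := N' (d / (4 * n%:R)) (divr_gt0 d0 (mulr_gt0 (ltr0n _ 4) n0')).
have r2 : 0 < Num.min (nrm w1 / 2) (d / (4 * n%:R)).
  by rewrite lt_min !divr_gt0 ?nrm_gt0 // mulr_gt0.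
have [w2 [w20 + w2L]] := N' _ r2; rewrite le_min => /andP[w21 w2d].
have : n%:R * (w1 - w2) = 0.
  have -> : n%:R * (w1 - w2) = n%:R * (z + w1) - n%:R * (z + w2) by ring.
  apply: Hd; first by rewrite rpredB.
  rewrite -mulrBr opprD addrACA subrr add0r nrmM nrm_nat.
  move: w1d w2d; rewrite !ler_pdivlMr ?mulr_gt0 // => w1d w2d.
  have := nrmB w1 w2; nra.
move/eqP; rewrite mulf_eq0 pnatr_eq0 -leqn0 leqNgt n0 /= subr_eq0 => /eqP E.
have z1 : 0 < nrm w1 by rewrite nrm_gt0.
by suff : nrm w1 <= 0; [rewrite leNgt z1 | move: w21; rewrite E in z1 *; lra].
Qed.

(** An entire function with constant multipliers over a lattice is, up to a
    suitable exponential factor e(tx), t real, bounded, hence constant.  If it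
    did not vanish, its multipliers would be those of e(-tx), which forces s
    into the lattice. *)
Lemma quasi_periodic_eq0 tau (s : C) G : 0 < complex.Im tau ->
  s \notin lattice tau -> (forall x, expands G x (G x)) ->
  (forall x, G (x + 1) = G x) -> (forall x, G (x + tau) = e (- s) * G x) ->
  forall x, G x = 0.
Proof.
move=> t0 sL HG G1 Gt.
pose t : C := ((complex.Im s / complex.Im tau)%:C)%C.
pose H x := e (t * x) * G x.
have HH x : expands H x (H x).
  apply: expandsM (HG x); apply: eq_expands (_ : expands (fun z => e (t * z + 0)) x _).
    by move=> z; rewrite addr0.
  have [->|tn0] := eqVneq t 0.
    apply: eq_expands (expands_cst (e (0 * x)) x) => z.
    by rewrite mul0r addr0 mul0r.
  by apply: expands_affine => //; rewrite addr0; apply: expands_e.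
have H1 x : nrm (H (x + 1)) = nrm (H x).
  rewrite /H G1 mulrDr mulr1 eD !nrmM (nrm_e t) /= mulr0 oppr0 expR0.
  by rewrite mulr1.
have Ht x : nrm (H (x + tau)) = nrm (H x).
  have -> : H (x + tau) = e (t * tau - s) * H x.
    by rewrite /H Gt mulrDr !eD; ring.
  rewrite nrmM nrm_e ImD ImN ImM /= mul0r addr0 divfK ?gt_eqF //.
  by rewrite subrr mulr0 oppr0 expR0 mul1r.
have HmN (T : C) : (forall x, nrm (H (x + T)) = nrm (H x)) ->
    forall (m : int) x, nrm (H (x + m%:~R * T)) = nrm (H x).
  move=> HT; have HmN (m : nat) x : nrm (H (x + m%:R * T)) = nrm (H x).
    elim: m => [|m IH]; first by rewrite mul0r addr0.
    by rewrite -addn1 natrD mulrDl mul1r addrA HT.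
  case=> m x; first exact: HmN.
  rewrite NegzE rmorphN /= mulNr -[x in RHS](subrK (m.+1%:R * T)).
  exact/esym/HmN.
have [z0 _ Hz0] : exists2 z0 : C, true & forall x, nrm (H x) <= nrm (H z0).
  pose L z : C := (complex.Re z)%:C%C + (complex.Im z)%:C%C * tau.
  have L0 : L 0 = 0 by rewrite /L /= mul0r addr0.
  have LD z w : L (z + w) = L z + (L w - L 0).
    by rewrite L0 subr0 /L ReD ImD !rmorphD /=; ring.
  have Lb w : nrm (L w - L 0) <= (1 + nrm tau) * nrm w.
    rewrite L0 subr0 /L; apply: le_trans (nrmD _ _) _; rewrite nrmM !nrm_real.
    rewrite mulrDl mul1r [nrm tau * _]mulrC.
    apply: lerD; first exact: Re_le_nrm.
    by apply: ler_wpM2r (Im_le_nrm w); exact: nrm_ge0.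
  have [z0 _ Hmax] := rect_max (@ler01 R) (fun x =>
    ccont_comp_affine (x := x) (LD x) Lb (expands_ccont (HH (L x)))).
  exists (L z0) => // x; have [a [b [u [v [uI vI ->]]]]] := lattice_reduce x t0.
  rewrite addrA; have /= := HmN _ Ht b; move=> ->.
  have := HmN _ H1 a; rewrite mulr1 => ->.
  by apply: (Hmax (u +i* v)%C); rewrite /= uI vI.
have Hc := liouville HH Hz0.
have [H00|H00] := eqVneq (H 0) 0.
  by move=> x; have := Hc x; rewrite H00 => /eqP; rewrite mulf_eq0 (negbTE (e_neq0 _)) => /eqP.
exfalso; move/negP: sL; apply.
have et : e t = 1.
  apply: (mulIf H00); rewrite mul1r -{2}(Hc 1) /H mulr1 mulr0 e0 mul1r.
  by rewrite -[1 in RHS]add0r G1.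
have ett : e (t * tau - s) = 1.
  apply: (mulIf H00); rewrite mul1r -{2}(Hc tau) /H mulr0 e0 mul1r eD -mulrA.
  by rewrite -Gt add0r.
have [m mE] := e_eq1 et; have [m' mE'] := e_eq1 ett.
apply/latticeP; exists (- m'), m; rewrite rmorphN /= -mE' -mE; ring.
Qed.

(** The limits at the points of order n extend G to an entire function with the
    same multipliers. *)
Lemma removable_quasi_periodic_eq0 (n : nat) tau (s : C) G : (0 < n)%N ->
  0 < complex.Im tau -> s \notin lattice tau ->
  (forall x, exists v, expands G x v) ->
  (forall x, n%:R * x \notin lattice tau -> expands G x (G x)) ->
  (forall x, G (x + 1) = G x) -> (forall x, G (x + tau) = e (- s) * G x) ->
  forall x, n%:R * x \notin lattice tau -> G x = 0.
Proof.
move=> n0 t0 sL HG Greg G1 Gt.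
pose F x := xget 0 [set v | expands G x v].
have HF x : expands G x (F x).
  by have [v Hv] := HG x; rewrite /F; exact: (xgetPex 0 (ex_intro _ v Hv)).
have FE x : n%:R * x \notin lattice tau -> F x = G x.
  by move=> /Greg; apply: expands_uniq.
have shift (T c : C) : (forall x, G (x + T) = c * G x) -> forall x, F (x + T) = c * F x.
  move=> GT x; apply: expands_uniq (HF (x + T)) _ => m.
  have [P PE HP] := expandsZ c (HF x) m; exists P => //.
  by apply: eq_bigO HP => w; rewrite addrAC GT.
have FF x : expands F x (F x).
  have [d d0 Hd] := lattice_regular_near x t0 n0.
  by apply: expands_near d0 _ (HF x) => w w0 wd; rewrite FE //; exact: Hd.
move=> x xr; rewrite -FE //.
apply: (quasi_periodic_eq0 t0 sL FF) => [y|y]; last exact: shift.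
by rewrite (shift 1 1) ?mul1r // => z; rewrite mul1r.
Qed.

End Lattices.

(** * Complex differentiability *)

Section Holomorphy.
Variable R : realType.
Local Notation C := R[i].
Implicit Types (f : C -> C) (z w c : C).

Lemma gt0_real (eps : C) : 0 < eps -> exists2 r : R, 0 < r & eps = r%:C%C.
Proof.
by case: eps => a b; rewrite ltcE /= => /andP[/eqP -> a0]; exists a.
Qed.

Lemma nrm_le_norm z (r : R) : (`|z| <= r%:C%C) = (nrm z <= r).
Proof. by rewrite norm_nrm lecR. Qed.

(** Differentiability through nrm, which avoids the topology of C^o. *)
Lemma holo_atP f z : holo_at f z <-> exists c : C, forall eps : R, 0 < eps ->
  exists2 d : R, 0 < d & forall w, w != 0 -> nrm w <= d ->
    nrm ((f (z + w) - f z) / w - c) <= eps.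
Proof.
split=> [/cvg_ex[c /cvgrPdist_le Hc]|[c Hc]].
  exists c => eps e0; have := Hc eps%:C%C; rewrite ltcR => /(_ e0).
  move=> /nbhs_ballP[d' /= /gt0_real[d d0 ->] Hd]; exists (d / 2) => [|w w0 wd].
    by rewrite divr_gt0.
  have wB : ball (0 : C^o) d%:C%C w.
    rewrite -ball_normE /ball_ /= sub0r norm_nrm nrmN ltcR; lra.
  have := Hd w wB w0; rewrite nrm_le_norm -nrmN opprB.
  by rewrite /GRing.scale /= mulr1 mulrC [w + z]addrC.
apply/cvg_ex; exists c; apply/cvgrPdist_le => _ /gt0_real[eps e0 ->].
have [d d0 Hd] := Hc eps e0.
have d0' : 0 < d%:C%C :> C by rewrite ltcR.
have h1 := @dnbhs0_le C C^o _ d0'.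
have h2 := nbhs_dnbhs_neq (0 : C^o).
apply: (filterS2 _ _ h1 h2) => w; rewrite nrm_le_norm => wd w0.
rewrite nrm_le_norm -nrmN opprB.
by have := Hd w w0 wd; rewrite /GRing.scale /= mulr1 mulrC [w + z]addrC.
Qed.

Lemma expands_holo f z : expands f z (f z) -> holo_at f z.
Proof.
move=> /(_ 2%N)[P P0 HP]; apply/holo_atP.
have [P1 E1] : exists Q, P - (f z)%:P = Q * 'X.
  by apply: poly_factorX; rewrite !hornerE P0 /=; ring.
exists P1.[0] => eps e0.
have Q0 : (P1 - (P1.[0])%:P).[0] = 0 by rewrite !hornerE /=; ring.
have /bigOP[K [r [K0 r0 r1 H]]] := bigOD (bigO_divX HP) (bigO_poly0 Q0).
have K1 : 0 < K + 1 by lra.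
exists (Num.min r (eps / (K + 1))); first by rewrite lt_min r0 divr_gt0.
move=> w w0; rewrite le_min => /andP[wr]; rewrite ler_pdivlMr // => we.
have := H w w0 wr; rewrite expr1 => h.
have E : P.[w] = f z + P1.[w] * w.
  have := congr1 (horner^~ w) E1; rewrite /= !hornerD hornerN hornerC hornerMX.
  by move=> /eqP; rewrite subr_eq => /eqP ->; rewrite addrC.
apply: le_trans (_ : K * nrm w <= _); last by have := nrm_ge0 w; nra.
apply: le_trans h; rewrite le_eqVlt; apply/orP; left; apply/eqP; congr nrm.
by rewrite E !hornerE /=; field.
Qed.

Definition pcont f z : Prop := forall eps : R, 0 < eps ->
  exists2 d : R, 0 < d & forall w, nrm w <= d -> nrm (f (z + w) - f z) <= eps.

Lemma holo_pcont f z : holo_at f z -> pcont f z.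
Proof.
move=> /holo_atP[c Hc] eps e0; have [d d0 Hd] := Hc 1 ltr01.
have c1 : 0 < nrm c + 1 by have := nrm_ge0 c; lra.
exists (Num.min d (eps / (nrm c + 1))); first by rewrite lt_min d0 divr_gt0.
move=> w; rewrite le_min => /andP[wd]; rewrite ler_pdivlMr // => we.
have [->|w0] := eqVneq w 0; first by rewrite addr0 subrr nrm0 ltW.
have h := Hd w w0 wd.
have -> : f (z + w) - f z = ((f (z + w) - f z) / w - c + c) * w by field.
rewrite nrmM mulrC; apply: le_trans we; apply: ler_wpM2l; first exact: nrm_ge0.
by apply: le_trans (nrmD _ _) _; rewrite addrC lerD2l.
Qed.

Lemma limn_eq (u : nat -> C) l :
  (forall eps : R, 0 < eps -> exists N : nat, forall m : nat,
     (N <= m)%N -> nrm (u m - l) <= eps) -> limn (u : nat -> C^o) = l.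
Proof.
move=> H; apply: cvg_lim; first exact: norm_hausdorff.
apply/cvgrPdist_le => _ /gt0_real[eps e0 ->]; have [N HN] := H eps e0.
exists N => // m Nm /=; rewrite nrm_le_norm -nrmN opprB; exact: HN.
Qed.

End Holomorphy.

(** * The theta series *)

Section GeometricSums.
Variable R : realType.
Local Notation C := R[i].
Implicit Types (u v : nat -> C) (l c : C) (f g : int -> C).

(** l is the sum of the series u; the geometric rate, which the theta series has,
    gives explicit tail estimates. *)
Definition gsum u l : Prop := exists A : R, forall N : nat,
  nrm (\sum_(i < N) u i - l) <= A * 2^-1 ^+ N.

Lemma gsum_cvg u l : gsum u l -> forall eps : R, 0 < eps ->
  exists N : nat, forall m, (N <= m)%N -> nrm (\sum_(i < m) u i - l) <= eps.
Proof.
move=> [A HA] eps e0.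
have A1 : 0 < `|A| + 1 by have := normr_ge0 A; lra.
pose r := (`|A| + 1) / eps.
exists (Num.truncn r).+1 => m hm; apply: le_trans (HA m) _.
have h1 : r < m%:R.
  apply: lt_le_trans (_ : (Num.truncn r).+1%:R <= _); last by rewrite ler_nat.
  by have /andP[] := truncn_itv (ltW (divr_gt0 A1 e0)).
have h2 : m%:R <= 2 ^+ m :> R by rewrite -natrX ler_nat ltnW // ltn_expl.
rewrite exprVn ler_pdivrMr ?exprn_gt0 //.
have h3 : `|A| + 1 <= eps * 2 ^+ m.
  move: h1; rewrite /r ltr_pdivrMr // => h1.
  by apply: le_trans (ltW h1) _; rewrite mulrC ler_pM2l.
by have := ler_norm A; lra.
Qed.

Lemma gsum_uniq u l l' : gsum u l -> gsum u l' -> l = l'.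
Proof.
move=> /gsum_cvg H /gsum_cvg H'; apply/eqP; rewrite -subr_eq0 -nrm_eq0.
rewrite eq_le nrm_ge0 andbT; apply/ler_addgt0Pr => eps e0; rewrite add0r.
have e2 : 0 < eps / 2 by rewrite divr_gt0.
have [N HN] := H _ e2; have [N' HN'] := H' _ e2.
have h := HN _ (leq_maxl N N'); have h' := HN' _ (leq_maxr N N').
move: h h'; set S := \sum_(i < _) _ => h h'.
have -> : l - l' = (S - l') - (S - l) by ring.
by apply: le_trans (nrmB _ _) _; lra.
Qed.

Lemma gsumD u v l l' : gsum u l -> gsum v l' -> gsum (fun i => u i + v i) (l + l').
Proof.
move=> [A HA] [B HB]; exists (A + B) => N.
rewrite big_split /= opprD addrACA mulrDl.
by apply: le_trans (nrmD _ _) _; exact: lerD (HA N) (HB N).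
Qed.

Lemma gsumZ c u l : gsum u l -> gsum (fun i => c * u i) (c * l).
Proof.
move=> [A HA]; exists (nrm c * A) => N.
rewrite -mulr_sumr -mulrBr nrmM -mulrA; by apply: ler_wpM2l; [exact: nrm_ge0 | exact: HA].
Qed.

Lemma eq_gsum u v l : u =1 v -> gsum u l -> gsum v l.
Proof. by move=> /funext ->. Qed.

Lemma gsum_tail u l : gsum u l -> gsum (fun i => u i.+1) (l - u 0%N).
Proof.
move=> [A HA]; exists (A / 2) => N.
have := HA N.+1; rewrite big_ord_recl /= exprS mulrA.
have -> : u 0%N + \sum_(i < N) u (bump 0 i) - l = \sum_(i < N) u i.+1 - (l - u 0%N).
  by rewrite (eq_bigr (fun i : 'I_N => u i.+1)) //; ring.
by [].
Qed.

Lemma gsum_cons u l c : gsum u l -> gsum (fun i => if i is j.+1 then u j else c) (c + l).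
Proof.
move=> [A HA]; exists (2 * `|A| + nrm (c + l)) => -[|N].
  rewrite big_ord0 sub0r nrmN expr0 mulr1 lerDr mulr_ge0 //.
rewrite big_ord_recl /= (eq_bigr (fun i : 'I_N => u i)) //.
rewrite opprD addrACA subrr add0r; apply: le_trans (HA N) _.
rewrite exprS mulrA; apply: ler_wpM2r; first by rewrite exprn_ge0 // invr_ge0.
by have := ler_norm A; have := nrm_ge0 (c + l); lra.
Qed.

Lemma geo_sum_le (N : nat) : \sum_(i < N) 2^-1 ^+ i <= 2 :> R.
Proof.
suff -> : \sum_(i < N) 2^-1 ^+ i = 2 - 2 * 2^-1 ^+ N :> R.
  by rewrite lerBlDr lerDl mulr_ge0 // exprn_ge0 // invr_ge0.
elim: N => [|N IH]; first by rewrite big_ord0 expr0; ring.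
rewrite big_ord_recr /= IH exprS; set t := 2^-1 ^+ N.
by have := divff (_ : 2 != 0 :> R); rewrite pnatr_eq0 => /(_ isT); nra.
Qed.

Lemma gsum_le u l (B : R) : gsum u l -> (forall i, nrm (u i) <= B * 2^-1 ^+ i) ->
  nrm l <= 2 * B.
Proof.
move=> /gsum_cvg H HB; apply/ler_addgt0Pr => eps e0.
have [N HN] := H _ e0; have h := HN N (leqnn N).
have B0 : 0 <= B by have := HB 0%N; rewrite expr0 mulr1; apply: le_trans (nrm_ge0 _).
have : nrm (\sum_(i < N) u i) <= 2 * B.
  apply: le_trans (nrm_sum _ _ _) _.
  apply: (@le_trans _ _ (\sum_(i < N) B * 2^-1 ^+ i)); first by apply: ler_sum => i _; exact: HB.
  by rewrite -mulr_sumr mulrC; apply: ler_wpM2r => //; exact: geo_sum_le.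
have := nrm_triangle l (l - \sum_(i < N) u i).
have -> : l - (l - \sum_(i < N) u i) = \sum_(i < N) u i by ring.
by rewrite -[nrm (l - _)]nrmN opprB; lra.
Qed.

Lemma real_gsum (u : nat -> R) (A : R) : (forall i, `|u i| <= A * 2^-1 ^+ i) ->
  exists l : R, forall N, `|\sum_(i < N) u i - l| <= 2 * A * 2^-1 ^+ N.
Proof.
move=> H.
have A0 : 0 <= A by have := H 0%N; rewrite expr0 mulr1; apply: le_trans.
have cn : cvgn [normed series u].
  apply: (series_le_cvg (v_ := fun i => A * 2^-1 ^+ i)) => [i|i|i|].
  - exact: normr_ge0.
  - by rewrite mulr_ge0 // exprn_ge0 // invr_ge0.
  - exact: H.
  have -> : series (fun i => A * 2^-1 ^+ i : R) = series (geometric A 2^-1).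
    by [].
  by apply: is_cvg_geometric_series; rewrite ger0_norm ?invr_ge0 //; lra.
have /cvgrPdist_le Hl := normed_cvg cn.
exists (limn (series u)) => N; apply/ler_addgt0Pr => eps e0.
have [M _ HM] := Hl eps e0.
have := HM (maxn M N) (leq_maxl _ _); rewrite /series /= big_mkord => h.
have [k kE] : exists k, maxn M N = (N + k)%N.
  by exists (maxn M N - N)%N; rewrite subnKC // leq_maxr.
rewrite kE big_split_ord /= in h.
have h2 : `|\sum_(i < k) u (N + i)%N| <= 2 * A * 2^-1 ^+ N.
  apply: le_trans (ler_norm_sum _ _ _) _.
  apply: (@le_trans _ _ (\sum_(i < k) A * 2^-1 ^+ (N + i))).
    by apply: ler_sum => i _; exact: H.
  under eq_bigr do rewrite exprD mulrA.
  rewrite -mulr_sumr mulrC -mulrA; apply: ler_wpM2r; last exact: geo_sum_le.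
  by rewrite mulr_ge0 // exprn_ge0 // invr_ge0.
set S := \sum_(i < N) _ in h *; set T := \sum_(i < k) _ in h h2.
set L := limn _ in h *.
have -> : S - L = - (L - (S + T)) - T by ring.
by apply: le_trans (ler_normB _ _) _; rewrite normrN addrC; apply: lerD.
Qed.

(** Geometric domination bounds the tails geometrically, in the real and in the
    imaginary part. *)
Lemma gsum_ex u (A : R) : (forall i, nrm (u i) <= A * 2^-1 ^+ i) -> exists l, gsum u l.
Proof.
move=> H.
have [a Ha] := @real_gsum (fun i => complex.Re (u i)) A (fun i => le_trans (Re_le_nrm _) (H i)).
have [b Hb] := @real_gsum (fun i => complex.Im (u i)) A (fun i => le_trans (Im_le_nrm _) (H i)).
exists (a +i* b)%C, (4 * A) => N.
have ReS : complex.Re (\sum_(i < N) u i) = \sum_(i < N) complex.Re (u i).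
  by apply: (big_morph (@complex.Re R) (@ReD R)).
have ImS : complex.Im (\sum_(i < N) u i) = \sum_(i < N) complex.Im (u i).
  by apply: (big_morph (@complex.Im R) (@ImD R)).
apply: le_trans (nrm_le_ReIm _) _; rewrite ReD ImD ReN ImN ReS ImS /=.
have -> : 4 * A * 2^-1 ^+ N = 2 * A * 2^-1 ^+ N + 2 * A * 2^-1 ^+ N by ring.
exact: lerD (Ha N) (Hb N).
Qed.

Lemma gsum_limn u l : gsum u l -> limn (series u : nat -> C^o) = l.
Proof.
move=> /gsum_cvg H; apply: limn_eq => eps e0; have [N HN] := H eps e0.
by exists N => m /HN; rewrite /series /= big_mkord.
Qed.

(** The two halves are summed separately, as in the definition of theta. *)
Definition zsum f l : Prop := exists l1 l2, [/\ gsum (fun m : nat => f m%:Z) l1,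
  gsum (fun m : nat => f (- m.+1%:Z)) l2 & l = l1 + l2].

Lemma zsum_uniq f l l' : zsum f l -> zsum f l' -> l = l'.
Proof.
move=> [a [b [Ha Hb ->]]] [a' [b' [Ha' Hb' ->]]].
by rewrite (gsum_uniq Ha Ha') (gsum_uniq Hb Hb').
Qed.

Lemma eq_zsum f g l : f =1 g -> zsum f l -> zsum g l.
Proof. by move=> /funext ->. Qed.

Lemma zsumD f g l l' : zsum f l -> zsum g l' -> zsum (fun m => f m + g m) (l + l').
Proof.
move=> [a [b [Ha Hb ->]]] [a' [b' [Ha' Hb' ->]]].
by exists (a + a'), (b + b'); split; [exact: gsumD|exact: gsumD|rewrite addrACA].
Qed.

Lemma zsumZ c f l : zsum f l -> zsum (fun m => c * f m) (c * l).
Proof.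
move=> [a [b [Ha Hb ->]]].
by exists (c * a), (c * b); split; [exact: gsumZ|exact: gsumZ|rewrite mulrDr].
Qed.

Lemma zsum_sum (I : finType) (F : I -> int -> C) (l : I -> C) :
  (forall i, zsum (F i) (l i)) -> zsum (fun m => \sum_i F i m) (\sum_i l i).
Proof.
move=> H; elim: (index_enum I) => [|i s IH].
  rewrite big_nil; apply: (@eq_zsum (fun=> 0)) => [m|]; first by rewrite big_nil.
  exists 0, 0; split; last by rewrite addr0.
    by exists 0 => N; rewrite big1 // subrr nrm0 mul0r.
  by exists 0 => N; rewrite big1 // subrr nrm0 mul0r.
rewrite big_cons; apply: eq_zsum (zsumD (H i) IH) => m; by rewrite big_cons.
Qed.

(** One term moves from one half to the other. *)
Lemma zsum_shift f l : zsum f l -> zsum (fun m => f (m + 1)) l.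
Proof.
move=> [a [b [Ha Hb ->]]]; exists (a - f 0), (f 0 + b); split.
- by apply: eq_gsum (gsum_tail Ha) => m; rewrite -PoszD addn1.
- apply: eq_gsum (gsum_cons (f 0) Hb) => -[|m].
    by congr f; lia.
  by congr f; lia.
- by rewrite addrA subrK.
Qed.

Lemma zsum_opp f l : zsum f l -> zsum (fun m => f (- m)) l.
Proof.
move=> [a [b [Ha Hb ->]]]; exists (f 0 + b), (a - f 0); split.
- by apply: eq_gsum (gsum_cons (f 0) Hb) => -[|m].
- by apply: eq_gsum (gsum_tail Ha) => m; rewrite opprK.
- by ring.
Qed.

Lemma half_exp_le (m : nat) : 2^-1 ^+ m.+1 <= 2^-1 ^+ m :> R.
Proof.
have : 0 <= 2^-1 ^+ m :> R by rewrite exprn_ge0 // invr_ge0.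
by rewrite exprS; lra.
Qed.

Lemma zsum_le f l (B : R) : zsum f l ->
  (forall m, nrm (f m) <= B * 2^-1 ^+ `|m|%N) -> nrm l <= 4 * B.
Proof.
move=> [a [b [Ha Hb ->]]] H.
have B0 : 0 <= B by have := H 0; rewrite expr0 mulr1; apply: le_trans (nrm_ge0 _).
have h1 := gsum_le Ha (fun m => H m%:Z).
have h2 : nrm b <= 2 * B.
  apply: (gsum_le Hb) => m; apply: le_trans (H _) _.
  by apply: ler_wpM2l => //; rewrite abszN /= half_exp_le.
by apply: le_trans (nrmD _ _) _; lra.
Qed.

Lemma zsum_ex f (B : R) : (forall m, nrm (f m) <= B * 2^-1 ^+ `|m|%N) ->
  exists l, zsum f l.
Proof.
move=> H.
have B0 : 0 <= B by have := H 0; rewrite expr0 mulr1; apply: le_trans (nrm_ge0 _).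
have [a Ha] := @gsum_ex (fun m => f m%:Z) B (fun m => H m%:Z).
have [|b Hb] := @gsum_ex (fun m => f (- m.+1%:Z)) B.
  move=> m; apply: le_trans (H _) _.
  by apply: ler_wpM2l => //; rewrite abszN /= half_exp_le.
by exists (a + b), a, b.
Qed.

End GeometricSums.

Section ThetaSeries.
Variable R : realType.
Local Notation C := R[i].
Variable tau : C.
Hypothesis tau_gt0 : 0 < complex.Im tau.
Implicit Types (z w : C) (m : int).

Lemma nrm_sign m : nrm ((-1 : C) ^ m) = 1.
Proof.
by case: m => m; rewrite -?exprnP ?NegzE -?exprnN ?nrmV nrmX nrmN nrm1 expr1n ?invr1.
Qed.

Lemma nrm_theta_term z m : nrm (theta_term tau z m) =
  expR (- (2 * pi * (m%:~R * complex.Im z + 2^-1 * (m * (m - 1))%:~R * complex.Im tau))).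
Proof.
rewrite /theta_term nrmM nrm_sign mul1r nrm_e; congr (expR (- (_ * _))).
have -> : (2^-1 : C) = (2^-1 : R)%:C%C by rewrite fmorphV rmorph_nat.
by rewrite ImD !(ImM, ReM, Im_int, Re_int) /= !(mul0r, mulr0, addr0, subr0, add0r).
Qed.

(* Completing the square: -|m|^2 T dominates any linear exponent. *)
Lemma theta_term_bound z (B : R) : exists2 A : R, 0 <= A & forall m,
  nrm (theta_term tau z m) * expR (B * `|m|%N%:R) <= A * 2^-1 ^+ `|m|%N.
Proof.
pose T := pi * complex.Im tau; have T0 : 0 < T by rewrite mulr_gt0 // pi_gt0.
pose D := 2 * pi * `|complex.Im z| + T + B + 1.
exists (expR (D ^+ 2 / (4 * T))); first exact: expR_ge0.
move=> m; have e2 : 2^-1 ^+ `|m|%N >= expR (- (`|m|%N%:R)) :> R.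
  rewrite expRN exprVn lef_pV2 ?posrE ?expR_gt0 ?exprn_gt0 //.
  have -> : expR (`|m|%N%:R) = expR 1 ^+ `|m|%N :> R by rewrite -expRM_natl mulr1.
  by apply: lerXn2r; rewrite ?nnegrE ?expR_ge0 //; have := expR_ge1Dx (1 : R); lra.
apply: le_trans (ler_wpM2l (expR_ge0 _) e2).
rewrite nrm_theta_term -!expRD ler_expR.
set k := (`|m|%N%:R : R); have k0 : 0 <= k by rewrite ler0n.
have mk : k = `|m%:~R : R| by rewrite /k -intr_norm -abszE.
rewrite intrM intrB /= -lerBrDr.
have h1 : - (2 * pi * (m%:~R * complex.Im z)) <= 2 * pi * `|complex.Im z| * k.
  have := ler_norm (- (m%:~R * complex.Im z)); rewrite normrN normrM -mk => h.
  rewrite -subr_ge0 (_ : _ - _ = 2 * pi * (k * `|complex.Im z| - - (m%:~R * complex.Im z))).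
    by rewrite mulr_ge0 ?subr_ge0 // mulr_ge0 // pi_ge0.
  by ring.
have h2 : (m%:~R : R) <= k by rewrite mk ler_norm.
have h3 : (m%:~R : R) * m%:~R = k ^+ 2.
  by rewrite mk real_normK ?num_real // expr2.
have h4 : D * k - T * k ^+ 2 <= D ^+ 2 / (4 * T).
  rewrite -subr_ge0 (_ : _ - _ = (2 * T * k - D) ^+ 2 / (4 * T)).
    by rewrite divr_ge0 ?sqr_ge0 // mulr_ge0 // ltW.
  by field; rewrite gt_eqF.
suff : - (2 * pi * (m%:~R * complex.Im z + 2^-1 * (m%:~R * (m%:~R - 1)) * complex.Im tau)) =
   - (2 * pi * (m%:~R * complex.Im z)) - T * k ^+ 2 + T * m%:~R.
  move=> ->; have h5 : T * m%:~R <= T * k by rewrite ler_pM2l.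
  by move: h4; rewrite /D !mulrDl mul1r; lra.
by rewrite -h3 /T; field.
Qed.

Lemma zsum_theta z : zsum (theta_term tau z) (theta tau z).
Proof.
have [A A0 HA] := theta_term_bound z 0.
have [l Hl] : exists l, zsum (theta_term tau z) l.
  by apply: (@zsum_ex _ _ A) => m; have := HA m; rewrite mul0r expR0 mulr1.
suff -> : theta tau z = l by [].
by case: Hl => [a [b [Ha Hb ->]]]; rewrite /theta (gsum_limn Ha) (gsum_limn Hb).
Qed.

Lemma theta_add1 z : theta tau (z + 1) = theta tau z.
Proof.
apply: zsum_uniq (zsum_theta _) _; apply: eq_zsum (zsum_theta z) => m.
by rewrite /theta_term [m%:~R * (z + 1)]mulrDr mulr1 [in RHS]addrAC [in RHS]eD e_int mulr1.
Qed.

Lemma sign_succ m : (-1 : C) ^ (m + 1) = - (-1) ^ m.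
Proof. by rewrite exprzDr ?unitrN1 ?unitr1 // expr1z mulrN1. Qed.

Lemma sign_opp m : (-1 : C) ^ (- m) = (-1) ^ m.
Proof. by rewrite -exprz_inv invrN invr1. Qed.

(** Reindexing m by m + 1. *)
Lemma theta_add_tau z : theta tau (z + tau) = - e (- z) * theta tau z.
Proof.
apply: zsum_uniq (zsum_theta _) _.
apply: eq_zsum (zsumZ (- e (- z)) (zsum_shift (zsum_theta z))) => m.
rewrite /theta_term sign_succ !mulNr mulrN opprK mulrCA -eD; congr (_ * e _).
by rewrite !intrM !(intrD, intrB) /=; field.
Qed.

(** Reindexing m by 1 - m. *)
Lemma theta_opp z : theta tau (- z) = - e (- z) * theta tau z.
Proof.
apply: zsum_uniq (zsum_theta _) _.
apply: eq_zsum (zsumZ (- e (- z)) (zsum_opp (zsum_shift (zsum_theta z)))) => m.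
rewrite /theta_term sign_succ sign_opp !mulNr mulrN opprK mulrCA -eD; congr (_ * e _).
by rewrite !intrM !(intrD, intrB) !rmorphN /=; field.
Qed.

(** theta is odd up to the factor e(-z), which is 1 at the origin. *)
Lemma theta_0 : theta tau 0 = 0.
Proof.
have := theta_opp 0; rewrite oppr0 e0 mulN1r => /eqP.
by rewrite -addr_eq0 -mulr2n mulrn_eq0 /= => /eqP.
Qed.

Lemma expR_ge_pow (x : R) (k : nat) : 0 <= x -> x ^+ k <= k`!%:R * expR x.
Proof.
move=> x0; case: k => [|k].
  by rewrite expr0 fact0 mul1r; have := expR_ge1Dx x; lra.
have := expR_ge1Dxn k x0 => h; rewrite mulrC -ler_pdivrMr ?ltr0n ?fact_gt0 //; lra.
Qed.

(** Term by term: the remainder of the Taylor polynomial of the m-th term is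
    dominated by theta_term_bound, uniformly near z. *)
Lemma expands_theta z : expands (theta tau) z (theta tau z).
Proof.
suff H M : exists2 P : {poly C}, P.[0] = theta tau z &
    bigO M.+1 (fun w => theta tau (z + w) - P.[w]).
  by move=> m; have [P P0 HP] := H m; exists P => //; apply: bigO_weaken HP.
pose c m := theta_term tau z m.
have moment (k : nat) : exists l, zsum (fun m => c m * m%:~R ^+ k) l.
  have [A A0 HA] := theta_term_bound z 1.
  apply: (@zsum_ex _ _ (k`!%:R * A)) => m.
  rewrite nrmM nrmX nrm_int -intr_norm -abszE -mulrA.
  apply: le_trans (ler_wpM2l (ler0n _ _) (HA m)); rewrite mulrCA mul1r.
  apply: ler_wpM2l; first exact: nrm_ge0.
  by apply: expR_ge_pow; rewrite ler0n.
have [s Hs] := choice moment.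
pose P : {poly C} := \poly_(k < M.+1) ((k`!%:R)^-1 * twopii R ^+ k * s k).
have PE w : zsum (fun m => c m * (exp_poly R M.+1).[twopii R * (m%:~R * w)]) P.[w].
  rewrite /P horner_poly.
  rewrite (eq_bigr (fun k : 'I_M.+1 => (k`!%:R)^-1 * twopii R ^+ k * w ^+ k * s k));
    last by move=> k _; ring.
  apply: eq_zsum (zsum_sum (fun k : 'I_M.+1 =>
     zsumZ ((k`!%:R)^-1 * twopii R ^+ k * w ^+ k) (Hs k))) => m.
  rewrite /exp_poly horner_poly mulr_sumr; apply: eq_bigr => k _.
  by rewrite !exprMn; ring.
have [A A0 HA] := theta_term_bound z (6 * pi).
exists P.
  rewrite horner_coef0 coef_poly /= fact0 invr1 expr0 !mul1r.
  apply: zsum_uniq (Hs 0%N) _; apply: eq_zsum (zsum_theta z) => m.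
  by rewrite expr0 mulr1.
exists (4 * ((M.+1)`!%:R * A)), 1; split=> // w _ w1.
have Hr : zsum (fun m => c m * (e (m%:~R * w) - (exp_poly R M.+1).[twopii R * (m%:~R * w)]))
    (theta tau (z + w) - P.[w]).
  have := zsumD (zsum_theta (z + w)) (zsumZ (-1) (PE w)); rewrite mulN1r.
  apply: eq_zsum => m; rewrite /c /theta_term mulrDr addrAC eD; ring.
rewrite -mulrA; apply: (zsum_le Hr) => m.
rewrite nrmM; apply: le_trans (ler_wpM2l (nrm_ge0 _) (e_taylor _ _)) _.
rewrite (nrmM m%:~R) nrm_int -intr_norm -abszE; set k := (`|m|%N%:R : R).
have k0 : 0 <= k by rewrite ler0n.
have p0 : 0 <= (pi : R) by exact: pi_ge0.
have r0 := nrm_ge0 w.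
have h1 : (4 * pi * k) ^+ M.+1 <= (M.+1)`!%:R * expR (4 * pi * k).
  by apply: expR_ge_pow; rewrite !mulr_ge0.
have h2 : expR (2 * pi * (k * nrm w)) <= expR (2 * pi * k).
  by rewrite ler_expR; apply: ler_wpM2l; rewrite ?mulr_ge0 // ler_piMr.
have -> : 4 * pi * (k * nrm w) = 4 * pi * k * nrm w by ring.
have f0 : 0 <= (M.+1)`!%:R :> R by rewrite ler0n.
have H3 : (4 * pi * k * nrm w) ^+ M.+1 * expR (2 * pi * (k * nrm w)) <=
    (M.+1)`!%:R * expR (4 * pi * k) * nrm w ^+ M.+1 * expR (2 * pi * k).
  rewrite exprMn; apply: ler_pM => //; rewrite ?mulr_ge0 ?exprn_ge0 ?expR_ge0 ?mulr_ge0 //.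
  by apply: ler_wpM2r => //; rewrite exprn_ge0.
apply: le_trans (ler_wpM2l (nrm_ge0 _) H3) _.
have := HA m; rewrite -/k -/(c m) => h.
have -> : nrm (c m) * ((M.+1)`!%:R * expR (4 * pi * k) * nrm w ^+ M.+1 * expR (2 * pi * k)) =
    (M.+1)`!%:R * nrm w ^+ M.+1 * (nrm (c m) * expR (6 * pi * k)).
  have -> : 6 * pi * k = 4 * pi * k + 2 * pi * k by ring.
  by rewrite expRD; ring.
have -> : (M.+1)`!%:R * A * nrm w ^+ M.+1 * 2^-1 ^+ `|m|%N =
    (M.+1)`!%:R * nrm w ^+ M.+1 * (A * 2^-1 ^+ `|m|%N) by ring.
by apply: ler_wpM2l => //; rewrite mulr_ge0 // exprn_ge0.
Qed.

End ThetaSeries.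

(** * The finite triple product *)

Section QBinomial.
Variable F : fieldType.
Variable q : F.
Hypothesis q_nroot : forall m : nat, 1 - q ^+ m.+1 != 0.

(** The q-factorial up to a power of 1 - q. *)
Definition qpoch (m : nat) : F := \prod_(i < m) (1 - q ^+ i.+1).

Lemma qpochS m : qpoch m.+1 = qpoch m * (1 - q ^+ m.+1).
Proof. by rewrite /qpoch big_ord_recr. Qed.

Lemma qpoch_neq0 m : qpoch m != 0.
Proof. by apply/prodf_neq0 => i _; exact: q_nroot. Qed.

Definition qbin_coef (M j : nat) : F :=
  q ^+ 'C(j, 2) * qpoch M / (qpoch j * qpoch (M - j)).

Lemma qbin_coefS M j : (j < M)%N ->
  qbin_coef M.+1 j.+1 = qbin_coef M j.+1 + q ^+ M * qbin_coef M j.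
Proof.
move=> jM; rewrite /qbin_coef subSS.
have [k kE] : exists k, (M - j)%N = k.+1 by exists (M - j).-1; rewrite prednK ?subn_gt0.
have -> : (M - j.+1)%N = k by rewrite subnS kE.
have -> : q ^+ M = q ^+ j * q ^+ k.+1 by rewrite -exprD -kE subnKC // ltnW.
rewrite kE binS bin1 exprD !qpochS.
have -> : q ^+ M.+1 = q ^+ j.+1 * q ^+ k.+1.
  by rewrite -exprD addSn -kE subnKC // ltnW.
have := qpoch_neq0 j; have := qpoch_neq0 k; have := q_nroot k; have := q_nroot j.
rewrite exprS; set a := q ^+ j; set b := q ^+ k.+1 => h1 h2 h3 h4.
by field; rewrite h1 h2 h3 h4.
Qed.

(** Gauss's q-binomial theorem, by the q-Pascal rule qbin_coefS. *)
Lemma qbinomial M x :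
  \prod_(i < M) (1 + q ^+ i * x) = \sum_(j < M.+1) qbin_coef M j * x ^+ j.
Proof.
have c0 N : qbin_coef N 0 = 1.
  by rewrite /qbin_coef bin0n expr0 mul1r subn0 /qpoch big_ord0 mul1r divff ?qpoch_neq0.
have cM N : qbin_coef N.+1 N.+1 = q ^+ N * qbin_coef N N.
  rewrite /qbin_coef !subnn binS bin1 exprD /qpoch !big_ord0 !mulr1.
  by rewrite !mulfK ?qpoch_neq0 // mulrC.
elim: M => [|M IH]; first by rewrite big_ord0 big_ord1 c0 mul1r expr0.
rewrite big_ord_recr /= IH mulrDr mulr1 [in RHS]big_ord_recl [in RHS]big_ord_recr /=.
rewrite !c0 cM big_ord_recl /= c0 -!addrA; congr (_ + _).
under [in RHS]eq_bigr => i _.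
  rewrite /bump /= add1n qbin_coefS // mulrDl; over.
rewrite [in RHS]big_split /= -!addrA; congr (_ + _).
have -> : 1 * x ^+ 0 + \sum_(i < M) qbin_coef M (bump 0 i) * x ^+ bump 0 i =
  \sum_(j < M.+1) qbin_coef M j * x ^+ j by rewrite [in RHS]big_ord_recl c0.
rewrite mulr_suml big_ord_recr /=; congr (_ + _); last by rewrite exprS; ring.
by apply: eq_bigr => i _; rewrite ?add1n exprS; ring.
Qed.

End QBinomial.

Section InfiniteProducts.
Variable R : realType.
Local Notation C := R[i].
Implicit Types (r s : R) (q : C).

Lemma geo_le r (m : nat) : 0 <= r < 1 -> \sum_(i < m) r ^+ i <= (1 - r)^-1.
Proof.
move=> /andP[r0 r1]; have r1' : 0 < 1 - r by lra.
rewrite -(@ler_pM2l _ (1 - r)) // divff ?gt_eqF // -opprB mulNr -subrX1 opprB.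
by rewrite lerBlDr lerDl exprn_ge0.
Qed.

(** The inverses 1/(1-t) are at most exp(t/(1-s)) for t <= s. *)
Lemma prod_lower r s : 0 <= r < 1 -> 0 <= s < 1 ->
  exists2 k : R, 0 < k & forall m : nat, k <= \prod_(i < m) (1 - s * r ^+ i).
Proof.
move=> rI /andP[s0 s1]; have s1' : 0 < 1 - s by lra.
have := rI => /andP[r0 r1].
exists (expR (- (s / (1 - s) * (1 - r)^-1))); first exact: expR_gt0.
move=> m; apply: (@le_trans _ _ (expR (- (s / (1 - s) * \sum_(i < m) r ^+ i)))).
  rewrite ler_expR lerN2; apply: ler_wpM2l; first by rewrite divr_ge0 // ltW.
  exact: geo_le.
elim: m => [|m IH]; first by rewrite !big_ord0 mulr0 oppr0 expR0.
rewrite !big_ord_recr /= mulrDr opprD expRD.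
apply: ler_pM => //; try exact: expR_ge0.
set t := r ^+ m; have t0 : 0 <= t by rewrite exprn_ge0.
have t1 : t <= 1 by rewrite exprn_ile1 // ltW.
have st : s * t <= s by rewrite ler_piMr.
have st1 : 0 < 1 - s * t by lra.
have st0 : 0 <= s * t by rewrite mulr_ge0.
have h : (1 - s * t)^-1 <= expR (s / (1 - s) * t).
  apply: le_trans (expR_ge1Dx _).
  rewrite -[_^-1]mul1r ler_pdivrMr // mulrDl mul1r.
  have : s * t <= s / (1 - s) * t * (1 - s * t).
    have -> : s / (1 - s) * t * (1 - s * t) = s * t * ((1 - s * t) / (1 - s)) by ring.
    by apply: ler_peMr => //; rewrite ler_pdivlMr // mul1r; lra.
  by lra.
rewrite expRN -[leRHS]invrK lef_pV2 // posrE ?expR_gt0 // invr_gt0 //.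
Qed.

Section Q.
Variable q : C.
Hypothesis q1 : nrm q < 1.
Let r := nrm q.
Let rI : 0 <= r < 1. Proof. by rewrite nrm_ge0 q1. Qed.

Lemma nrm_1B (x : C) : 1 - nrm x <= nrm (1 - x).
Proof. by have := nrm_triangle 1 x; rewrite nrm1. Qed.

Lemma qpoch_lower : exists2 k : R, 0 < k & forall m, k <= nrm (qpoch q m).
Proof.
have [k k0 Hk] := prod_lower rI rI; exists k => // m.
apply: le_trans (Hk m) _; rewrite /qpoch nrm_prod; apply: ler_prod => i _.
rewrite -exprS; have /andP[r0 r1] := rI.
rewrite subr_ge0 exprn_ile1 ?(ltW r1) //=.
by apply: le_trans (nrm_1B _); rewrite nrmX.
Qed.

Lemma qpoch_upper : exists2 U : R, 0 < U & forall m, nrm (qpoch q m) <= U.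
Proof.
have /andP[r0 r1] := rI; exists (expR (1 - r)^-1); first exact: expR_gt0.
move=> m; apply: (@le_trans _ _ (expR (\sum_(i < m) r ^+ i))); last first.
  by rewrite ler_expR; exact: geo_le.
elim: m => [|m IH]; first by rewrite /qpoch !big_ord0 nrm1 expR0.
rewrite qpochS nrmM big_ord_recr /= expRD; apply: ler_pM => //; try exact: nrm_ge0.
apply: le_trans (nrmB _ _) _; rewrite nrm1 nrmX -/r.
apply: le_trans (expR_ge1Dx _); rewrite lerD2l exprS.
by rewrite ler_piMl ?exprn_ge0 // ltW.
Qed.

(** Consecutive values differ by at most a constant times r^i, a geometric series. *)
Lemma qpoch_cauchy : exists2 K : R, 0 <= K & forall a b, (a <= b)%N ->
  nrm (qpoch q b - qpoch q a) <= K * r ^+ a.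
Proof.
have /andP[r0 r1] := rI; have [U U0 HU] := qpoch_upper.
have r1' : 0 <= (1 - r)^-1 by rewrite invr_ge0; lra.
exists (U * (1 - r)^-1); first by rewrite mulr_ge0 // ltW.
move=> a b ab; rewrite -(subnKC ab); set k := (b - a)%N.
apply: (@le_trans _ _ (U * (\sum_(i < k) r ^+ i) * r ^+ a)); last first.
  apply: ler_wpM2r; first by rewrite exprn_ge0.
  by apply: ler_wpM2l; [exact: ltW | exact: geo_le].
elim: k => [|k IH]; first by rewrite addn0 subrr nrm0 big_ord0 mulr0 mul0r.
rewrite addnS qpochS big_ord_recr /= [U * _]mulrDr [(_ + _) * r ^+ a]mulrDl.
have -> : qpoch q (a + k) * (1 - q ^+ (a + k).+1) - qpoch q a =
  (qpoch q (a + k) - qpoch q a) - qpoch q (a + k) * q ^+ (a + k).+1 by ring.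
apply: le_trans (nrmB _ _) _; apply: lerD => //.
rewrite nrmM -mulrA; apply: ler_pM => //; try exact: nrm_ge0.
by rewrite nrmX -/r -exprD [(k + a)%N]addnC exprS ler_piMl ?exprn_ge0 ?(ltW r1).
Qed.

End Q.
End InfiniteProducts.

Section ThetaZeros.
Variable R : realType.
Local Notation C := R[i].
Variable tau : C.
Hypothesis tau_gt0 : 0 < complex.Im tau.
Implicit Types (z w : C) (m : int).
Let q := e tau.
Let r := nrm q.

Let q0 : q != 0. Proof. exact: e_neq0. Qed.

Lemma rE : r = expR (- (2 * pi * complex.Im tau)). Proof. exact: nrm_e. Qed.

Let r0 : 0 < r. Proof. by rewrite rE expR_gt0. Qed.

Let r1 : r < 1.
Proof. by rewrite rE -[X in _ < X]expR0 ltr_expR oppr_lt0 !mulr_gt0 ?pi_gt0. Qed.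

Let q_nroot (m : nat) : 1 - q ^+ m.+1 != 0.
Proof.
rewrite -nrm_gt0; apply: lt_le_trans (nrm_1B _).
by rewrite nrmX -/r subr_gt0 exprn_ilt1 // ltW.
Qed.

(** The partial products of the Jacobi triple product, up to the factors 1 - q^i. *)
Definition theta_prod (N : nat) z : C :=
  \prod_(i < N) ((1 - q ^+ i * e z) * (1 - q ^+ i.+1 / e z)).

(** The q-binomial coefficient (2N over j) divided by the central one. *)
Definition qbin_ratio (N j : nat) : C :=
  qpoch q N ^+ 2 / (qpoch q j * qpoch q (N + N - j)).

Lemma binE (j : nat) : 'C(j, 2)%:R = (j%:R * (j%:R - 1)) / 2 :> C.
Proof.
apply: (mulIf (_ : 2 != 0 :> C)); first by rewrite pnatr_eq0.
rewrite divfK ?pnatr_eq0 // -natrM mulnC -mul_bin_diag bin1.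
rewrite natrM; case: j => [|j]; first by rewrite !mul0r.
by congr (_ * _); rewrite /= -natr1 addrK.
Qed.

(** The finite triple product: the q-binomial theorem at x = - q^-N e(z). *)
Lemma finite_triple_product N z :
  theta_prod N z * (qpoch q N ^+ 2 / qpoch q (N + N)) =
  \sum_(j < (N + N).+1) theta_term tau z (j%:Z - N%:Z) * qbin_ratio N j.
Proof.
pose x : C := - e (z - N%:R * tau).
pose F : C := (-1) ^+ N * e (N%:R * z - (N%:R * (N%:R + 1) / 2) * tau).
have F0 : F != 0 by rewrite mulf_neq0 ?e_neq0 // signr_eq0.
have qE (i : nat) : q ^+ i = e (i%:R * tau) by rewrite eX.
have lhs : \prod_(i < N + N) (1 + q ^+ i * x) = theta_prod N z * F.
  rewrite big_split_ord /= /theta_prod big_split /= mulrC -mulrA; congr (_ * _).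
    apply: eq_bigr => i _; rewrite /x mulrN !qE -eD natrD; congr (1 - _).
    by rewrite -eD; congr e; ring.
  rewrite (reindex_inj rev_ord_inj) /=.
  have -> : F = \prod_(i < N) - e (z - i.+1%:R * tau).
    rewrite /F; elim: (N) => [|M IH].
      by rewrite big_ord0 expr0 !mul0r subrr e0 mulr1.
    rewrite big_ord_recr /= -IH exprS mulN1r mulrN mulNr -[X in _ = - X]mulrA -eD; congr (- (_ * e _)).
    by rewrite -natr1; field.
  rewrite -big_split /=; apply: eq_bigr => i _.
  have -> : q ^+ (N - i.+1) = e (N%:R * tau - i.+1%:R * tau).
    by rewrite qE natrB // mulrBl.
  by rewrite /x qE !eB; field; rewrite !e_neq0.
have := qbinomial q_nroot (N + N) x; rewrite lhs => H.
apply: (mulIf F0); rewrite mulrAC H !mulr_suml; apply: eq_bigr => j _.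
have E : q ^+ 'C(j, 2) * x ^+ j = theta_term tau z (j%:Z - N%:Z) * F.
  rewrite /theta_term /F mulrACA -eD.
  have -> : (-1 : C) ^ (j%:Z - N%:Z) * (-1) ^+ N = (-1) ^+ j.
    by rewrite [(-1) ^+ N]exprnP -exprzDr ?unitrN1 // subrK.
  rewrite /x [(- e _) ^+ _]exprNn qE [e (z - _) ^+ _]eX mulrCA -eD binE; congr (_ * e _).
  by rewrite intrM !intrB /=; field.
rewrite /qbin_coef /qbin_ratio.
have [h1 [h2 h3]] : [/\ qpoch q (N + N) != 0, qpoch q j != 0 & qpoch q (N + N - j) != 0].
  by split; exact: qpoch_neq0.
have -> : theta_term tau z (j%:Z - N%:Z) * (qpoch q N ^+ 2 / (qpoch q j * qpoch q (N + N - j))) * F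
  = (q ^+ 'C(j, 2) * x ^+ j) * (qpoch q N ^+ 2 / (qpoch q j * qpoch q (N + N - j))).
  by rewrite E; ring.
by field; rewrite h1 h2 h3.
Qed.

End ThetaZeros.

(** * The triple product and the zeros of theta *)

Section FiniteZsum.
Variable R : realType.
Local Notation C := R[i].

Lemma gsum_fin (u : nat -> C) (M : nat) : (forall i, (M <= i)%N -> u i = 0) ->
  gsum u (\sum_(i < M) u i).
Proof.
move=> H; exists (2 ^+ M * \sum_(i < M) nrm (u i)) => N.
have S0 : 0 <= \sum_(i < M) nrm (u i) by apply: sumr_ge0 => i _; exact: nrm_ge0.
have [MN|NM] := leqP M N.
  rewrite -(subnKC MN) big_split_ord /= [X in _ + X - _]big1 => [|i _].
    by rewrite addr0 subrr nrm0 !mulr_ge0 ?exprn_ge0 ?invr_ge0.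
  by apply: H; rewrite leq_addr.
have h : nrm (\sum_(i < N) u i - \sum_(i < M) u i) <= \sum_(i < M) nrm (u i).
  rewrite -(subnKC (ltnW NM)) !big_split_ord /= opprD addrA subrr add0r nrmN.
  apply: le_trans (nrm_sum _ _ _) _; rewrite lerDr.
  by apply: sumr_ge0 => i _; exact: nrm_ge0.
apply: le_trans h _; rewrite mulrAC; apply: ler_peMl => //.
rewrite exprVn ler_pdivlMr ?exprn_gt0 // mul1r.
by apply: ler_weXn2l; [lra | exact: ltnW].
Qed.

Lemma zsum_fin (f : int -> C) (N : nat) : (forall m, (N < `|m|)%N -> f m = 0) ->
  zsum f (\sum_(j < (N + N).+1) f (j%:Z - N%:Z)).
Proof.
move=> H; exists (\sum_(m < N.+1) f m%:Z), (\sum_(m < N) f (- m.+1%:Z)); split.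
- by apply: (@gsum_fin (fun m => f m%:Z)) => i Ni; apply: H; lia.
- by apply: (@gsum_fin (fun m => f (- m.+1%:Z))) => i Ni; apply: H; lia.
rewrite -addnS big_split_ord /= addrC; congr (_ + _).
  by apply: eq_bigr => i _; congr f; lia.
rewrite (reindex_inj rev_ord_inj) /=; apply: eq_bigr => i _; congr f.
by have := ltn_ord i; lia.
Qed.

End FiniteZsum.

Section ThetaZeros.
Variable R : realType.
Local Notation C := R[i].
Variable tau : C.
Hypothesis tau_gt0 : 0 < complex.Im tau.
Implicit Types (z w : C) (m : int).
Let q := e tau.
Let r := nrm q.

Let rE : r = expR (- (2 * pi * complex.Im tau)). Proof. exact: nrm_e. Qed.

Let r0 : 0 < r. Proof. by rewrite rE expR_gt0. Qed.

Let r1 : r < 1.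
Proof. by rewrite rE -[X in _ < X]expR0 ltr_expR oppr_lt0 !mulr_gt0 ?pi_gt0. Qed.

(** All q-Pochhammer products involved have N - k factors at least, and are close
    to their common limit. *)
Lemma qbin_ratio_near1 : exists2 K : R, 0 <= K & forall (N k j : nat), (k <= N)%N ->
  j = (N + k)%N \/ j = (N - k)%N -> nrm (1 - qbin_ratio tau N j) <= K * r ^+ (N - k).
Proof.
have [k0 k00 Hk] := qpoch_lower r1; have [U U0 HU] := qpoch_upper r1.
have [K K0 HK] := qpoch_cauchy r1.
exists (2 * U * K / k0 ^+ 2) => [|N k j kN jE].
  by rewrite divr_ge0 ?exprn_ge0 ?mulr_ge0 // ltW.
have -> : qbin_ratio tau N j =
    qpoch q N ^+ 2 / (qpoch q (N + k) * qpoch q (N - k)).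
  rewrite /qbin_ratio; case: jE => ->; first by rewrite subnDl.
  by rewrite (_ : (N + N - (N - k) = N + k)%N) 1?[_ * qpoch _ (N + k)]mulrC //; lia.
set A := qpoch q (N + k); set B := qpoch q (N - k); set D := qpoch q N.
have A0 : 0 < nrm A by apply: lt_le_trans (Hk _).
have B0 : 0 < nrm B by apply: lt_le_trans (Hk _).
have -> : 1 - D ^+ 2 / (A * B) = ((A - D) * B - D * (D - B)) / (A * B).
  by field; rewrite -!nrm_gt0 A0 B0.
rewrite nrmM nrmV nrmM mulrAC; apply: ler_pM; rewrite ?nrm_ge0 ?invr_ge0 ?mulr_ge0 ?nrm_ge0 //; last first.
  rewrite lef_pV2 ?posrE ?mulr_gt0 ?exprn_gt0 //.
  by rewrite expr2; apply: ler_pM; rewrite ?(ltW k00) ?Hk.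
have h1 : nrm (A - D) <= K * r ^+ (N - k).
  apply: le_trans (HK N (N + k)%N (leq_addr _ _)) _.
  by apply: ler_wpM2l => //; apply: ler_wiXn2l; rewrite ?leq_subr ?ltW.
have h2 : nrm (D - B) <= K * r ^+ (N - k) by apply: HK; rewrite leq_subr.
apply: le_trans (nrmB _ _) _; rewrite !nrmM.
have hB : nrm B <= U by exact: HU.
have hD : nrm D <= U by exact: HU.
set T := K * _ in h1 h2.
have T0 : 0 <= T by rewrite mulr_ge0 // exprn_ge0 // ltW.
have -> : 2 * U * K * r ^+ (N - k) = T * U + U * T by rewrite /T; ring.
by apply: lerD; apply: ler_pM => //; exact: nrm_ge0.
Qed.

(** Term by term: theta_term decays faster than |q|^|m|, which makes up for the
    rate |q|^(N - |m|) of qbin_ratio_near1. *)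
Lemma triple_product_cvg z : exists A : R, forall N : nat,
  nrm (theta tau z - theta_prod tau N z * (qpoch q N ^+ 2 / qpoch q (N + N))) <= A * r ^+ N.
Proof.
have [K K0 HK] := qbin_ratio_near1.
pose L := 2 * pi * complex.Im tau.
have [A A0 HA] := theta_term_bound tau_gt0 z L.
have rk (k : nat) : r ^+ k = (expR (L * k%:R))^-1.
  by rewrite rE -expRM_natl mulrN expRN mulrC.
have HA' m : nrm (theta_term tau z m) <= A * r ^+ `|m|%N * 2^-1 ^+ `|m|%N.
  by rewrite mulrAC rk ler_pdivlMr ?expR_gt0 //; exact: HA.
exists (4 * (A * (K + 1))) => N; rewrite finite_triple_product //.
pose b m : C := if (`|m| <= N)%N then qbin_ratio tau N (absz (m + N%:Z)%R) else 0.
have Hb : zsum (fun m => theta_term tau z m * b m)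
    (\sum_(j < (N + N).+1) theta_term tau z (j%:Z - N%:Z) * qbin_ratio tau N j).
  have := @zsum_fin R (fun m => theta_term tau z m * b m) N.
  rewrite (eq_bigr (fun j : 'I_(N + N).+1 => theta_term tau z (j%:Z - N%:Z) * qbin_ratio tau N j)).
    by apply=> m Nm; rewrite /b leqNgt Nm mulr0.
  move=> j _; rewrite /b subrK absz_nat ifT //; have := ltn_ord j; lia.
have Hd : zsum (fun m => theta_term tau z m * (1 - b m)) (theta tau z -
    \sum_(j < (N + N).+1) theta_term tau z (j%:Z - N%:Z) * qbin_ratio tau N j).
  have := zsumD (zsum_theta tau_gt0 z) (zsumZ (-1) Hb); rewrite mulN1r.
  by apply: eq_zsum => m; ring.
rewrite -mulrA; apply: (zsum_le Hd) => m; rewrite nrmM.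
have r0N (k : nat) : 0 <= r ^+ k by rewrite exprn_ge0 // ltW.
have h2 : 0 <= 2^-1 ^+ `|m|%N :> R by rewrite exprn_ge0 // invr_ge0.
have [mN|Nm] := leqP `|m| N.
  have hb : nrm (1 - b m) <= K * r ^+ (N - `|m|).
    rewrite /b mN; apply: HK => //; have [m0|m0] := lerP 0 m.
      by left; lia.
    by right; lia.
  apply: le_trans (ler_pM (nrm_ge0 _) (nrm_ge0 _) (HA' m) hb) _.
  have -> : A * r ^+ `|m| * 2^-1 ^+ `|m| * (K * r ^+ (N - `|m|)) =
    (A * K) * (r ^+ `|m| * r ^+ (N - `|m|)) * 2^-1 ^+ `|m| by ring.
  rewrite -exprD subnKC //; do 2 apply: ler_wpM2r => //.
  by apply: ler_wpM2l => //; lra.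
rewrite /b leqNgt Nm /= subr0 nrm1 mulr1; apply: le_trans (HA' m) _.
apply: ler_wpM2r => //; apply: ler_pM => //.
  by rewrite -[X in X <= _]mulr1; apply: ler_wpM2l => //; lra.
by apply: ler_wiXn2l; [exact: ltW r0 | exact: ltW r1 | exact: ltnW].
Qed.

(** On the strip of height Im tau centred on the real axis, theta is bounded
    below by a multiple of 1 - e(z): the other factors of the triple product
    are at least 1 - |q|^(i+1/2). *)
Lemma theta_lower : exists2 c : R, 0 < c & forall z,
  `|complex.Im z| <= complex.Im tau / 2 -> c * nrm (1 - e z) <= nrm (theta tau z).
Proof.
have [k0 k00 Hk] := qpoch_lower r1; have [U U0 HU] := qpoch_upper r1.
pose s := expR (- (pi * complex.Im tau)).
have sI : 0 <= s < 1.
  by rewrite expR_ge0 -[X in _ < X]expR0 ltr_expR oppr_lt0 mulr_gt0 ?pi_gt0.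
have rI : 0 <= r < 1 by rewrite (ltW r0) r1.
have [k1 k10 Hk1] := prod_lower rI sI.
exists (k1 ^+ 2 * (k0 ^+ 2 / U)); first by rewrite mulr_gt0 ?divr_gt0 ?exprn_gt0.
move=> z zI.
have wI (w : C) : `|complex.Im w| <= complex.Im tau / 2 -> forall i : nat,
    1 - s * r ^+ i <= nrm (1 - q ^+ i.+1 * e w).
  move=> hw i; apply: le_trans (nrm_1B _); rewrite lerD2l lerN2 nrmM nrmX -/r.
  rewrite exprS mulrAC; apply: ler_wpM2r; first by rewrite exprn_ge0 // ltW.
  rewrite rE nrm_e -expRD ler_expR /s.
  by move: hw; rewrite ler_norml => /andP[h _]; have := pi_gt0 R; nra.
have prod_ge (w : C) (N : nat) : `|complex.Im w| <= complex.Im tau / 2 ->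
    k1 <= \prod_(i < N) nrm (1 - q ^+ i.+1 * e w).
  move=> hw; apply: le_trans (Hk1 N) _; apply: ler_prod => i _.
  rewrite wI // andbT subr_ge0; have /andP[s0 s1] := sI; have /andP[t0 t1] := rI.
  have : r ^+ i <= 1 by rewrite exprn_ile1 // ltW.
  have : 0 <= r ^+ i by rewrite exprn_ge0.
  by nra.
have zNI : `|complex.Im (- z)| <= complex.Im tau / 2 by rewrite ImN normrN.
have low (N : nat) : k1 ^+ 2 * (k0 ^+ 2 / U) * nrm (1 - e z) <=
    nrm (theta_prod tau N.+1 z * (qpoch q N.+1 ^+ 2 / qpoch q (N.+1 + N.+1))).
  rewrite nrmM mulrAC; apply: ler_pM; rewrite ?mulr_ge0 ?nrm_ge0 ?exprn_ge0 ?invr_ge0 ?(ltW k10) ?(ltW k00) ?(ltW U0) //.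
    rewrite /theta_prod big_split /= nrmM big_ord_recl /= expr0 mul1r nrmM !nrm_prod.
    rewrite mulrC -mulrA; apply: ler_wpM2l; first exact: nrm_ge0.
    rewrite expr2; apply: ler_pM; rewrite ?(ltW k10) //.
      exact: prod_ge.
    rewrite (eq_bigr (fun i : 'I_N.+1 => nrm (1 - q ^+ i.+1 * e (- z)))).
      exact: prod_ge.
    by move=> i _; rewrite eN.
  rewrite nrmM nrmX nrmV; apply: ler_pM; rewrite ?exprn_ge0 ?invr_ge0 ?(ltW k00) ?(ltW U0) //.
    by apply: lerXn2r; rewrite ?nnegrE ?nrm_ge0 ?(ltW k00).
  by rewrite lef_pV2 ?posrE //; apply: lt_le_trans (Hk _).
have [A HA] := triple_product_cvg z.
have A0 : 0 <= A by have := HA 0%N; rewrite expr0 mulr1; apply: le_trans (nrm_ge0 _).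
apply/ler_addgt0Pr => eps e0.
have [N HN] : exists N : nat, A * r ^+ N.+1 <= eps.
  have r1' : `|r| < 1 by rewrite gtr0_norm.
  have /cvgrPdist_le := cvg_geometric A r1' => /(_ eps e0)[N _ HN].
  exists N; have := HN N.+1 (leqnSn N); rewrite sub0r normrN; apply: le_trans.
  exact: ler_norm.
have := low N; have := HA N.+1; set X := _ * (_ / _) => h1 h2.
have h3 := nrm_triangle X (X - theta tau z).
have E : X - (X - theta tau z) = theta tau z by ring.
rewrite E -[nrm (X - _)]nrmN opprB in h3.
lra.
Qed.

(** Iterated quasi-periodicity; the factor matters only by not vanishing. *)
Lemma theta_tau_shift z (b : int) : exists2 u : C, u != 0 &
  theta tau (z + b%:~R * tau) = u * theta tau z.
Proof.
have Hn (m : nat) x : exists2 u : C, u != 0 & theta tau (x + m%:R * tau) = u * theta tau x.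
  elim: m => [|m [u u0 IH]]; first by exists 1; rewrite ?oner_eq0 // mul0r addr0 mul1r.
  exists (- e (- (x + m%:R * tau)) * u); first by rewrite mulf_neq0 // oppr_eq0 e_neq0.
  by rewrite -natr1 mulrDl mul1r addrA theta_add_tau // IH mulrA.
case: b => b; first exact: Hn.
rewrite NegzE rmorphN /= mulNr; have [u u0 E] := Hn b.+1 (z - b.+1%:R * tau).
exists u^-1; first by rewrite invr_eq0.
by rewrite -[z in RHS](subrK (b.+1%:R * tau)) E mulKf.
Qed.

(** A translation by a multiple of tau moves z into the strip of theta_lower, where
    theta vanishes only if 1 - e(z) does. *)
Lemma theta_zero z : theta tau z = 0 -> z \in lattice tau.
Proof.
have t2 : 0 < complex.Im tau by [].
pose y := complex.Im z / complex.Im tau.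
pose b := Num.floor (y + 2^-1).
have [u u0 E] := theta_tau_shift z (- b).
move=> z0; rewrite z0 mulr0 in E.
have [c c0 Hc] := theta_lower.
have h : `|complex.Im (z + (- b)%:~R * tau)| <= complex.Im tau / 2.
  have /andP[f1 f2] := floor_itv (y + 2^-1); rewrite -/b rmorphD /= in f1 f2.
  rewrite ImD ImM Im_int Re_int rmorphN /= mul0r addr0.
  have -> : complex.Im z = y * complex.Im tau by rewrite divfK // gt_eqF.
  rewrite ler_norml; apply/andP; split; nra.
have := Hc _ h; rewrite E nrm0 pmulr_rle0 // le_eqVlt ltNge nrm_ge0 orbF nrm_eq0.
rewrite subr_eq0 eq_sym => /eqP/e_eq1[a Ea].
apply/latticeP; exists a, b; rewrite -Ea rmorphN /=; ring.
Qed.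

(** By theta_lower, since 1 - e(w) is - 2 pi i w to first order. *)
Lemma theta_simple_zero : exists c d : R, [/\ 0 < c, 0 < d &
  forall w, nrm w <= d -> c * nrm w <= nrm (theta tau w)].
Proof.
have [c c0 Hc] := theta_lower.
have p0 := pi_gt0 R.
pose B : R := 16 * pi * expR (2 * pi).
have B0 : 0 < B by rewrite !mulr_gt0 // expR_gt0.
have t2 : 0 < complex.Im tau / 2 by rewrite divr_gt0.
pose d := Num.min 1 (Num.min B^-1 (complex.Im tau / 2)).
exists (c * pi), d; split; first by rewrite mulr_gt0.
  by rewrite !lt_min ltr01 invr_gt0 B0.
move=> w; rewrite !le_min => /and3P[w1 wB wt].
apply: le_trans (Hc w (le_trans (Im_le_nrm _) wt)).
rewrite -mulrA; apply: ler_wpM2l; first exact: ltW.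
have := e_taylor 2 w; rewrite /exp_poly horner_poly !big_ord_recl big_ord0 /=.
rewrite fact0 !invr1 !mul1r expr0 expr1 addr0 => h.
have h2 : (4 * pi * nrm w) ^+ 2 * expR (2 * pi * nrm w) <= pi * nrm w.
  have e1 : expR (2 * pi * nrm w) <= expR (2 * pi).
    by rewrite ler_expR; apply: ler_piMr => //; rewrite mulr_ge0 // ltW.
  have wB' : nrm w * B <= 1 by rewrite -ler_pdivlMr // div1r.
  have nw := nrm_ge0 w.
  have -> : (4 * pi * nrm w) ^+ 2 * expR (2 * pi * nrm w) =
     (pi * nrm w) * (16 * pi * expR (2 * pi * nrm w) * nrm w) by ring.
  apply: ler_piMr; first by rewrite mulr_ge0 // ltW.
  apply: le_trans wB'; rewrite [_ * B]mulrC; apply: ler_wpM2r => //.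
  by apply: ler_wpM2l => //; rewrite mulr_ge0 // ltW.
have h3 := nrm_triangle (twopii R * w) (e w - (1 + twopii R * w)).
have h4 := nrmB (e w - (1 + twopii R * w)) (e w - 1).
have -> : 1 - e w = - (e w - 1) by rewrite opprB.
have E : e w - (1 + twopii R * w) - (e w - 1) = - (twopii R * w) by ring.
rewrite E nrmN nrmM nrm_twopii in h4.
by rewrite nrmN; lra.
Qed.

End ThetaZeros.

(** * The functions theta_alpha *)

Lemma eq_bounded_mod (n m m' : nat) (d : int) :
  m%:Z - m'%:Z = n%:Z * d -> (m < n)%N -> (m' < n)%N -> m = m'.
Proof.
move=> h hm hm'; have [d1|d1] := leP 1 d; first by nia.
have [d2|d2] := leP d (-1); first by nia.
have d0 : d = 0 by lia.
by move: h; rewrite d0 mulr0; lia.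
Qed.

Section Character.
Variable R : realType.
Local Notation C := R[i].
Variable n : nat.
Hypothesis n_gt1 : (1 < n)%N.
Implicit Types (x y z : C) (al : int) (a b : 'Z_n).

Let n_gt0 : (0 < n)%N. Proof. exact: ltnW. Qed.

Lemma nC_neq0 : n%:R != 0 :> C.
Proof. by rewrite pnatr_eq0 -lt0n. Qed.
Let n0 := nC_neq0.

Lemma ltn_ordZ a : (a < n)%N.
Proof. by have := ltn_ord a; rewrite [X in (_ < X)%N -> _]Zp_cast. Qed.

Lemma intZ al : exists k : int, al = (nat_of_ord (al%:~R : 'Z_n))%:Z + k * n%:Z.
Proof.
exists (al %/ n%:Z)%Z; rewrite [LHS](divz_eq al n%:Z) addrC; congr (_ + _).
have n0' : n%:Z != 0 by rewrite -lt0n.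
have h1 := modz_ge0 al n0'; have h2 := ltz_mod al n0'.
case E : (al %% n%:Z)%Z h1 h2 => [k|//] _; rewrite /= ltz_nat => kn.
have -> : al%:~R = k%:R :> 'Z_n.
  rewrite [in LHS](divz_eq al n%:Z) E rmorphD rmorphM /=.
  by rewrite -[n%:Z%:~R]/(n%:R) pchar_Zp // mulr0 add0r.
by rewrite val_Zp_nat // modn_small.
Qed.

(** The character of Z/n of value e(1/n) at 1. *)
Definition chi a : C := e ((nat_of_ord a)%:R / n%:R).

Lemma chi_int al : chi al%:~R = e (al%:~R / n%:R).
Proof.
have [k E] := intZ al; rewrite [in RHS]E rmorphD rmorphM /= mulrDl eD.
by rewrite mulfK // e_int mulr1.
Qed.

Lemma intZ_nat a : ((nat_of_ord a)%:Z)%:~R = a.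
Proof. exact: natr_Zp. Qed.

Lemma chiD a b : chi (a + b) = chi a * chi b.
Proof.
rewrite -[a in LHS]intZ_nat -[b in LHS]intZ_nat -rmorphD chi_int rmorphD /=.
by rewrite mulrDl eD.
Qed.

Lemma chi0 : chi 0 = 1.
Proof. by have := chi_int 0; rewrite mul0r e0. Qed.

Lemma chi_neq0 a : chi a != 0. Proof. exact: e_neq0. Qed.

Lemma chiN a : chi (- a) = (chi a)^-1.
Proof. by apply: (mulfI (chi_neq0 a)); rewrite -chiD subrr chi0 divff // chi_neq0. Qed.

Lemma chi_inj : injective chi.
Proof.
move=> a b E; apply/eqP; rewrite -subr_eq0; apply/eqP.
have : chi (a - b) = 1 by rewrite chiD chiN E divff // chi_neq0.
move=> /e_eq1[m /(congr1 ( *%R^~ n%:R))]; rewrite divfK //.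
set c := a - b; move=> h; have {}h : (nat_of_ord c)%:Z = m * n%:Z.
  by apply: (@intr_inj C); rewrite intrM.
have cn := ltn_ordZ c.
suff c0 : nat_of_ord c = 0%N by apply: ord_inj; rewrite c0.
move: h cn; move: (nat_of_ord c) => k h cn.
have [m1|m1] := leP 1 m; nia.
Qed.

End Character.

Section ThetaAlpha.
Variable R : realType.
Local Notation C := R[i].
Variables (n : nat) (tau : C).
Hypothesis n_gt1 : (1 < n)%N.
Hypothesis tau_gt0 : 0 < complex.Im tau.
Local Notation chi := (@chi R n).
Implicit Types (x y z : C) (al : int) (a b : 'Z_n).

Let n_gt0 : (0 < n)%N. Proof. exact: ltnW. Qed.
Let n0 : n%:R != 0 :> C. Proof. exact: nC_neq0. Qed.

(** The n factors of theta_alpha. *)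
Definition thprod al x : C :=
  \prod_(0 <= m < n) theta tau (x + m%:R / n%:R + al%:~R / n%:R * tau).

Definition thfac al x : C :=
  e (al%:~R * x + al%:~R / (2 * n%:R) + (al * (al - n%:Z))%:~R / (2 * n%:R) * tau).

Lemma theta_E al x : theta_ n tau al x = thfac al x * thprod al x.
Proof. by []. Qed.

(** The shift by 1/n permutes the factors cyclically. *)
Lemma thprod_add1n al x : thprod al (x + n%:R^-1) = thprod al x.
Proof.
rewrite /thprod; case: n n_gt0 n0 => // k _ k0.
rewrite big_nat_recr //= [RHS]big_nat_recl //= mulrC; congr (_ * _).
  rewrite -[RHS](theta_add1 tau_gt0 _); congr theta.
  by rewrite -natr1; field; rewrite natr1.
by apply: eq_bigr => i _; congr theta; rewrite -[i.+1%:R]natr1; ring.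
Qed.

Lemma prod_e_args al x : \prod_(0 <= m < n) - e (- (x + m%:R / n%:R + al%:~R / n%:R * tau)) =
  e (n%:R / 2 - (n%:R * x + (n%:R - 1) / 2 + al%:~R * tau)).
Proof.
pose f (m : nat) : C := m%:R / 2 - (m%:R * x + m%:R * (m%:R - 1) / 2 / n%:R + m%:R / n%:R * al%:~R * tau).
suff H m : \prod_(0 <= i < m) - e (- (x + i%:R / n%:R + al%:~R / n%:R * tau)) = e (f m).
  by rewrite H /f; congr e; field.
elim: m => [|m IH]; first by rewrite big_nil /f !mul0r !addr0 subr0 e0.
rewrite big_nat_recr //= IH -mulN1r -e_half -!eD; congr e.
by rewrite /f -natr1; field.
Qed.

Lemma thprod_add_tau al x : thprod al (x + tau) =
  e (n%:R / 2 - (n%:R * x + (n%:R - 1) / 2 + al%:~R * tau)) * thprod al x.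
Proof.
rewrite -prod_e_args /thprod -big_split /=; apply: eq_bigr => i _.
rewrite -theta_add_tau //; congr theta; ring.
Qed.

Lemma thprod_opp al x : thprod al (- x) =
  e (n%:R / 2 - (n%:R * x + (n%:R - 1) / 2 - al%:~R * tau) + (n%:R - 1)) * thprod (- al) x.
Proof.
have -> : thprod (- al) x = \prod_(0 <= m < n)
   theta tau (x - m%:R / n%:R - al%:~R / n%:R * tau).
  rewrite -[LHS]thprod_add1n /thprod big_nat_rev /= !big_nat; apply: eq_bigr => i.
  move=> /andP[_ ilt]; rewrite add0n -[RHS](theta_add1 tau_gt0 _); congr theta.
  by rewrite natrB // -natr1 rmorphN /=; field.
have -> : e (n%:R / 2 - (n%:R * x + (n%:R - 1) / 2 - al%:~R * tau) + (n%:R - 1)) =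
  \prod_(0 <= m < n) - e (- (x - m%:R / n%:R - al%:~R / n%:R * tau)).
  rewrite big_nat_rev /= !big_nat.
  rewrite (eq_bigr (fun i => - e (- ((x - 1 + n%:R^-1) + i%:R / n%:R + (- al)%:~R / n%:R * tau)))).
    rewrite -big_nat prod_e_args; congr e.
    by rewrite rmorphN /=; field.
  move=> i /andP[_ ilt]; congr (- e (- _)); rewrite add0n natrB // -natr1 rmorphN /=; field.
  done.
rewrite -big_split /=; apply: eq_bigr => i _.
rewrite -theta_opp //; congr theta; ring.
Qed.

(** Raising al by n shifts every factor by tau; the exponential prefactor absorbs
    the multipliers. *)
Lemma theta_addn al x : theta_ n tau (al + n%:Z) x = theta_ n tau al x.
Proof.
rewrite !theta_E.
have -> : thprod (al + n%:Z) x = thprod al (x + tau).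
  by apply: eq_bigr => i _; congr theta; rewrite rmorphD /=; field.
rewrite thprod_add_tau mulrA; congr (_ * _); rewrite /thfac -eD.
rewrite -[RHS](e_addz _ 1); congr e.
by rewrite !intrM !intrB !intrD /=; field.
Qed.

Lemma thetaZ_int al x : thetaZ tau (al%:~R : 'Z_n) x = theta_ n tau al x.
Proof.
have Hn (k : nat) m : theta_ n tau (m + k%:Z * n%:Z) x = theta_ n tau m x.
  elim: k => [|k IH]; first by rewrite mul0r addr0.
  by rewrite -addn1 PoszD mulrDl mul1r addrA theta_addn.
have [k E] := intZ n_gt1 al; rewrite /thetaZ [in RHS]E.
case: k {E} => k; first by rewrite Hn.
rewrite -[RHS](Hn k.+1); congr (theta_ n tau _ x); rewrite NegzE; ring.
Qed.

Lemma thetaZ_add1n a x : thetaZ tau a (x + n%:R^-1) = chi a * thetaZ tau a x.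
Proof.
rewrite /thetaZ !theta_E thprod_add1n mulrA; congr (_ * _); rewrite /chi -eD.
by congr e; ring.
Qed.

(** The multiplier of theta_alpha under tau/n; it is the same for all alpha. *)
Definition taufac x : C :=
  e (- x - (2 * n%:R)^-1 + (n%:R - 1) / (2 * n%:R) * tau).

Lemma thetaZ_addtau a x :
  thetaZ tau a (x + tau / n%:R) = taufac x * thetaZ tau (a + 1) x.
Proof.
have -> : a + 1 = ((nat_of_ord a)%:Z + 1)%:~R by rewrite rmorphD /= intZ_nat.
rewrite thetaZ_int /thetaZ; set al := (nat_of_ord a)%:Z; rewrite !theta_E.
have -> : thprod al (x + tau / n%:R) = thprod (al + 1) x.
  by apply: eq_bigr => i _; congr theta; rewrite rmorphD /=; ring.
rewrite mulrA; congr (_ * _); rewrite /thfac /taufac -eD; congr e.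
by rewrite !intrM !intrB !intrD /=; field.
Qed.

Lemma taufacD x y : taufac (x + y) = e (- y) * taufac x.
Proof. by rewrite /taufac -eD; congr e; ring. Qed.

Lemma taufac_neq0 x : taufac x != 0. Proof. exact: e_neq0. Qed.

Lemma thetaZ_opp b x :
  thetaZ tau (- b) (- x) = - (e (- (n%:R * x)) / chi b) * thetaZ tau b x.
Proof.
rewrite -[in LHS](intZ_nat b) -rmorphN thetaZ_int /thetaZ.
set al := (nat_of_ord b)%:Z; rewrite !theta_E thprod_opp opprK !mulrA; congr (_ * _).
rewrite /chi (_ : - (e _ / e _) = e (2^-1 - n%:R * x - (nat_of_ord b)%:R / n%:R)); last first.
  by rewrite !eB e_half eN; ring.
rewrite /thfac -!eD.
rewrite -[RHS](e_addz _ (n%:Z - 1)); congr e.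
by rewrite !intrM !intrB !rmorphN /=; field.
Qed.

Lemma thetaZ_regular a x : n%:R * x \notin lattice tau -> thetaZ tau a x != 0.
Proof.
move=> xr; rewrite mulf_neq0 ?e_neq0 //.
rewrite big_mkord; apply/prodf_neq0 => i _; apply/eqP => /(theta_zero tau_gt0) h.
move/negP: xr; apply.
have -> : n%:R * x = (n%:Z)%:~R * (x + i%:R / n%:R + (nat_of_ord a)%:Z%:~R / n%:R * tau) -
  (i%:R + (nat_of_ord a)%:R * tau) by field.
rewrite rpredB ?lattice_int //; apply/latticeP.
by exists (nat_of_ord i)%:Z, (nat_of_ord a)%:Z.
Qed.

Lemma thetaZ_0 : thetaZ tau (0 : 'Z_n) 0 = 0.
Proof.
rewrite /thetaZ theta_E /thprod big_ltn // !mul0r !addr0 theta_0 //.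
by rewrite mul0r mulr0.
Qed.

(** The zeros of theta_a form the class of - a tau/n modulo (1/n) Z + Z tau, and
    these classes are distinct. *)
Lemma thetaZ_zero_uniq a b x : thetaZ tau a x = 0 -> thetaZ tau b x = 0 -> a = b.
Proof.
have Hz (c : 'Z_n) : thetaZ tau c x = 0 -> exists p r : int,
    n%:R * x + (nat_of_ord c)%:R * tau = p%:~R + n%:R * r%:~R * tau.
  rewrite /thetaZ theta_E /thprod => /eqP; rewrite mulf_eq0 (negbTE (e_neq0 _)) /= big_mkord.
  move=> /prodf_eq0[i _ /eqP /(theta_zero tau_gt0)].
  move=> /latticeP[p [r]] /(congr1 ( *%R n%:R)) E.
  exists (n%:Z * p - (nat_of_ord i)%:Z), r; rewrite intrB intrM.
  transitivity (n%:R * (p%:~R + r%:~R * tau) - (nat_of_ord i)%:R); last by ring.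
  by rewrite -E; field.
move=> /Hz[p [r E]] /Hz[p' [r' E']].
have {E E'}E : (nat_of_ord a)%:R * tau - (nat_of_ord b)%:R * tau =
    (p - p')%:~R + n%:R * (r - r')%:~R * tau.
  transitivity (n%:R * x + (nat_of_ord a)%:R * tau - (n%:R * x + (nat_of_ord b)%:R * tau)).
    by ring.
  by rewrite E E' !intrB; ring.
have : ((nat_of_ord a)%:R - (nat_of_ord b)%:R) * complex.Im tau =
    n%:R * (r - r')%:~R * complex.Im tau.
  have := congr1 (@complex.Im R) E.
  rewrite !(ImD, ImN, ImM, ReM, Im_int, Re_int, Im_nat, Re_nat).
  by rewrite !(mul0r, mulr0, add0r, addr0, subr0) mulrBl.
move=> /(mulIf (lt0r_neq0 tau_gt0)) h.
have {}h : (nat_of_ord a)%:Z - (nat_of_ord b)%:Z = n%:Z * (r - r').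
  by apply: (@intr_inj R); rewrite [LHS]intrB h [RHS]intrM.
have := ltn_ordZ n_gt1 a; have := ltn_ordZ n_gt1 b; move=> hb ha.
apply: ord_inj; move: (nat_of_ord a) (nat_of_ord b) (r - r') h ha hb => m m' d h hm hm'.
exact: (eq_bounded_mod h hm hm').
Qed.

Lemma thetaZ_neq0 a : a != 0 -> thetaZ tau a 0 != 0.
Proof. by apply: contra => /eqP a0; apply/eqP/(thetaZ_zero_uniq a0)/thetaZ_0. Qed.

Lemma expands_shift (f : C -> C) c x v : expands f (x + c) v -> expands (fun z => f (z + c)) x v.
Proof.
move=> H; apply: eq_expands (_ : expands (fun z => f (1 * z + c)) x v).
  by move=> z; rewrite mul1r.
by apply: expands_affine; rewrite ?oner_eq0 // mul1r.
Qed.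

Lemma expands_exp (c d x : C) : expands (fun z => e (c * z + d)) x (e (c * x + d)).
Proof.
have [->|c0] := eqVneq c 0; last exact/expands_affine/expands_e.
by apply: eq_expands (expands_cst _ _) => z; rewrite !mul0r.
Qed.

Lemma expands_thetaZ a x : expands (thetaZ tau a) x (thetaZ tau a x).
Proof.
apply: expandsM.
  apply: eq_expands (_ : expands (fun z => e ((nat_of_ord a)%:Z%:~R * z + _)) x _) => [z|].
    by rewrite -addrA.
  by rewrite -addrA; exact: expands_exp.
apply: expands_prod => i _.
apply: eq_expands (_ : expands (fun z => theta tau (z + _)) x _) => [z|].
  by rewrite -addrA.
by rewrite -addrA; apply: expands_shift; exact: expands_theta.
Qed.

(** The factor of index m = 0 contributes the simple zero of theta, and the other
    factors do not vanish at the origin. *)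
Lemma thetaZ_simple : exists2 v : C, v != 0 &
  expands (fun x => thetaZ tau (0 : 'Z_n) x / x) 0 v.
Proof.
have [v1 H1] : exists v, expands (fun z => theta tau z / (z - 0)) 0 v.
  by apply: expands_divX; rewrite -[X in expands _ _ X](theta_0 tau_gt0); exact: expands_theta.
have [c [d [c0 d0 Hc]]] := theta_simple_zero tau_gt0.
have v10 : v1 != 0.
  apply: expands_divX_ge c0 d0 _ H1 => w w0 wd.
  by rewrite add0r subr0 nrmM nrmV ler_pdivlMr ?nrm_gt0 //; exact: Hc.
pose g x := \prod_(1 <= m < n) theta tau (x + m%:R / n%:R).
have Hg : expands g 0 (g 0).
  by apply: expands_prod => i _; apply: expands_shift; exact: expands_theta.
exists (v1 * g 0).
  rewrite mulf_neq0 // /g big_nat prodf_seq_neq0; apply/allP => i _; apply/implyP.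
  move=> /andP[i1 ilt]; rewrite add0r; apply/eqP => /(theta_zero tau_gt0).
  move=> /latticeP[p [r]] /(congr1 ( *%R n%:R)); rewrite mulrC divfK // => E.
  have r0 : r = 0.
    have := congr1 (@complex.Im R) E.
    rewrite !(ImD, ImM, ReM, ReD, Im_int, Re_int, Im_nat, Re_nat) !(mul0r, mulr0, add0r, addr0, subr0).
    move=> /eqP; rewrite eq_sym mulf_eq0 pnatr_eq0 -leqn0 leqNgt n_gt0 /=.
    by rewrite mulf_eq0 (gt_eqF tau_gt0) orbF intr_eq0 => /eqP.
  move: E; rewrite r0 mul0r addr0 => E.
  have {}E : i%:Z = n%:Z * p by apply: (@intr_inj C); rewrite intrM.
  have [p1|p1] := leP 1 p; nia.
apply: eq_expands (expandsM H1 Hg) => x.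
rewrite /thetaZ theta_E /thfac !mul0r !addr0 e0 mul1r /thprod big_ltn //.
rewrite !mul0r !addr0 subr0 /g [RHS]mulrAC; congr (_ * _ / _).
by apply: eq_bigr => i _; rewrite addr0.
Qed.

End ThetaAlpha.

(** * The operator R as a Kronecker function *)

Section Kronecker.
Variable R : realType.
Local Notation C := R[i].
Variables (n k : nat).
Hypothesis n_gt1 : (1 < n)%N.
Local Notation N := (Zp_trunc n).+2.
Local Notation chi := (@chi R n).
Implicit Types (x y z : C) (a b i j : 'Z_n) (p q : int).

Let n_gt0 : (0 < n)%N. Proof. exact: ltnW. Qed.
Let n0 : n%:R != 0 :> C. Proof. exact: nC_neq0. Qed.

(** The coefficients of R, as Kronecker theta functions in two variables: each is
    quasi-periodic in x with multipliers that depend on y only, and conversely. *)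
Definition Kr tau a b x y : C :=
  thetaZ tau (a + b) (x + y) / (thetaZ tau a x * thetaZ tau b y).

Lemma chi_mulz p a : chi (p%:~R * a) = chi a ^ p.
Proof.
have Hn (m : nat) : chi (m%:R * a) = chi a ^+ m.
  elim: m => [|m IH]; first by rewrite mul0r chi0 // expr0.
  by rewrite -natr1 mulrDl mul1r chiD // IH exprSr.
case: p => m; first by rewrite Hn.
by rewrite NegzE rmorphN mulNr /= chiN // Hn exprnN.
Qed.

Section OneCurve.
Variable tau : C.
Hypothesis tau_gt0 : 0 < complex.Im tau.

Lemma div_cancel (c u v w s : C) : c != 0 -> (s * (c * u)) / (c * v * w) = s * (u / (v * w)).
Proof.
move=> c0; rewrite !invfM.
transitivity (s * (u * (v^-1 * w^-1)) * (c / c)); first by ring.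
by rewrite divff // mulr1.
Qed.

Lemma Kr_add1n a b x y : Kr tau a b (x + n%:R^-1) y = chi b * Kr tau a b x y.
Proof.
rewrite /Kr addrAC !thetaZ_add1n // chiD // -(div_cancel _ _ _ _ (chi_neq0 R a)).
by congr (_ / _); ring.
Qed.

Lemma Kr_addtau a b x y :
  Kr tau a b (x + tau / n%:R) y = e (- y) * Kr tau (a + 1) b x y.
Proof.
rewrite /Kr addrAC !thetaZ_addtau // taufacD [a + 1 + b]addrAC.
by rewrite -(div_cancel _ _ _ _ (taufac_neq0 n tau x)) mulrA.
Qed.

Lemma KrC a b x y : Kr tau a b x y = Kr tau b a y x.
Proof. by rewrite /Kr addrC [x + y]addrC [X in _ / X]mulrC. Qed.

(** Iteration of Kr_add1n and Kr_addtau, also for negative multiples. *)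
Lemma Kr_shift a b x y p q :
  Kr tau a b (x + (p%:~R + q%:~R * tau) / n%:R) y =
  e (- (q%:~R * y)) * chi b ^ p * Kr tau (a + q%:~R) b x y.
Proof.
have H1 (m : nat) a' x' : Kr tau a' b (x' + m%:R / n%:R) y = chi b ^+ m * Kr tau a' b x' y.
  elim: m => [|m IH]; first by rewrite mul0r addr0 mul1r.
  by rewrite -natr1 mulrDl mul1r addrA Kr_add1n IH exprS mulrA.
have {}H1 a' x' : Kr tau a' b (x' + p%:~R / n%:R) y = chi b ^ p * Kr tau a' b x' y.
  case: p => m; first exact: H1.
  rewrite NegzE rmorphN mulNr -[X in _ = _ * Kr _ _ _ X _](subrK (m.+1%:R / n%:R)) H1.
  by rewrite -exprnN mulKf // expf_neq0 // chi_neq0.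
have H2 (m : nat) a' x' : Kr tau a' b (x' + m%:R * tau / n%:R) y =
    e (- (m%:R * y)) * Kr tau (a' + m%:R) b x' y.
  elim: m a' => [|m IH] a'; first by rewrite !mul0r !addr0 oppr0 e0 mul1r.
  have E1 : a' + 1 + m%:R = a' + m.+1%:R by rewrite -natr1 -addrA [1 + _]addrC.
  have E2 : - y + - (m%:R * y) = - (m%:R * y + y) by rewrite [RHS]opprD [RHS]addrC.
  rewrite -natr1 !mulrDl !mul1r addrA Kr_addtau IH mulrA -eD.
  by rewrite E1 E2.
have {}H2 a' x' : Kr tau a' b (x' + q%:~R * tau / n%:R) y =
    e (- (q%:~R * y)) * Kr tau (a' + q%:~R) b x' y.
  case: q => m; first exact: H2.
  rewrite NegzE !rmorphN !mulNr opprK /=.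
  have := H2 m.+1 (a' - m.+1%:R) (x' - m.+1%:R * tau / n%:R); rewrite !subrK => ->.
  by rewrite mulrA -eD subrr e0 mul1r.
by rewrite mulrDl addrA H2 H1 mulrA.
Qed.

(** A period is n times a point of order n. *)
Lemma Kr_period a b x y p q : Kr tau a b (x + (p%:~R + q%:~R * tau)) y =
  e (- (n%:R * q%:~R * y)) * Kr tau a b x y.
Proof.
have -> : p%:~R + q%:~R * tau = ((n%:Z * p)%:~R + (n%:Z * q)%:~R * tau) / n%:R.
  by rewrite !intrM; field.
have nZ : (n%:Z)%:~R = 0 :> 'Z_n by exact: pchar_Zp.
have E1 : (n%:Z * q)%:~R = 0 :> 'Z_n by rewrite intrM nZ mul0r.
have E2 : chi b ^ (n%:Z * p) = 1 by rewrite -chi_mulz intrM nZ !mul0r chi0.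
by rewrite Kr_shift E1 E2 addr0 mulr1 intrM.
Qed.

Lemma Kr_expands a b x y : n%:R * x \notin lattice tau -> n%:R * y \notin lattice tau ->
  expands (Kr tau a b ^~ y) x (Kr tau a b x y).
Proof.
move=> xr yr; apply: expands_div; first by rewrite mulf_neq0 // thetaZ_regular.
  by apply: expands_shift; exact: expands_thetaZ.
apply: expandsM; [exact: expands_thetaZ | exact: expands_cst].
Qed.

(** The only pole at x = 0 is the simple pole of 1/thetaZ 0. *)
Lemma Kr_residue : exists2 v : C, v != 0 & forall a b y, n%:R * y \notin lattice tau ->
  expands (fun x => x * Kr tau a b x y) 0 ((a == 0)%:R * v).
Proof.
have [v v0 Hv] := thetaZ_simple n_gt1 tau_gt0; exists v^-1; first by rewrite invr_eq0.
move=> a b y yr.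
have Hn : expands (fun x => thetaZ tau (a + b) (x + y)) 0 (thetaZ tau (a + b) y).
  by apply: expands_shift; rewrite add0r; exact: expands_thetaZ.
have tb := thetaZ_regular n_gt1 tau_gt0 b yr.
have [a0|a0] := eqVneq a 0.
  rewrite {a}a0 mul1r add0r in Hn *.
  have := expandsM (expandsV v0 Hv) (expandsM Hn (expands_cst (thetaZ tau b y)^-1 0)).
  rewrite divff // mulr1; apply: eq_expands => x.
  by rewrite /Kr add0r !invfM invrK; ring.
rewrite mul0r; have ta := thetaZ_neq0 n_gt1 tau_gt0 a0.
have := expandsM (expands_id 0) (expands_div _ Hn
   (expandsM (expands_thetaZ tau_gt0 a 0) (expands_cst (thetaZ tau b y) 0))).
by rewrite mul0r; apply; rewrite mulf_neq0.
Qed.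

(** The operator of the R-matrix, up to its scalar prefactor and z = -x. *)
Definition Mmx x y : 'M[C]_(N * N) := \matrix_(u, v)
  let: (a, b) := mxtens_unindex u in let: (i, j) := mxtens_unindex v in
  ((a : 'Z_n) + b == (i : 'Z_n) + j)%:R * Kr tau ((a : 'Z_n) - i) (k%:R * ((j : 'Z_n) - a)) x y.

Lemma MmxE x y a b i j :
  Mmx x y (mxtens_index (a, b)) (mxtens_index (i, j)) =
  (a + b == i + j)%:R * Kr tau (a - i) (k%:R * (j - a)) x y.
Proof. by rewrite mxE !mxtens_indexK. Qed.

(** T^(kp) S^q, where T x_i = e(i/n) x_i and S x_i = x_(i+1). *)
Definition Xmx p q : 'M[C]_N :=
  \matrix_(a, i) (((a : 'Z_n) == (i : 'Z_n) + q%:~R)%:R * chi (k%:R * (a : 'Z_n)) ^ p).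

Lemma sum_mxtens (F : 'I_(N * N) -> C) :
  \sum_u F u = \sum_(a : 'Z_n) \sum_(b : 'Z_n) F (mxtens_index (a, b)).
Proof.
rewrite pair_bigA /= (reindex (@mxtens_index N N)) /=; last first.
  by exists (@mxtens_unindex N N) => u _; rewrite ?mxtens_indexK ?mxtens_unindexK.
by apply: eq_bigr => -[a b].
Qed.

Lemma sum_delta (c : 'Z_n) (F : 'Z_n -> C) : \sum_a (a == c)%:R * F a = F c.
Proof.
rewrite (bigD1 c) //= eqxx mul1r big1 ?addr0 // => a /negbTE ->.
by rewrite mul0r.
Qed.

Lemma Mmx_mulX x y a b i j p q : (Mmx x y *m (Xmx p q *t 1%:M))
    (mxtens_index (a, b)) (mxtens_index (i, j)) =
  Mmx x y (mxtens_index (a, b)) (mxtens_index (i + q%:~R, j)) * chi (k%:R * (i + q%:~R)) ^ p.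
Proof.
rewrite mxE sum_mxtens -[RHS](sum_delta (i + q%:~R) (fun i' =>
  Mmx x y (mxtens_index (a, b)) (mxtens_index (i', j)) * chi (k%:R * i') ^ p)).
apply: eq_bigr => i' _.
rewrite -(sum_delta j (fun j' => Mmx x y (mxtens_index (a, b)) (mxtens_index (i', j')) * chi (k%:R * i') ^ p)).
rewrite mulr_sumr; apply: eq_bigr => j' _.
by rewrite tensmxE [Xmx _ _ _ _]mxE [1%:M _ _]mxE; ring.
Qed.

Lemma X_mulMmx x y a b i j p q : ((1%:M *t Xmx p q) *m Mmx x y)
    (mxtens_index (a, b)) (mxtens_index (i, j)) =
  chi (k%:R * b) ^ p * Mmx x y (mxtens_index (a, b - q%:~R)) (mxtens_index (i, j)).
Proof.
rewrite mxE sum_mxtens -[RHS](sum_delta a (fun a' =>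
  chi (k%:R * b) ^ p * Mmx x y (mxtens_index (a', b - q%:~R)) (mxtens_index (i, j)))).
apply: eq_bigr => a' _.
rewrite -(sum_delta (b - q%:~R) (fun b' => chi (k%:R * b) ^ p * Mmx x y (mxtens_index (a', b')) (mxtens_index (i, j)))).
rewrite mulr_sumr; apply: eq_bigr => b' _.
rewrite tensmxE [Xmx _ _ _ _]mxE [1%:M _ _]mxE [a' == a]eq_sym.
by rewrite [b' == _]eq_sym subr_eq; ring.
Qed.

(** A shift of x by tau/n raises a - i by one, which the Heisenberg operators undo:
    applied to the second factor of the target and to the first one of the source,
    since the operator interchanges the factors. *)
Lemma Mmx_shift x y p q :
  Mmx (x + (p%:~R + q%:~R * tau) / n%:R) y *m (Xmx p q *t 1%:M) =
  e (- (q%:~R * y)) *: ((1%:M *t Xmx p q) *m Mmx x y).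
Proof.
apply/matrixP => u v; rewrite [RHS]mxE.
case: (mxtens_indexP u) => a b; case: (mxtens_indexP v) => i j.
rewrite Mmx_mulX X_mulMmx !MmxE Kr_shift.
have -> : (a + (b - q%:~R) == i + j) = (a + b == i + q%:~R + j).
  by rewrite addrA subr_eq addrAC.
have [E|_] := eqVneq (a + b) (i + q%:~R + j); last by rewrite !mul0r !mulr0.
have -> : a - (i + q%:~R) + q%:~R = a - i by rewrite opprD addrA subrK.
have -> : chi (k%:R * b) = chi (k%:R * (j - a)) * chi (k%:R * (i + q%:~R)).
  rewrite -chiD // -mulrDr; congr (chi (_ * _)).
  by apply: (addrI a); rewrite E [RHS]addrC [RHS]addrAC subrK addrC.
rewrite !mul1r expfzMl.
by move: (chi (k%:R * (j - a)) ^ p) (chi (k%:R * (i + q%:~R)) ^ p) (Kr _ _ _ _ _) (e _) => *; ring.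
Qed.

Lemma Mmx_period x y p q : Mmx (x + (p%:~R + q%:~R * tau)) y =
  e (- (n%:R * q%:~R * y)) *: Mmx x y.
Proof.
apply/matrixP => u v; rewrite [RHS]mxE.
case: (mxtens_indexP u) => a b; case: (mxtens_indexP v) => i j.
by rewrite !MmxE Kr_period mulrCA.
Qed.

Lemma Mmx_period2 x y p q : Mmx x (y + (p%:~R + q%:~R * tau)) =
  e (- (n%:R * q%:~R * x)) *: Mmx x y.
Proof.
apply/matrixP => u v; rewrite [RHS]mxE.
case: (mxtens_indexP u) => a b; case: (mxtens_indexP v) => i j.
by rewrite !MmxE KrC Kr_period mulrCA KrC.
Qed.

Lemma Xmx_unit p q : Xmx p q \in unitmx.
Proof.
pose c := chi (k%:R * q%:~R) ^ p.
have c0 : c != 0 by rewrite expfz_neq0 // chi_neq0.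
have H : Xmx p q *m (c^-1 *: Xmx (- p) (- q)) = 1%:M.
  rewrite -scalemxAr; apply/matrixP => a i; rewrite mxE mxE [RHS]mxE.
  have -> : \sum_j Xmx p q a j * Xmx (- p) (- q) j i =
    \sum_(j : 'Z_n) (j == (a : 'Z_n) - q%:~R)%:R *
    (chi (k%:R * (a : 'Z_n)) ^ p * ((j == (i : 'Z_n) - q%:~R)%:R * chi (k%:R * j) ^ (- p))).
    apply: eq_bigr => j _; rewrite !mxE rmorphN /=.
    have -> : ((j : 'Z_n) == (a : 'Z_n) - q%:~R) = ((a : 'Z_n) == (j : 'Z_n) + q%:~R).
      by rewrite [RHS]eq_sym eq_sym subr_eq eq_sym.
    by move: (_ ^ p) (_ ^ (- p)) => *; ring.
  rewrite sum_delta (inj_eq (addIr _)).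
  have [->|_] := eqVneq (a : 'Z_n) i; last by rewrite mul0r !mulr0.
  have u0 : chi (k%:R * (i : 'Z_n)) ^ p != 0 by rewrite expfz_neq0 // chi_neq0.
  rewrite mul1r mulrBr chiD // chiN // expfzMl exprz_inv opprK -/c -invr_expz.
  move: (chi (k%:R * (i : 'Z_n)) ^ p) u0 => u u0.
  by rewrite (mulrA u) mulfV // mul1r mulVf.
by have [] := mulmx1_unit H.
Qed.

End OneCurve.
End Kronecker.

(** * Modular transformation of the operator R *)

Section MatrixExpansions.
Variable R : realType.
Local Notation C := R[i].
Variable m : nat.
Implicit Types (A B : C -> 'M[C]_m) (V W : 'M[C]_m) (x c d : C) (f : C -> C).

Definition mexpands A x V := forall u v, expands (fun z => A z u v) x (V u v).

Lemma mexpands_ex A x :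
  (forall u v, exists t, expands (fun z => A z u v) x t) -> exists V, mexpands A x V.
Proof.
move=> H; have [f Hf] := choice (fun uv : 'I_m * 'I_m => H uv.1 uv.2).
by exists (\matrix_(u, v) f (u, v)) => u v; rewrite mxE; exact: (Hf (u, v)).
Qed.

Lemma eq_mexpands A B x V : A =1 B -> mexpands A x V -> mexpands B x V.
Proof. by move=> /funext ->. Qed.

Lemma mexpands_cst V x : mexpands (fun=> V) x V.
Proof. by move=> u v; exact: expands_cst. Qed.

Lemma mexpandsM A B x V W : mexpands A x V -> mexpands B x W ->
  mexpands (fun z => A z *m B z) x (V *m W).
Proof.
move=> HA HB u v; rewrite mxE.
have := @expands_sum R _ (index_enum _) xpredT (fun w z => A z u w * B z w v)
  (fun w => V u w * W w v) x (fun w _ => expandsM (HA u w) (HB w v)).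
by apply: eq_expands => z; rewrite mxE.
Qed.

Lemma mexpandsS f A x t V : expands f x t -> mexpands A x V ->
  mexpands (fun z => f z *: A z) x (t *: V).
Proof.
move=> Hf HA u v; rewrite mxE; have := expandsM Hf (HA u v).
by apply: eq_expands => z; rewrite mxE.
Qed.

Lemma mexpandsB A B x V W : mexpands A x V -> mexpands B x W ->
  mexpands (fun z => A z - B z) x (V - W).
Proof.
move=> HA HB u v; rewrite !mxE; have := expandsB (HA u v) (HB u v).
by apply: eq_expands => z; rewrite !mxE.
Qed.

Lemma mexpands_affine A c d x V : c != 0 -> mexpands A (c * x + d) V ->
  mexpands (fun z => A (c * z + d)) x V.
Proof.
by move=> c0 H u v; exact: (@expands_affine R (fun z => A z u v) c d x _ c0 (H u v)).
Qed.

Lemma mexpands_shift A x d : (exists V, mexpands (fun z => A (z + d)) x V) ->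
  exists V, mexpands A (x + d) V.
Proof.
move=> [V HV]; exists V => u v.
have := @expands_shift R (fun z => A (z + d) u v) (- d) (x + d) (V u v).
rewrite addrK => /(_ (HV u v)); apply: eq_expands => z.
by rewrite subrK.
Qed.

(* The locus where A expands is stable under the periods of A. *)
Lemma mexpands_periods A (XL XR : 'M[C]_m) (f d : C) : f != 0 ->
  XL \in unitmx -> XR \in unitmx ->
  (forall x, A (x + d) *m XL = f *: (XR *m A x)) ->
  forall x (j : int), (exists V, mexpands A x V) ->
    exists V, mexpands A (x + j%:~R * d) V.
Proof.
move=> f0 uL uR Hs x j.
have step (B D : 'M[C]_m) d' : (forall z, A (z + d') = B *m A z *m D) ->
    forall z, (exists V, mexpands A z V) -> exists V, mexpands A (z + d') V.
  move=> E z [V HV]; apply: mexpands_shift; exists (B *m V *m D).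
  have := mexpandsM (mexpandsM (mexpands_cst B z) HV) (mexpands_cst D z).
  by apply: eq_mexpands => t; rewrite E.
have fwd z : A (z + d) = (f *: XR) *m A z *m invmx XL.
  by rewrite -scalemxAl -Hs mulmxK.
have bwd z : A (z + - d) = (f^-1 *: invmx XR) *m A z *m XL.
  have := Hs (z - d); rewrite subrK => Hz.
  by rewrite -mulmxA Hz -scalemxAl -scalemxAr scalerA mulVf // scale1r mulKmx.
have Hn d' : (forall z, (exists V, mexpands A z V) -> exists V, mexpands A (z + d') V) ->
    forall (i : nat) z, (exists V, mexpands A z V) -> exists V, mexpands A (z + i%:R * d') V.
  move=> H; elim=> [|i IH] z Hz; first by rewrite mul0r addr0.
  by rewrite -natr1 mulrDl mul1r addrA; apply/H/IH.
case: j => j Hx; first exact: Hn (step _ _ _ fwd) _ _ Hx.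
rewrite NegzE rmorphN /= mulNr -mulrN.
exact: Hn (step _ _ _ bwd) _ _ Hx.
Qed.

End MatrixExpansions.

Section Transport.
Variable R : realType.
Local Notation C := R[i].
Variables (n k : nat).
Hypothesis n_gt1 : (1 < n)%N.
Local Notation N := (Zp_trunc n).+2.
Local Notation M := (@Mmx R n k).
Local Notation X := (@Xmx R n k).
Implicit Types (x y z : C) (u v w : 'I_(N * N)).

Let n0 : n%:R != 0 :> C. Proof. exact: nC_neq0. Qed.

Lemma Mmx_expands tau x y : 0 < complex.Im tau ->
  n%:R * x \notin lattice tau -> n%:R * y \notin lattice tau ->
  mexpands (fun z => M tau z y) x (M tau x y).
Proof.
move=> t0 xr yr u v; case: (mxtens_indexP u) => a b; case: (mxtens_indexP v) => i j.
apply: eq_expands (_ : expands (fun z => (a + b == i + j)%:R * Kr tau (a - i) (k%:R * (j - a)) z y) _ _).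
  by move=> z; rewrite MmxE.
by rewrite MmxE; apply/expandsZ/Kr_expands.
Qed.

(** The pole at x = 0 requires a = i, hence b = j: the residue is a scalar matrix. *)
Lemma Mmx_residue tau : 0 < complex.Im tau -> exists2 c : C, c != 0 &
  forall y, n%:R * y \notin lattice tau -> mexpands (fun x => x *: M tau x y) 0 c%:M.
Proof.
move=> t0; have [c c0 Hc] := Kr_residue n_gt1 t0; exists c => // y yr u v.
rewrite mxE -mulr_natl.
case: (mxtens_indexP u) => a b; case: (mxtens_indexP v) => i j.
have -> : (mxtens_index (a, b) == mxtens_index (i, j)) = (a + b == i + j) && (a - i == 0).
  rewrite (can_eq (@mxtens_indexK N N)) xpair_eqE subr_eq0.
  by have [->|] := eqVneq a i; rewrite ?andbF // (inj_eq (addrI i)) andbT.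
have := expandsZ (a + b == i + j)%:R (Hc (a - i) (k%:R * (j - a)) y yr).
rewrite mulrA -natrM mulnb; apply: eq_expands => x.
by rewrite mxE MmxE; ring.
Qed.

Local Opaque Mmx Xmx.

Variables (tau tau' c : C) (p q r s : int) (P : 'M[C]_N) (s1 s2 : C).
Hypothesis tau_gt0 : 0 < complex.Im tau.
Hypothesis tau'_gt0 : 0 < complex.Im tau'.
Hypothesis c1E : c = p%:~R + q%:~R * tau'.
Hypothesis ctE : c * tau = r%:~R + s%:~R * tau'.
Hypothesis det1 : p * s - q * r = 1.
Hypothesis s1_neq0 : s1 != 0.
Hypothesis s2_neq0 : s2 != 0.
Hypothesis PX1 : P *m X 1 0 = s1 *: (X p q *m P).
Hypothesis PX2 : P *m X 0 1 = s2 *: (X r s *m P).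
Let Phi : 'M[C]_(N * N) := P *t P.

Let c_neq0 : c != 0.
Proof.
apply/eqP => c0; have := ctE; rewrite c0 mul0r; move: c1E; rewrite c0.
move=> E1 E2; have := det1.
have im (a b : int) : 0 = a%:~R + b%:~R * tau' -> a = 0 /\ b = 0.
  move=> E; have b0 : b = 0.
    have := congr1 (@complex.Im R) E; rewrite ImD ImM Im_int Re_int Im_int /= mul0r add0r addr0.
    by move=> /esym/eqP; rewrite mulf_eq0 (gt_eqF tau'_gt0) orbF intr_eq0 => /eqP.
  by move: E; rewrite b0 mul0r addr0 => /esym/eqP; rewrite intr_eq0 => /eqP.
by have [-> ->] := im _ _ E1; rewrite !mul0r subrr.
Qed.

Lemma det1C : p%:~R * s%:~R - q%:~R * r%:~R = 1 :> C.
Proof. by rewrite -!intrM -intrB det1. Qed.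

Lemma lattice_mulc z : c * z \in lattice tau' -> z \in lattice tau.
Proof.
move=> /latticeP[a [b E]]; apply/latticeP.
exists (a * s - b * r), (b * p - a * q).
apply: (mulfI c_neq0); rewrite E mulrDr mulrCA ctE c1E !intrB !intrM.
transitivity ((p%:~R * s%:~R - q%:~R * r%:~R) * (a%:~R + b%:~R * tau')).
  by rewrite det1C mul1r.
by ring.
Qed.

Lemma qctau : q%:~R * (c * tau) = s%:~R * c - 1.
Proof.
transitivity (s%:~R * c - (p%:~R * s%:~R - q%:~R * r%:~R)); last by rewrite det1C.
by rewrite ctE c1E; ring.
Qed.

Lemma tensmxZl (t : C) (A B : 'M[C]_N) : (t *: A) *t B = t *: (A *t B).
Proof. by apply/matrixP => u v; rewrite !mxE mulrA. Qed.

Lemma tensmxZr (t : C) (A B : 'M[C]_N) : A *t (t *: B) = t *: (A *t B).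
Proof. by apply/matrixP => u v; rewrite !mxE mulrCA. Qed.

Lemma tens_shift (A B : 'M[C]_N) (t : C) : P *m A = t *: (B *m P) ->
  Phi *m (A *t 1%:M) = t *: ((B *t 1%:M) *m Phi) /\
  Phi *m (1%:M *t A) = t *: ((1%:M *t B) *m Phi).
Proof.
move=> E; rewrite /Phi !tensmx_mul !mulmx1 !mul1mx E.
by rewrite tensmxZl tensmxZr.
Qed.

Variables (y rho : C).

(** The difference between the two sides of the modular transformation formula.
    The exponential factor turns the multipliers attached to tau' into those
    attached to tau. *)
Definition Hmx x : 'M[C]_(N * N) :=
  e (n%:R * q%:~R * c * x * y) *: (M tau' (c * x) (c * y) *m Phi) -
  rho *: (Phi *m M tau x y).

Lemma Hmx_shift (p0 q0 p' q' : int) (t : C) : 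
  c * (p0%:~R + q0%:~R * tau) = p'%:~R + q'%:~R * tau' ->
  q%:~R * c * (p0%:~R + q0%:~R * tau) = q'%:~R * c - q0%:~R ->
  P *m X p0 q0 = t *: (X p' q' *m P) ->
  forall x, Hmx (x + (p0%:~R + q0%:~R * tau) / n%:R) *m (X p0 q0 *t 1%:M) =
    (t * e (- (q0%:~R * y))) *: ((1%:M *t X p' q') *m Hmx x).
Proof.
move=> cE qE PX x; have [T1 T2] := tens_shift PX.
rewrite /Hmx mulmxBl mulmxBr scalerBr; congr (_ - _).
  rewrite -scalemxAl -mulmxA T1 -scalemxAr mulmxA.
  have -> : c * (x + (p0%:~R + q0%:~R * tau) / n%:R) =
      c * x + (p'%:~R + q'%:~R * tau') / n%:R by rewrite mulrDr mulrA cE.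
  rewrite (Mmx_shift k n_gt1 tau'_gt0) -scalemxAl -scalemxAr !scalerA -mulmxA; congr (_ *: _).
  rewrite mulrCA -[RHS]mulrA; congr (_ * _); rewrite -!eD; congr e.
  have -> : n%:R * q%:~R * c * (x + (p0%:~R + q0%:~R * tau) / n%:R) * y =
    n%:R * q%:~R * c * x * y + q%:~R * c * (p0%:~R + q0%:~R * tau) * y by field.
  by rewrite qE; ring.
rewrite -scalemxAl -mulmxA (Mmx_shift k n_gt1 tau_gt0) -!scalemxAr mulmxA T2.
by rewrite -scalemxAl !scalerA -mulmxA; congr (_ *: _); ring.
Qed.

Lemma Hmx_period (p0 q0 p' q' : int) :
  c * (p0%:~R + q0%:~R * tau) = p'%:~R + q'%:~R * tau' ->
  q%:~R * c * (p0%:~R + q0%:~R * tau) = q'%:~R * c - q0%:~R ->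
  forall x, Hmx (x + (p0%:~R + q0%:~R * tau)) = e (- (n%:R * q0%:~R * y)) *: Hmx x.
Proof.
move=> cE qE x; rewrite /Hmx scalerBr [c * (x + _)]mulrDr cE.
rewrite (Mmx_period k n_gt1 tau'_gt0) (Mmx_period k n_gt1 tau_gt0).
rewrite -scalemxAl -scalemxAr !scalerA; congr (_ *: _ - _ *: _); last by rewrite mulrC.
rewrite -!eD; congr e.
have -> : n%:R * q%:~R * c * (x + (p0%:~R + q0%:~R * tau)) * y =
  n%:R * q%:~R * c * x * y + n%:R * (q%:~R * c * (p0%:~R + q0%:~R * tau)) * y by ring.
by rewrite qE; ring.
Qed.

Hypothesis y_reg : n%:R * y \notin lattice tau.

Let cy_reg : n%:R * (c * y) \notin lattice tau'.
Proof. by apply: contra y_reg => h; apply: lattice_mulc; rewrite mulrCA. Qed.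

Lemma expands_factor x : expands (fun z => e (n%:R * q%:~R * c * z * y)) x
  (e (n%:R * q%:~R * c * x * y)).
Proof.
have := expands_exp (n%:R * q%:~R * c * y) 0 x; rewrite addr0 [X in e X]mulrAC.
by apply: eq_expands => z; rewrite addr0 [X in e X]mulrAC.
Qed.

Lemma Hmx_expands x : n%:R * x \notin lattice tau -> mexpands Hmx x (Hmx x).
Proof.
move=> xr.
have cxr : n%:R * (c * x) \notin lattice tau'.
  by apply: contra xr => h; apply: lattice_mulc; rewrite mulrCA.
have HM' : mexpands (fun z => M tau' (c * z + 0) (c * y)) x (M tau' (c * x) (c * y)).
  apply: (@mexpands_affine _ _ (fun z => M tau' z (c * y)) c 0 x _ c_neq0).
  by rewrite addr0; apply: Mmx_expands.
have H1 := mexpandsS (expands_factor x) (mexpandsM HM' (mexpands_cst Phi x)).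
have H2 := mexpandsS (expands_cst rho x)
  (mexpandsM (mexpands_cst Phi x) (Mmx_expands tau_gt0 xr y_reg)).
by apply: eq_mexpands (mexpandsB H1 H2) => z; rewrite addr0.
Qed.

(** The constant rho makes the residues at the origin cancel: both are scalar
    matrices, hence commute with P (x) P. *)
Lemma Hmx_residue (v v' : C) : v != 0 -> rho = v' / (c * v) ->
  (forall y, n%:R * y \notin lattice tau -> mexpands (fun x => x *: M tau x y) 0 v%:M) ->
  (forall y, n%:R * y \notin lattice tau' -> mexpands (fun x => x *: M tau' x y) 0 v'%:M) ->
  mexpands (fun x => x *: Hmx x) 0 0.
Proof.
move=> v0 rhoE Hv Hv'.
have HM' : mexpands (fun z => (c * z + 0) *: M tau' (c * z + 0) (c * y)) 0 v'%:M.
  apply: (@mexpands_affine _ _ (fun z => z *: M tau' z (c * y)) c 0 0 _ c_neq0).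
  by rewrite mulr0 addr0; exact: Hv'.
have H1 := mexpandsS (expandsZ c^-1 (expands_factor 0)) (mexpandsM HM' (mexpands_cst Phi 0)).
have H2 := mexpandsS (expands_cst rho 0) (mexpandsM (mexpands_cst Phi 0) (Hv y y_reg)).
have E0 : (c^-1 * e (n%:R * q%:~R * c * 0 * y)) *: (v'%:M *m Phi) - rho *: (Phi *m v%:M) = 0.
  rewrite mulr0 mul0r e0 mulr1 mul_scalar_mx mul_mx_scalar !scalerA -scalerBl.
  suff -> : c^-1 * v' - rho * v = 0 by rewrite scale0r.
  by rewrite rhoE; field; rewrite v0 c_neq0.
have := mexpandsB H1 H2; rewrite E0; apply: eq_mexpands => x.
rewrite addr0 /Hmx scalerBr -scalemxAl -scalemxAr !scalerA [x * rho]mulrC.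
by congr (_ *: _ - _); field.
Qed.

Local Opaque Hmx.

(** Removability of the singularity of Hmx at x0. *)
Definition expandable x0 := exists V, mexpands Hmx x0 V.

Lemma expandable_0 : mexpands (fun x => x *: Hmx x) 0 0 -> expandable 0.
Proof.
move=> H; apply: mexpands_ex => u v.
have H' : expands (fun x => (x *: Hmx x) u v) 0 0 by have := H u v; rewrite mxE.
have [t Ht] := expands_divX H'.
exists t; apply: expands_near ltr01 _ Ht => w w0 _.
have E : (w *: Hmx w) u v = w * Hmx w u v by exact: mxE.
have E2 : Hmx w u v = (w *: Hmx w) u v / w by rewrite E mulrAC divff // mul1r.
by rewrite add0r subr0; exact: E2.
Qed.

Lemma expandable_step (p0 q0 p' q' : int) (t : C) : t != 0 ->
  c * (p0%:~R + q0%:~R * tau) = p'%:~R + q'%:~R * tau' ->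
  q%:~R * c * (p0%:~R + q0%:~R * tau) = q'%:~R * c - q0%:~R ->
  P *m X p0 q0 = t *: (X p' q' *m P) ->
  forall x (m : int), expandable x ->
    expandable (x + m%:~R * ((p0%:~R + q0%:~R * tau) / n%:R)).
Proof.
move=> t0 cE qE PX x m.
apply: (@mexpands_periods _ _ _ (X p0 q0 *t 1%:M) (1%:M *t X p' q') (t * e (- (q0%:~R * y)))).
- by rewrite mulf_neq0 ?e_neq0.
- by rewrite tensmx_unit ?unitmx1 ?Xmx_unit.
- by rewrite tensmx_unit ?unitmx1 ?Xmx_unit.
- exact: Hmx_shift.
Qed.

(** Translations by points of order n carry the removable singularity at the origin
    to all other points of order n; Hmx is then entire, with constant multipliers
    given by y, which is not a lattice point after multiplication by n. *)
Lemma Hmx_eq0 : expandable 0 -> forall x, n%:R * x \notin lattice tau -> Hmx x = 0.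
Proof.
move=> H0.
have c1 : c * (1%:~R + 0%:~R * tau) = p%:~R + q%:~R * tau'.
  by rewrite mul0r addr0 mulr1.
have c2 : c * (0%:~R + 1%:~R * tau) = r%:~R + s%:~R * tau'.
  by rewrite mul1r add0r.
have q1 : q%:~R * c * (1%:~R + 0%:~R * tau) = q%:~R * c - 0%:~R.
  by rewrite mul0r addr0 mulr1 subr0.
have q2 : q%:~R * c * (0%:~R + 1%:~R * tau) = s%:~R * c - 1%:~R.
  by rewrite mul1r add0r -mulrA qctau.
have Hall x : expandable x.
  have [xL|xr] := boolP (n%:R * x \in lattice tau); last by exists (Hmx x); exact: Hmx_expands.
  have [a [b E]] := latticeP _ _ xL.
  have -> : x = 0 + a%:~R * ((1%:~R + 0%:~R * tau) / n%:R) + b%:~R * ((0%:~R + 1%:~R * tau) / n%:R).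
    by apply: (mulfI n0); rewrite E; field.
  apply: (expandable_step s2_neq0 c2 q2 PX2).
  exact: (expandable_step s1_neq0 c1 q1 PX1).
move=> x xr; apply/matrixP => u v; rewrite [RHS]mxE.
pose G z := Hmx z u v.
have G1 z : exists t, expands G z t by have [V HV] := Hall z; exists (V u v); exact: HV.
have G2 z : n%:R * z \notin lattice tau -> expands G z (G z).
  by move=> zr; exact: (Hmx_expands zr).
have G3 z : G (z + 1) = G z.
  have := Hmx_period c1 q1 z; rewrite mul0r addr0 mulr0 mul0r oppr0 e0 scale1r.
  by rewrite /G => ->.
have G4 z : G (z + tau) = e (- (n%:R * y)) * G z.
  have := Hmx_period c2 q2 z; rewrite add0r mul1r mulr1 /G => ->.
  by rewrite [LHS]mxE.
exact: (removable_quasi_periodic_eq0 (ltnW n_gt1) tau_gt0 y_reg G1 G2 G3 G4 xr).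
Qed.

End Transport.

(** * Intertwiners of the Heisenberg group *)

Section Intertwiner.
Variable R : realType.
Local Notation C := R[i].
Variables (n k : nat).
Hypothesis n_gt1 : (1 < n)%N.
Hypothesis nk_coprime : coprime n k.
Local Notation N := (Zp_trunc n).+2.
Local Notation X := (@Xmx R n k).
Local Notation chi := (@chi R n).

Lemma Xmx_mul p q p' q' :
  X p q *m X p' q' = (chi (k%:R * q%:~R) ^ p')^-1 *: X (p + p') (q + q').
Proof.
apply/matrixP => a i; rewrite [RHS]mxE mxE [X (p + p') _ _ _]mxE.
have -> : \sum_j X p q a j * X p' q' j i = \sum_(j : 'Z_n) (j == (a : 'Z_n) - q%:~R)%:R *
    (chi (k%:R * (a : 'Z_n)) ^ p * ((j == (i : 'Z_n) + q'%:~R)%:R * chi (k%:R * j) ^ p')).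
  apply: eq_bigr => j _; rewrite !mxE.
  have -> : ((j : 'Z_n) == (a : 'Z_n) - q%:~R) = ((a : 'Z_n) == (j : 'Z_n) + q%:~R).
    by rewrite [RHS]eq_sym eq_sym subr_eq eq_sym.
  by move: (_ ^ p) (_ ^ p') => *; ring.
rewrite sum_delta subr_eq -addrA [q'%:~R + _]addrC -rmorphD /=.
rewrite mulrBr chiD // chiN // expfzMl exprz_inv -invr_expz.
rewrite expfzDr ?chi_neq0 //.
by move: (_ == _) (_ ^ p) (_ ^ p') (_ ^ p') => *; ring.
Qed.

Lemma Xmx_comm (p q r s : int) : p * s - q * r = 1 ->
  X p q *m X r s = chi k%:R *: (X r s *m X p q).
Proof.
move=> det1; rewrite !Xmx_mul scalerA [r + p]addrC [s + q]addrC; congr (_ *: _).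
have E (a b : int) : chi (k%:R * a%:~R) ^ b = chi k%:R ^ (a * b).
  by rewrite mulrC chi_mulz // exprz_exp.
have aux (z : C) (u v : int) : z != 0 -> u - v = 1 -> (z ^ v)^-1 = z / z ^ u.
  move=> z0 /eqP; rewrite subr_eq addrC => /eqP ->.
  by rewrite expfzDr // expr1z invfM mulrCA divff // mulr1.
rewrite (E q r) (E s p); apply: aux; first exact: chi_neq0.
by rewrite [s * p]mulrC.
Qed.

Lemma Xmx00 : X 0 0 = 1%:M.
Proof. by apply/matrixP => a i; rewrite !mxE addr0 expr0z mulr1. Qed.

(** A scalar, since translations by n in Z/n are trivial. *)
Lemma Xmx_order (p q : int) : exists2 t : C, t != 0 & X p q ^+ n = t%:M.
Proof.
have H (m : nat) : exists2 t : C, t != 0 & X p q ^+ m = t *: X (m%:Z * p) (m%:Z * q).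
  elim: m => [|m [t t0 IH]].
    by exists 1; rewrite ?oner_eq0 // expr0 !mul0r Xmx00 scale1r.
  exists (t * (chi (k%:R * q%:~R) ^ (m%:Z * p))^-1).
    by rewrite mulf_neq0 // invr_eq0 expfz_neq0 // chi_neq0.
  rewrite exprS IH -mulmxE -scalemxAr Xmx_mul scalerA; congr (_ *: X _ _).
    by rewrite -addn1 PoszD mulrDl mul1r addrC.
  by rewrite -addn1 PoszD mulrDl mul1r addrC.
have [t t0 E] := H n; exists t => //; rewrite E.
have nZ : (n%:Z)%:~R = 0 :> 'Z_n by exact: pchar_Zp.
suff -> : X (n%:Z * p) (n%:Z * q) = 1%:M by rewrite scalemx1.
apply/matrixP => a i; rewrite !mxE intrM nZ mul0r addr0.
by rewrite -chi_mulz // intrM nZ !mul0r chi0 // mulr1.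
Qed.

Lemma chi_pow_n (a : 'Z_n) : chi a ^+ n = 1.
Proof. by rewrite exprnP -chi_mulz // (pchar_Zp n_gt1 : (n%:Z)%:~R = 0) mul0r chi0. Qed.

Lemma chi_k_neq1 (a : 'Z_n) : a != 0 -> chi (k%:R * a) != 1.
Proof.
move=> a0; rewrite -(chi0 R n_gt1); apply: contra_neq a0 => /(chi_inj n_gt1) E.
have uk : (k%:R : 'Z_n) \is a GRing.unit by rewrite unitZpE.
by rewrite -[a](mulKr uk) E mulr0.
Qed.

Lemma eigenvector m (A : 'M[C]_m.+1) : exists mu : C, exists2 v : 'cV[C]_m.+1,
  v != 0 & A *m v = mu *: v.
Proof.
have /closed_rootP[mu] : size (char_poly A^T) != 1%N by rewrite size_char_poly.
rewrite -eigenvalue_root_char => /eigenvalueP[v Ev v0].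
exists mu, v^T; first by rewrite -trmx0 (inj_eq trmx_inj).
by apply: trmx_inj; rewrite trmx_mul trmxK Ev linearZ /= trmxK.
Qed.

(** Stone-von Neumann: the pairs of Heisenberg operators attached to two
    oriented bases of Z^2 are conjugate up to scalars.  The intertwiner sends
    x_i to a multiple of B^i v, where A = X p q, B = X r s and v is an eigenvector
    of A. *)
Lemma intertwiner (p q r s : int) : p * s - q * r = 1 ->
  exists P : 'M[C]_N, exists s1 s2 : C, [/\ P \in unitmx, s1 != 0, s2 != 0,
    P *m X 1 0 = s1 *: (X p q *m P) & P *m X 0 1 = s2 *: (X r s *m P)].
Proof.
move=> det1; set A := X p q; set B := X r s.
have [mu [v v0 Av]] := eigenvector A.
have uA : A \in unitmx by exact: Xmx_unit.
have uB : B \in unitmx by exact: Xmx_unit.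
have mu0 : mu != 0.
  apply: contra_neq v0 => mu0; rewrite -[v](mulKmx uA) Av mu0 scale0r.
  by rewrite mulmx0.
have [t t0 Bn] := Xmx_order r s.
pose b : C := n.-root t^-1.
have bn : b ^+ n = t^-1 by rewrite /b rootCK // ltnW.
have b0 : b != 0.
  by apply: contra_neq t0 => b0; rewrite -[t]invrK -bn b0 expr0n gtn_eqF ?invr0 // ltnW.
pose f (j : nat) : 'cV[C]_N := b ^+ j *: (B ^+ j *m v).
have fS j : f j.+1 = b *: (B *m f j).
  by rewrite /f !exprS -mulmxE -scalemxAr scalerA mulmxA.
have fA j : A *m f j = (mu * chi k%:R ^+ j) *: f j.
  elim: j => [|j IH]; first by rewrite /f !expr0 !scale1r mul1mx mulr1.
  rewrite fS -scalemxAr mulmxA (Xmx_comm det1) -/A -/B -scalemxAl -mulmxA IH.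
  by rewrite -scalemxAr !scalerA exprS; congr (_ *: _); ring.
have f0 j : f j != 0.
  elim: j => [|j IH]; first by rewrite /f !expr0 scale1r mul1mx.
  rewrite fS scaler_eq0 negb_or b0 /=; apply: contra_neq IH => E.
  by rewrite -[f j](mulKmx uB) E mulmx0.
have fn (j : nat) : f (j + n)%N = f j.
  have -> : f (j + n)%N = b ^+ n *: (b ^+ j *: (B ^+ j *m (B ^+ n *m v))).
    by rewrite /f !exprD scalerA [b ^+ n * _]mulrC -mulmxE mulmxA.
  rewrite bn Bn mul_scalar_mx -scalemxAr !scalerA; congr (_ *: _).
  by field.
have fmod (j : nat) : f (j %% n)%N = f j.
  rewrite [in RHS](divn_eq j n) addnC; elim: (j %/ n)%N => [|m IH]; first by rewrite addn0.
  by rewrite mulSn addnCA addnC fn.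
pose P : 'M[C]_N := \matrix_(a, i) ((f (nat_of_ord i)) a ord0).
have Pf a (i : 'Z_n) : P a i = (f (nat_of_ord i)) a 0 by rewrite mxE.
have AP (Z : 'M[C]_N) a (i : 'Z_n) : (Z *m P) a i = (Z *m f (nat_of_ord i)) a 0.
  by rewrite !mxE; apply: eq_bigr => j _; rewrite Pf.
have chiE (i : 'Z_n) : chi (k%:R * i) = chi k%:R ^+ i.
  by rewrite -[i in LHS]natr_Zp mulrC (chi_mulz R n_gt1 (nat_of_ord i)%:Z).
have PX1 : P *m X 1 0 = mu^-1 *: (A *m P).
  apply/matrixP => a i; rewrite [RHS]mxE AP fA [(_ *: f i) _ _]mxE mxE.
  rewrite (eq_bigr (fun j : 'Z_n => (j == (i : 'Z_n))%:R * (P a j * chi (k%:R * j)))).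
    by rewrite sum_delta Pf chiE; field.
  by move=> j _; rewrite [X 1 0 _ _]mxE addr0 expr1z; ring.
have PX2 : P *m X 0 1 = b *: (B *m P).
  apply/matrixP => a i; rewrite [RHS]mxE AP mxE.
  rewrite (eq_bigr (fun j : 'Z_n => (j == (i : 'Z_n) + 1)%:R * P a j)).
    rewrite sum_delta Pf.
    have -> : nat_of_ord ((i : 'Z_n) + 1) = (i.+1 %% n)%N.
      by rewrite -[i in LHS]natr_Zp natr1 val_Zp_nat.
    by rewrite fmod fS mxE.
  by move=> j _; rewrite [X 0 1 _ _]mxE expr0z mulr1 mulrC.
exists P, mu^-1, b; split; [ | by rewrite invr_eq0 | exact: b0 | exact: PX1 | exact: PX2].
(* The kernel of P is stable under the diagonal matrix X 1 0; averaging over the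
   powers of X 1 0 separates the coordinates of a kernel vector. *)
rewrite unitmxE unitfE -det_tr; apply/negP => /det0P[w w0 wP].
move/eqP: w0; apply; apply: trmx_inj; rewrite trmx0.
set W := w^T; have PW : P *m W = 0.
  by apply: trmx_inj; rewrite trmx_mul trmxK wP trmx0.
have PXW j : P *m (X 1 0 ^+ j *m W) = 0.
  elim: j => [|j IH]; first by rewrite expr0 mul1mx.
  rewrite exprS -mulmxE -mulmxA mulmxA PX1 -scalemxAl -mulmxA IH.
  by rewrite mulmx0 scaler0.
have XW j (l : 'Z_n) : (X 1 0 ^+ j *m W) l 0 = chi (k%:R * l) ^+ j * W l 0.
  elim: j => [|j IH]; first by rewrite !expr0 mul1mx mul1r.
  rewrite exprS -mulmxE -mulmxA mxE.
  rewrite (eq_bigr (fun j' : 'Z_n => (j' == l)%:R * (chi (k%:R * l) * (X 1 0 ^+ j *m W) j' 0))).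
    by rewrite sum_delta IH exprS mulrA.
  by move=> j' _; rewrite [X 1 0 _ _]mxE addr0 expr1z eq_sym; ring.
apply/matrixP => i j; rewrite ord1 {j} [RHS]mxE.
pose S := \sum_(j < n) chi (- (k%:R * (i : 'Z_n))) ^+ j *: (X 1 0 ^+ j *m W).
have PS : P *m S = 0.
  rewrite mulmx_sumr big1 // => j _; by rewrite -scalemxAr PXW scaler0.
have SE (l : 'Z_n) : S l 0 = (l == i)%:R * (n%:R * W i 0).
  rewrite summxE (eq_bigr (fun j : 'I_n => chi (k%:R * (l - (i : 'Z_n))) ^+ j * W l 0)).
    rewrite -mulr_suml; have [->|li] := eqVneq l (i : 'Z_n).
      rewrite subrr mulr0 chi0 // (eq_bigr (fun=> 1)) => [|j _]; last by rewrite expr1n.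
      by rewrite sumr_const card_ord mul1r.
    rewrite mul0r.
    have h1 : chi (k%:R * (l - (i : 'Z_n))) - 1 != 0.
      by rewrite subr_eq0 chi_k_neq1 // subr_eq0.
    apply/eqP; rewrite mulf_eq0 -(mulrI_eq0 _ (mulfI h1)) -subrX1 chi_pow_n subrr.
    by rewrite eqxx.
  move=> j _; rewrite [LHS]mxE XW mulrA; congr (_ * _).
  rewrite -exprMn; congr (_ ^+ _); rewrite -chiD //; congr chi.
  by rewrite mulrBr addrC.
have PSi a : P a i * (n%:R * W i 0) = 0.
  have := congr1 (fun Z : 'cV[C]_N => Z a 0) PS; rewrite /= [in X in _ = X]mxE => <-.
  rewrite [RHS]mxE (eq_bigr (fun l : 'Z_n => (l == (i : 'Z_n))%:R * (P a l * (n%:R * W i 0)))).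
    by rewrite sum_delta.
  by move=> l _; rewrite SE; ring.
have [a Pa] : exists a, P a i != 0.
  apply: contrapT => Hn; have /eqP := f0 i; apply; apply/matrixP => a j.
  rewrite ord1 [RHS]mxE -Pf; apply: contrapT => /eqP h; by apply: Hn; exists a.
have /eqP := PSi a; rewrite !mulf_eq0 (negbTE Pa) /= pnatr_eq0 gtn_eqF ?(ltnW n_gt1) //=.
by move/eqP.
Qed.

End Intertwiner.

(** * The operator R on the diagonal *)

Section Diagonal.
Variable R : realType.
Local Notation C := R[i].
Variables (n k : nat).
Hypothesis n_gt1 : (1 < n)%N.
Local Notation N := (Zp_trunc n).+2.
Local Notation idx := (@mxtens_index N N).
Variable tau : C.
Hypothesis tau_gt0 : 0 < complex.Im tau.
Implicit Types (a b i j al be : 'Z_n) (z eta : C).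

Let n_gt0 : (0 < n)%N. Proof. exact: ltnW. Qed.

Definition mxV2 (A : 'M[C]_(N * N)) (v : V2 R n) : V2 R n :=
  [ffun p => \sum_(q : 'Z_n * 'Z_n) A (idx p) (idx q) * v q].

Lemma mxV2_is_linear A : linear (mxV2 A).
Proof.
move=> c u v; apply/ffunP => p; rewrite !ffunE /GRing.scale /= mulr_sumr -big_split /=.
by apply: eq_bigr => q _; rewrite !ffunE /GRing.scale /=; ring.
Qed.

HB.instance Definition _ A :=
  GRing.isLinear.Build C (V2 R n) (V2 R n) *:%R (mxV2 A) (mxV2_is_linear A).

Lemma mxV2M A B v : mxV2 (A *m B) v = mxV2 A (mxV2 B v).
Proof.
apply/ffunP => p; rewrite !ffunE.
under [RHS]eq_bigr => q _ do rewrite ffunE mulr_sumr.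
rewrite exchange_big /=; apply: eq_bigr => q _.
rewrite mxE sum_mxtens pair_bigA mulr_suml /=; apply: eq_bigr => -[a b] _ /=.
by rewrite mulrA.
Qed.

Lemma mxV2Z (c : C) A v : mxV2 (c *: A) v = c *: mxV2 A v.
Proof.
apply/ffunP => p; rewrite !ffunE /GRing.scale /= mulr_sumr; apply: eq_bigr => q _.
by rewrite mxE mulrA.
Qed.

(** The scalar prefactor of R. *)
Definition Dp z : C := (\prod_(a : 'Z_n) thetaZ tau a (- z)) /
   (\prod_(a : 'Z_n | a != 0) thetaZ tau a 0).

Lemma R_formulaE z eta (v : V2 R n) :
  R_formula n k tau z eta v = mxV2 (Dp z *: @Mmx R n k tau (- z) eta) v.
Proof.
rewrite /R_formula lfunE; apply/ffunP => -[a b].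
rewrite /R_fun sum_ffunE ffunE; apply: eq_bigr => -[i j] _.
rewrite !ffunE /GRing.scale /= [RHS]mulrC; congr (_ * _).
rewrite mxE MmxE sum_ffunE; congr (_ * _).
rewrite (bigD1 (j - a)) //= !ffunE subKr.
rewrite big1 ?addr0 => [|r rja]; last first.
  rewrite !ffunE xpair_eqE /=.
  have [E|_] := eqVneq a (j - r); last by rewrite scaler0.
  by move: rja; rewrite E subKr eqxx.
rewrite xpair_eqE eqxx /= /GRing.scale /= mulrC.
have -> : (b == i + (j - a)) = (a + b == i + j).
  by rewrite addrA eq_sym subr_eq eq_sym [b + a]addrC.
congr (_ * _); rewrite /R_coef /Kr.
have -> : j - i + (j - a) * (k%:R - 1) = a - i + k%:R * (j - a) by ring.
by have -> : j - i - (j - a) = a - i by ring.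
Qed.

(** The coefficients of R at z = eta, with the factors theta_al(-eta) and
    theta_be(eta) of the denominator cancelled against the prefactor; this needs
    al <> - be, and otherwise theta_(al+be)(0) = 0. *)
Definition Ent (al be : 'Z_n) eta : C := if al + be == 0 then 0 else
  thetaZ tau (al + be) 0 / (\prod_(a : 'Z_n | a != 0) thetaZ tau a 0) *
  (- (e (- (n%:R * eta)) * chi R (- be))) *
  \prod_(a : 'Z_n | (a != al) && (a != - be)) thetaZ tau a (- eta).

(** The matrix of R at z = eta, free of the apparent singularities. *)
Definition Emx eta : 'M[C]_(N * N) := \matrix_(u, v)
  let: (a, b) := mxtens_unindex u in let: (i, j) := mxtens_unindex v in
  ((a : 'Z_n) + b == (i : 'Z_n) + j)%:R * Ent ((a : 'Z_n) - i) (k%:R * ((j : 'Z_n) - a)) eta.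

Lemma EmxE eta a b i j : Emx eta (idx (a, b)) (idx (i, j)) =
  (a + b == i + j)%:R * Ent (a - i) (k%:R * (j - a)) eta.
Proof. by rewrite mxE !mxtens_indexK. Qed.

Lemma thprod0_neq0 : \prod_(a : 'Z_n | a != 0) thetaZ tau a 0 != 0.
Proof. by apply/prodf_neq0 => a a0; exact: thetaZ_neq0. Qed.

(** theta_be(eta) is a nonzero multiple of theta_(-be)(-eta), by thetaZ_opp. *)
Lemma Ent_regular al be eta : n%:R * eta \notin lattice tau ->
  Dp eta * Kr tau al be (- eta) eta = Ent al be eta.
Proof.
move=> er; rewrite /Kr /Ent /Dp addNr; have [->|ab] := eqVneq (al + be) 0.
  by rewrite thetaZ_0 // mul0r mulr0.
have t0 (a : 'Z_n) : thetaZ tau a (- eta) != 0.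
  by apply: thetaZ_regular => //; rewrite mulrN rpredN.
have := thetaZ_opp n_gt1 tau_gt0 (- be) (- eta); rewrite !opprK mulrN opprK => ->.
rewrite (bigD1 al) //= (bigD1 (- be)) /=; last first.
  by apply: contraNneq ab => <-; rewrite addNr.
rewrite eN; have := t0 al; have := t0 (- be); have := thprod0_neq0.
have := chi_neq0 R (- be); have := e_neq0 (n%:R * eta).
move: (e _) (chi _ _) (\prod_(a | a != 0) _) (\prod_(a | _ && _) _) (thetaZ _ (- be) _).
by move: (thetaZ _ al _) (thetaZ _ _ 0) => *; field; apply/and5P.
Qed.

Lemma Emx_regular eta : n%:R * eta \notin lattice tau ->
  Dp eta *: @Mmx R n k tau (- eta) eta = Emx eta.
Proof.
move=> er; apply/matrixP => u v; rewrite [LHS]mxE.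
case: (mxtens_indexP u) => a b; case: (mxtens_indexP v) => i j.
by rewrite EmxE MmxE mulrCA Ent_regular.
Qed.

Lemma expands_thetaZN (a : 'Z_n) eta :
  expands (fun z => thetaZ tau a (- z)) eta (thetaZ tau a (- eta)).
Proof.
have := expands_affine (c := -1) (d := 0) _ (expands_thetaZ tau_gt0 a (-1 * eta + 0)).
rewrite addr0 mulN1r => /(_ _)/eq_expands; apply; last by rewrite oppr_eq0 oner_eq0.
by move=> z; rewrite addr0 mulN1r.
Qed.

Lemma Ent_expands al be eta : expands (Ent al be) eta (Ent al be eta).
Proof.
rewrite /Ent; case: eqP => _; first exact: expands_cst.
apply: expandsM; last by apply: expands_prod => a _; exact: expands_thetaZN.
apply: expandsZ; apply: expandsN; apply: expandsM; last exact: expands_cst.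
have := expands_exp (- n%:R) 0 eta; rewrite addr0 mulNr; apply: eq_expands => z.
by rewrite addr0 mulNr.
Qed.

Lemma Emx_expands eta : mexpands Emx eta (Emx eta).
Proof.
move=> u v; case: (mxtens_indexP u) => a b; case: (mxtens_indexP v) => i j.
rewrite EmxE; apply: eq_expands (expandsZ _ (Ent_expands _ _ eta)) => z.
by rewrite EmxE.
Qed.

(** Among the theta_a at most one vanishes at a given point, and it can be
    excluded from the product. *)
Lemma Emx_neq0 eta : Emx eta != 0.
Proof.
suff [a Ha] : exists a : 'Z_n, Ent a 0 eta != 0.
  apply/eqP => /matrixP /(_ (idx (a, 0)) (idx (0, a))) /eqP.
  by rewrite EmxE [X in _ == X]mxE add0r addr0 eqxx subr0 subrr mulr0 mul1r (negbTE Ha).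
have [a [a0 Ha]] : exists a : 'Z_n, a != 0 /\
    forall b, b != a -> b != 0 -> thetaZ tau b (- eta) != 0.
  have [a /andP[a0 /eqP ta]|H] :=
      pickP (fun a : 'Z_n => (a != 0) && (thetaZ tau a (- eta) == 0)).
    exists a; split=> // b ba _; apply: contraNneq ba => tb.
    by apply/eqP/(thetaZ_zero_uniq n_gt1 tau_gt0 tb ta).
  exists 1; split; first exact: oner_neq0.
  by move=> b _ b0; have := H b; rewrite b0 => /negbT.
exists a; rewrite /Ent addr0 (negbTE a0) oppr0.
apply: mulf_neq0; last by apply/prodf_neq0 => b /andP[ba b0]; exact: Ha.
apply: mulf_neq0; last by rewrite oppr_eq0 mulf_neq0 ?e_neq0 ?chi_neq0.
apply: mulf_neq0; first exact: thetaZ_neq0.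
by rewrite invr_eq0 thprod0_neq0.
Qed.

Definition Eend eta : 'End(V2 R n) := linfun (mxV2 (Emx eta)).

Lemma Eend_E eta v : Eend eta v = mxV2 (Emx eta) v.
Proof. exact: lfunE. Qed.

Lemma Eend_entire : entire Eend.
Proof.
move=> v p z; apply: expands_holo.
have E w : Eend w v p = \sum_(q : 'Z_n * 'Z_n) Emx w (idx p) (idx q) * v q.
  by rewrite lfunE /= ffunE.
have H q (_ : true) : expands (fun w => Emx w (idx p) (idx q) * v q) z
    (Emx z (idx p) (idx q) * v q).
  by apply: expandsM (expands_cst _ _); exact: Emx_expands.
have G := eq_expands E (expands_sum (index_enum _) H).
exact: (eq_ind_r (fun t => expands _ z t) G (E z)).
Qed.

Lemma entire_ext_on (D : set C) (f : C -> 'End(V2 R n)) z :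
  D z -> entire_ext D f z = f z.
Proof. by rewrite /entire_ext; case: xgetP => [F _ [_ H] /H|]. Qed.

Lemma pcont_eq (f g : C -> C) z (d : R) : 0 < d -> pcont f z -> pcont g z ->
  (forall w, w != 0 -> nrm w <= d -> f (z + w) = g (z + w)) -> f z = g z.
Proof.
move=> d0 Hf Hg E; apply: contrapT => /eqP; rewrite -subr_eq0 -nrm_gt0 => h.
set eps := nrm _ in h; have e4 : 0 < eps / 4 by rewrite divr_gt0.
have [d1 d10 H1] := Hf _ e4; have [d2 d20 H2] := Hg _ e4.
pose r := Num.min d (Num.min d1 d2).
have r0 : 0 < r by rewrite !lt_min d0 d10.
have rn : nrm (r%:C%C : C) = r by rewrite nrm_real gtr0_norm.
have r1 : (r%:C%C : C) != 0 by rewrite -nrm_gt0 rn.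
have := E _ r1; rewrite rn ge_min lexx => /(_ isT) Er.
have := H1 r%:C%C; rewrite rn !ge_min lexx !orbT => /(_ isT) h1.
have := H2 r%:C%C; rewrite rn !ge_min lexx !orbT => /(_ isT) h2.
have : eps <= eps / 4 + eps / 4.
  apply: le_trans (lerD h1 h2); rewrite Er -[X in _ <= X + _]nrmN opprB.
  apply: le_trans (nrmD _ _).
  by rewrite addrA subrK.
lra.
Qed.

(** Emx is entire and agrees with R off the points of order n, which are isolated;
    the holomorphic extension is therefore Emx. *)
Lemma R_diagE eta : R_diag n k tau eta = Eend eta.
Proof.
have EF z : regular_locus n tau z -> R_op n k tau z z = Eend z.
  move=> zr; rewrite /R_op entire_ext_on //; apply/lfunP => v.
  by rewrite [RHS]lfunE R_formulaE Emx_regular.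
rewrite /R_diag /entire_ext.
case: xgetP => [F _ [eF HF]|/(_ Eend)]; last first.
  by case; split; [exact: Eend_entire | move=> z /EF].
apply/lfunP => v; apply/ffunP => p.
have [d d0 Hd] := lattice_regular_near eta tau_gt0 n_gt0.
have H := (@pcont_eq (fun w => F w v p) (fun w => Eend w v p) _ _ d0 (holo_pcont (eF v p eta)) (holo_pcont (@Eend_entire v p eta))).
by apply: H => w w0 wd; rewrite HF ?EF //; exact: Hd.
Qed.

End Diagonal.

(** * Modular transformation on the diagonal *)

Section Proportional.
Variable R : realType.
Local Notation C := R[i].

(** The 2 x 2 minors formed with A and B vanish off a discrete set, hence at x. *)
Lemma proportional_extend (n m : nat) (tau : C) (A B : C -> 'M[C]_m) (x : C) :
  (0 < n)%N -> 0 < complex.Im tau ->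
  mexpands A x (A x) -> mexpands B x (B x) ->
  (forall z, n%:R * z \notin lattice tau -> exists f : C, A z = f *: B z) ->
  A x != 0 -> B x != 0 -> exists2 f : C, f != 0 & A x = f *: B x.
Proof.
move=> n0 t0 eA eB AB A0 B0.
have minor u v u' v' : A x u v * B x u' v' - A x u' v' * B x u v = 0.
  have eM := expandsB (expandsM (eA u v) (eB u' v')) (expandsM (eA u' v') (eB u v)).
  apply: expands_uniq eM _; have [d d0 Hd] := lattice_regular_near x t0 n0.
  apply: expands_near d0 _ (expands_cst 0 x) => w w0 wd.
  by have [f ->] := AB _ (Hd w w0 wd); rewrite !mxE; ring.
have [u [v Buv]] : exists u v, B x u v != 0.
  apply: contrapT => H; move/eqP: B0; apply; apply/matrixP => u v.
  by rewrite [RHS]mxE; apply: contrapT => /eqP h; apply: H; exists u, v.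
have E : A x = (A x u v / B x u v) *: B x.
  apply/matrixP => u' v'; rewrite mxE mulrAC; apply: (mulIf Buv); rewrite divfK //.
  by apply/eqP; rewrite -subr_eq0 minor.
exists (A x u v / B x u v) => //.
by apply: contraNneq A0 => f0; rewrite E f0 scale0r.
Qed.

End Proportional.

Section TransportDiagonal.
Variable R : realType.
Local Notation C := R[i].
Variables (n k : nat).
Hypothesis n_gt1 : (1 < n)%N.
Local Notation N := (Zp_trunc n).+2.
Local Notation X := (@Xmx R n k).
Variables (tau tau' c : C) (p q r s : int) (P : 'M[C]_N) (s1 s2 : C).
Hypothesis tau_gt0 : 0 < complex.Im tau.
Hypothesis tau'_gt0 : 0 < complex.Im tau'.
Hypothesis c0 : c != 0.
Hypothesis c1E : c = p%:~R + q%:~R * tau'.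
Hypothesis ctE : c * tau = r%:~R + s%:~R * tau'.
Hypothesis det1 : p * s - q * r = 1.
Hypothesis s1_neq0 : s1 != 0.
Hypothesis s2_neq0 : s2 != 0.
Hypothesis PX1 : P *m X 1 0 = s1 *: (X p q *m P).
Hypothesis PX2 : P *m X 0 1 = s2 *: (X r s *m P).
Hypothesis Punit : P \in unitmx.
Let Phi : 'M[C]_(N * N) := P *t P.

(** The formula Hmx = 0 for the constant rho that cancels the residues. *)
Lemma Mmx_transport x y : n%:R * x \notin lattice tau -> n%:R * y \notin lattice tau ->
  exists f, @Mmx R n k tau' (c * x) (c * y) *m Phi = f *: (Phi *m @Mmx R n k tau x y).
Proof.
move=> xr yr; have [v v0 Hv] := Mmx_residue k n_gt1 tau_gt0.
have [v' v0' Hv'] := Mmx_residue k n_gt1 tau'_gt0.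
have H := Hmx_eq0 n_gt1 tau_gt0 tau'_gt0 c1E ctE det1 s1_neq0 s2_neq0 PX1 PX2 yr
  (expandable_0 (Hmx_residue P tau'_gt0 c1E ctE det1 yr v0 erefl Hv Hv')) xr.
move: H; rewrite /Hmx -/Phi; move: (_ *m Phi) (Phi *m _) => A B /eqP.
rewrite subr_eq0 => /eqP E; set g := e _ in E; set rho := v' / _ in E.
exists (g^-1 * rho); rewrite -scalerA -E scalerA mulVf ?scale1r //; exact: e_neq0.
Qed.

Lemma mulmxZ_neq0 m (A B : 'M[C]_m) : A \in unitmx -> B != 0 -> A *m B != 0.
Proof. by move=> Au; apply: contraNneq => AB0; rewrite -(mulKmx Au B) AB0 mulmx0. Qed.

Lemma mulZmx_neq0 m (A B : 'M[C]_m) : A \in unitmx -> B != 0 -> B *m A != 0.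
Proof. by move=> Au; apply: contraNneq => AB0; rewrite -(mulmxK Au B) AB0 mul0mx. Qed.

(** Off the points of order n this is Mmx_transport at (- eta, eta), translated by l
    with the quasi-periodicity of Mmx in both variables.  The remaining values of
    eta follow by proportional_extend, as neither side vanishes anywhere. *)
Lemma Emx_transport eta l : l \in lattice tau' -> exists2 f, f != 0 &
  @Emx R n k tau' (c * eta + l) *m Phi = f *: (Phi *m @Emx R n k tau eta).
Proof.
move=> /[dup] lL /latticeP[a [b lE]].
have Pu : Phi \in unitmx by rewrite tensmx_unit.
pose A w := @Emx R n k tau' (c * w + l) *m Phi.
pose B w := Phi *m @Emx R n k tau w.
apply: (@proportional_extend R n _ tau A B eta (ltnW n_gt1) tau_gt0).
- apply: mexpandsM (mexpands_cst _ _).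
  by apply: (mexpands_affine (A := @Emx R n k tau') c0); exact: Emx_expands.
- by apply: mexpandsM (mexpands_cst _ _) _; exact: Emx_expands.
- move=> z zr; rewrite /A /B.
  have zr' : n%:R * (c * z + l) \notin lattice tau'.
    rewrite mulrDr rpredDr; last by rewrite mulr_natl rpredMn.
    by apply: contra zr => h; apply: (lattice_mulc tau'_gt0 c1E ctE det1); rewrite mulrCA.
  rewrite -(Emx_regular k n_gt1 tau'_gt0 zr') -(Emx_regular k n_gt1 tau_gt0 zr).
  have zN : n%:R * (- z) \notin lattice tau by rewrite mulrN rpredN.
  have [f Hf] := Mmx_transport zN zr.
  have -> : - (c * z + l) = c * (- z) + ((- a)%:~R + (- b)%:~R * tau').
    by rewrite lE !intrN; ring.
  rewrite Mmx_period // lE Mmx_period2 //; set g := e _; set g' := e _.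
  have D0 : Dp n tau z != 0.
    rewrite mulf_neq0 ?invr_eq0 ?thprod0_neq0 //.
    by apply/prodf_neq0 => i _; exact: thetaZ_regular.
  move: (Dp n tau' _) => D'.
  exists (D' * g * g' * f * (Dp n tau z)^-1).
  rewrite -!scalemxAl -scalemxAr Hf !scalerA; congr (_ *: _).
  by rewrite -!mulrA mulVf // mulr1.
- by apply: mulZmx_neq0 => //; exact: Emx_neq0.
- by apply: mulmxZ_neq0 => //; exact: Emx_neq0.
Qed.

End TransportDiagonal.

(** * Homomorphisms of elliptic curves *)

Section EllipticCurves.
Variable R : realType.
Local Notation C := R[i].
Implicit Types (tau c z w : C).

Lemma ell_piE tau x y : (ell_pi tau x = ell_pi tau y) <-> (x - y \in lattice tau).
Proof.
rewrite [_ \in _](Quotient.idealrBE (lattice tau)).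
by split=> [/eqP|/eqP].
Qed.

Lemma ell_piD tau x y : ell_pi tau (x + y) = ell_pi tau x + ell_pi tau y.
Proof. by rewrite /ell_pi raddfD. Qed.

Lemma ell_pi0 tau : ell_pi tau 0 = 0.
Proof. by rewrite /ell_pi raddf0. Qed.

Lemma ell_piMn tau x m : ell_pi tau (x *+ m) = ell_pi tau x *+ m.
Proof. by rewrite /ell_pi raddfMn. Qed.

Lemma near_nrm (P : set C) z : (\forall w \near (z : C^o), P w) ->
  exists2 d : R, 0 < d & forall w, nrm w <= d -> P (z + w).
Proof.
move=> /nbhs_normP[_ /= /gt0_real[d d0 ->] H]; exists (d / 2); first by rewrite divr_gt0.
move=> w wd; apply: H => /=; rewrite opprD addrA subrr add0r normrN.
have h : `|w| <= (d / 2)%:C%C by rewrite nrm_le_norm.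
by apply: le_lt_trans h _; rewrite ltcR; lra.
Qed.

(** A holomorphic homomorphism lifts near the origin to a function that is additive, since
    the lattice is discrete, and differentiable, hence linear. *)
Lemma ell_hom_linear tau tau' (f : ell tau -> ell tau') : 0 < complex.Im tau' ->
  {morph f : x y / x + y} -> ell_holo f ->
  exists c, forall z, f (ell_pi tau z) = ell_pi tau' (c * z).
Proof.
move=> t0 fD /(_ 0)[g /near_nrm[d1 d10 H1]].
have {}H1 w : nrm w <= d1 -> holo_at g w /\ f (ell_pi tau w) = ell_pi tau' (g w).
  by move=> /H1; rewrite add0r.
have f0 : f 0 = 0 by apply: (@addrI _ (f 0)); rewrite -fD !addr0.
have fMn x m : f (x *+ m) = f x *+ m.
  by elim: m => [|m IH]; rewrite ?mulr0n // !mulrS fD IH.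
have n0 : nrm (0 : C) <= d1 by rewrite nrm0 ltW.
have [hg Eg0] := H1 _ n0.
pose h w := g w - g 0.
have Eh w : nrm w <= d1 -> f (ell_pi tau w) = ell_pi tau' (h w).
  move=> /H1[_ ->]; apply/ell_piE; rewrite /h opprB addrC subrK.
  by have := Eg0; rewrite ell_pi0 f0 -(ell_pi0 tau') => /esym/ell_piE; rewrite subr0.
have [dl dl0 Hdl] := lattice_discrete t0.
have [d2 d20 H2] := holo_pcont hg (eps := dl / 4) (divr_gt0 dl0 (ltr0n _ 4)).
have {}H2 w : nrm w <= d2 -> nrm (h w) <= dl / 4.
  by move=> /H2; rewrite add0r.
(* Half of the radius, so that sums remain in the domain of h. *)
pose d := Num.min d1 d2 / 2.
have d0 : 0 < d by rewrite divr_gt0 // lt_min d10.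
have dd1 : d + d <= d1 by rewrite /d -splitr ge_min lexx.
have dd2 : d + d <= d2 by rewrite /d -splitr ge_min lexx orbT.
have hD w w' : nrm w <= d -> nrm w' <= d -> h (w + w') = h w + h w'.
  move=> wd wd'; have wwd : nrm (w + w') <= d + d := le_trans (nrmD _ _) (lerD wd wd').
  apply/eqP; rewrite -subr_eq0; apply/eqP/Hdl.
    apply/ell_piE; rewrite ell_piD -!Eh ?ell_piD ?fD //; lra.
  have := H2 (w + w') (le_trans wwd dd2).
  have h1 : nrm w <= d2 by lra. have h2 : nrm w' <= d2 by lra.
  have := H2 _ h1; have := H2 _ h2.
  have := nrmB (h (w + w')) (h w + h w'); have := nrmD (h w) (h w'); lra.
have /holo_atP[c Hc] := hg.
have hc w : nrm w <= d -> h w = c * w.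
  have [->|w0] := eqVneq w 0; first by rewrite /h subrr mulr0.
  move=> wd; have two m : nrm (w / 2 ^+ m) <= d.
    rewrite nrmM nrmV nrmX nrm_nat; apply: le_trans wd.
    by rewrite ler_pdivrMr ?exprn_gt0 // ler_peMr ?nrm_ge0 // exprn_ege1 // ler1n.
  (* h w / w is constant along the sequence w / 2^m, and tends to c. *)
  have half m : h w = 2 ^+ m * h (w / 2 ^+ m).
    elim: m => [|m ->]; first by rewrite expr0 divr1 mul1r.
    have E : w / 2 ^+ m = w / 2 ^+ m.+1 + w / 2 ^+ m.+1.
      have : (2 ^+ m : C) != 0 by rewrite expf_neq0 // pnatr_eq0.
      by rewrite exprS; move: (2 ^+ m) => b b0; field.
    by rewrite E hD //; move: (h _) => y; rewrite exprS; ring.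
  apply/eqP; rewrite -subr_eq0; apply: contrapT => /negP; rewrite -nrm_gt0 => hw.
  have w1 : 0 < nrm w by rewrite nrm_gt0.
  set eps := nrm _ in hw; have e0 : 0 < eps / nrm w / 2 by rewrite !divr_gt0.
  have [d3 d30 H3] := Hc _ e0.
  have [m Hm] : exists m, nrm (w / 2 ^+ m) <= d3.
    have [m Hm] : exists m : nat, nrm w / d3 <= m%:R.
      exists (Num.bound (nrm w / d3)); apply: ltW; apply: archi_boundP.
      by rewrite divr_ge0 // ltW.
    exists m; rewrite nrmM nrmV nrmX nrm_nat ler_pdivrMr ?exprn_gt0 //.
    move: Hm; rewrite ler_pdivrMr // => /le_trans; apply.
    by rewrite mulrC ler_pM2l // -natrX ler_nat ltnW // ltn_expl.
  have wm0 : w / 2 ^+ m != 0 by rewrite mulf_neq0 // invr_eq0 expf_neq0.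
  have := H3 _ wm0 Hm; rewrite add0r -/(h _).
  have -> : h (w / 2 ^+ m) / (w / 2 ^+ m) - c = (h w - c * w) / w.
    rewrite (half m); have : (2 ^+ m : C) != 0 by rewrite expf_neq0 // pnatr_eq0.
    by move: (h _) => y; move: (2 ^+ m) => b b0; field; rewrite w0.
  have e1 : 0 < eps / nrm w by rewrite divr_gt0.
  by rewrite nrmM nrmV -/eps leNgt ltr_pdivrMr // ltr_pMr // ltr1n.
exists c => z.
have [m Hm] : exists m : nat, nrm z / d <= m%:R.
  exists (Num.bound (nrm z / d)); apply: ltW; apply: archi_boundP.
  by rewrite divr_ge0 ?nrm_ge0 // ltW.
have m0 : (m.+1)%:R != 0 :> C by rewrite pnatr_eq0.
have zd : nrm (z / m.+1%:R) <= d.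
  rewrite nrmM nrmV nrm_nat ler_pdivrMr ?ltr0n // mulrC -ler_pdivrMr //.
  by apply: le_trans Hm _; rewrite ler_nat.
have zE : z = (z / m.+1%:R) *+ m.+1 by rewrite -[RHS]mulr_natr divfK.
rewrite {1}zE ell_piMn fMn Eh; last by lra.
by rewrite hc // -ell_piMn; congr ell_pi; rewrite -mulrnAr -zE.
Qed.

(** Both sides compute the oriented area spanned by c and c tau. *)
Lemma lattice_orientation tau tau' c (p q r s : int) :
  c = p%:~R + q%:~R * tau' -> c * tau = r%:~R + s%:~R * tau' ->
  (p * s - q * r)%:~R * complex.Im tau' = nrm c ^+ 2 * complex.Im tau.
Proof.
move=> E1 E2; rewrite sqr_nrm intrB !intrM.
have := congr1 (@complex.Re R) E1; have := congr1 (@complex.Im R) E1.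
have := congr1 (@complex.Re R) E2; have := congr1 (@complex.Im R) E2.
rewrite !(ReD, ImD, ReM, ImM, Re_int, Im_int) !(mul0r, mulr0, subr0, add0r, addr0).
move: (complex.Re c) (complex.Im c) => x y h1 h2 h3 h4.
have -> : (x ^+ 2 + y ^+ 2) * complex.Im tau =
  x * (x * complex.Im tau + y * complex.Re tau) - y * (x * complex.Re tau - y * complex.Im tau).
  by ring.
have -> : x * complex.Im tau + y * complex.Re tau = s%:~R * complex.Im tau'.
  by rewrite -h1; ring.
have -> : x * complex.Re tau - y * complex.Im tau = r%:~R + s%:~R * complex.Re tau'.
  by rewrite -h2; ring.
by rewrite h3 h4; ring.
Qed.

(** An isomorphism of elliptic curves is multiplication by some c that carries one
    lattice onto the other; the base change has determinant 1 since multiplication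
    by c preserves the orientation of the plane. *)
Lemma ell_isoP tau tau' (mu : {additive ell tau -> ell tau'}) :
  0 < complex.Im tau -> 0 < complex.Im tau' -> ell_iso mu ->
  exists (c : C) (p q r s : int),
    [/\ c != 0, forall z, mu (ell_pi tau z) = ell_pi tau' (c * z),
        c = p%:~R + q%:~R * tau', c * tau = r%:~R + s%:~R * tau' & p * s - q * r = 1].
Proof.
move=> t0 t0' [nu [muK nuK hmu hnu]].
have [c Hc] := ell_hom_linear t0' (raddfD mu) hmu.
have nuD : {morph nu : x y / x + y}.
  by move=> x y; apply: (can_inj muK); rewrite raddfD !nuK.
have [c' Hc'] := ell_hom_linear t0 nuD hnu.
have cc : c' * c = 1.
  apply/eqP; rewrite -subr_eq0; apply: contrapT => /negP a0.
  have [d d0 Hd] := lattice_discrete t0.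
  have h : (d / 2)%:C%C \in lattice tau.
    set z : C := (d / 2)%:C%C / (c' * c - 1).
    have /ell_piE : ell_pi tau (c' * (c * z)) = ell_pi tau z.
      by rewrite -Hc' -Hc muK.
    by rewrite mulrA -[X in _ - X]mul1r -mulrBl mulrC divfK.
  have d2 : 0 < d / 2 by rewrite divr_gt0.
  have := Hd _ h; rewrite nrm_real gtr0_norm // => E.
  have /E /(congr1 (@complex.Re R)) /= : d / 2 < d by lra.
  by move=> dE; rewrite dE ltxx in d2.
have lat z : z \in lattice tau -> c * z \in lattice tau'.
  move=> zL; have : ell_pi tau z = ell_pi tau 0 by apply/ell_piE; rewrite subr0.
  move=> /(congr1 mu); rewrite !Hc => /ell_piE; by rewrite mulr0 subr0.
have lat' z : z \in lattice tau' -> c' * z \in lattice tau.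
  move=> zL; have : ell_pi tau' z = ell_pi tau' 0 by apply/ell_piE; rewrite subr0.
  move=> /(congr1 nu); rewrite !Hc' => /ell_piE; by rewrite mulr0 subr0.
have /lat := lattice1 tau; rewrite mulr1 => /latticeP[p [q E1]].
have /lat /latticeP[r [s E2]] := lattice_tau tau.
have /lat' := lattice1 tau'; rewrite mulr1 => /latticeP[p' [q' E1']].
have /lat' /latticeP[r' [s' E2']] := lattice_tau tau'.
have O := lattice_orientation E1 E2; have O' := lattice_orientation E1' E2'.
have c0 : c != 0.
  by apply: contra_eq_neq cc => ->; rewrite mulr0 eq_sym oner_neq0.
exists c, p, q, r, s; split=> //.
have cc2 : nrm c' ^+ 2 * nrm c ^+ 2 = 1 by rewrite -exprMn -nrmM cc nrm1 expr1n.
have D1 : ((p * s - q * r) * (p' * s' - q' * r'))%:~R = 1 :> R.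
  rewrite intrM; apply: (mulIf (lt0r_neq0 t0)); apply: (mulIf (lt0r_neq0 t0')).
  transitivity ((p * s - q * r)%:~R * complex.Im tau' *
     ((p' * s' - q' * r')%:~R * complex.Im tau)); first by ring.
  rewrite O O'; transitivity (nrm c' ^+ 2 * nrm c ^+ 2 * (complex.Im tau * complex.Im tau')).
    by ring.
  by rewrite cc2 mul1r !mul1r.
have D0 : 0 < p * s - q * r.
  rewrite -(ltr0z R) -(pmulr_lgt0 _ t0') O pmulr_lgt0 //.
  by rewrite exprn_gt0 // nrm_gt0.
move: D1; rewrite -[1]/(1%:~R) => /intr_inj.
move: (_ - _) (_ - _) D0 => b a a0 ab.
have b0 : 0 < b by rewrite -(pmulr_rgt0 _ a0) ab.
have : a <= a * b by rewrite ler_peMr ?(ltW a0) //; lia.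
by rewrite ab; lia.
Qed.

End EllipticCurves.

(** * Endomorphisms of the tensor algebra *)

Section TensorAlgebra.
Variable R : realType.
Local Notation C := R[i].
Variable n : nat.
Local Notation N := (Zp_trunc n).+2.
Local Notation idx := (@mxtens_index N N).
Local Notation gen := (@gen R n).
Implicit Types (P Q : 'M[C]_N) (i a b : 'Z_n) (m : fmonom 'Z_n) (x y : TV R n).

Definition mon (g : 'Z_n -> TV R n) m : TV R n := \prod_(i <- fmonom_val m) g i.

Lemma mon_mmorphism g : mmorphism (mon g).
Proof.
split=> [m1 m2|]; last by rewrite /mon fm1 big_nil.
by rewrite /mon fmM big_cat.
Qed.

HB.instance Definition _ g :=
  monalg.isMultiplicative.Build (fmonom 'Z_n) (TV R n) (mon g) (mon_mmorphism g).

(** The image of x_i under the linear map with matrix P. *)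
Definition lincomb P i : TV R n := \sum_a P a i *: gen a.

Lemma TV_mulU (m1 m2 : fmonom 'Z_n) (c1 c2 : C) :
  (mkmalgU m1 c1 * mkmalgU m2 c2 : TV R n) = mkmalgU (mmul m1 m2) (c1 * c2).
Proof. by rewrite malgM_def fgmulUU. Qed.

Lemma TV_scaleU (m : fmonom 'Z_n) (c d : C) :
  (c *: mkmalgU m d : TV R n) = mkmalgU m (c * d).
Proof. by rewrite -mul_malgC malgM_def fgmulUU mul1m. Qed.

Lemma TV_malgC_comm (c : C) x : x * mkmalgU mone c = mkmalgU mone c * x.
Proof.
rewrite (monalgE x) mulr_suml mulr_sumr; apply: eq_bigr => k _.
by rewrite !TV_mulU mul1m mulm1 mulrC.
Qed.

Lemma TV_scaleAr (c : C) x y : x * (c *: y) = c *: (x * y).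
Proof. by rewrite -!mul_malgC mulrA TV_malgC_comm mulrA. Qed.

Lemma TV_scaleM (c d t : C) x y : t *: ((c *: x) * (d *: y)) = (c * d * t) *: (x * y).
Proof.
have -> : c * d * t = t * d * c by ring.
by rewrite TV_scaleAr -scalerAl !scalerA.
Qed.

Lemma TV_monomial (m : fmonom 'Z_n) : mkmalgU m 1 = mon gen m.
Proof.
case: m => s; elim: s => [|i s IH]; first by rewrite /mon big_nil -fmoneE.
rewrite /mon /= big_cons -/(mon gen (FMonom s)) -IH TV_mulU mulr1; congr mkmalgU.
by apply/eqP; rewrite fmP fmM fmU.
Qed.

Lemma TV_monalgE x :
  x = \sum_(m <- finmap.enum_fset (msupp x)) (mkmalgU m (mcoeff m x) : TV R n).
Proof. exact: monalgE. Qed.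

(** The endomorphism of the tensor algebra induced by an endomorphism of V. *)
Definition TVmap P : TV R n -> TV R n :=
  mmap (@mkmalgU (fmonom 'Z_n) C mone) (mon (lincomb P)).

Lemma TVmap_zmod P : zmod_morphism (TVmap P).
Proof. by move=> x y; rewrite /TVmap raddfB. Qed.

HB.instance Definition _ P :=
  GRing.isZmodMorphism.Build (TV R n) (TV R n) (TVmap P) (TVmap_zmod P).

Lemma TVmap_monoid P : monoid_morphism (TVmap P).
Proof.
have [M1 M2] := @commr_mmap_is_multiplicative (fmonom 'Z_n) C (TV R n)
  (@mkmalgU (fmonom 'Z_n) C mone) (mon (lincomb P))
  (fun g m m' => esym (TV_malgC_comm _ _)).
by split.
Qed.

HB.instance Definition _ P :=
  GRing.isMonoidMorphism.Build (TV R n) (TV R n) (TVmap P) (TVmap_monoid P).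

Lemma TVmap_scalable P : scalable (TVmap P).
Proof. by move=> c x; rewrite /TVmap mmapZ mul_malgC. Qed.

HB.instance Definition _ P :=
  GRing.isScalable.Build C (TV R n) (TV R n) *:%R (TVmap P) (TVmap_scalable P).

Lemma TVmap_sum P (s : seq (fmonom 'Z_n)) (F : fmonom 'Z_n -> TV R n) :
  TVmap P (\sum_(m <- s) F m) = \sum_(m <- s) TVmap P (F m).
Proof. exact: raddf_sum. Qed.

Lemma TVmap_monalg P x : TVmap P x =
  \sum_(m <- finmap.enum_fset (msupp x)) TVmap P (mkmalgU m (mcoeff m x)).
Proof.
by rewrite -TVmap_sum; congr (TVmap P _); exact: TV_monalgE.
Qed.

Lemma TVmapU P m (c : C) : TVmap P (mkmalgU m c) = c *: mon (lincomb P) m.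
Proof. by rewrite /TVmap mmapU mul_malgC. Qed.

Lemma TVmap_gen P i : TVmap P (gen i) = lincomb P i.
Proof. by rewrite TVmapU scale1r /mon fmU big_seq1. Qed.

Lemma TVmap_lincomb P Q i : TVmap P (lincomb Q i) = lincomb (P *m Q) i.
Proof.
rewrite /lincomb linear_sum /=.
under eq_bigr => a _ do rewrite linearZ /= TVmap_gen scaler_sumr.
rewrite exchange_big /=; apply: eq_bigr => b _.
rewrite mxE scaler_suml; apply: eq_bigr => a _.
by rewrite scalerA mulrC.
Qed.

Lemma lincomb1 i : lincomb 1%:M i = gen i.
Proof.
rewrite /lincomb (bigD1 i) //= mxE eqxx scale1r big1 ?addr0 // => a ai.
by rewrite mxE (negbTE ai) scale0r.
Qed.

(** Both sides are algebra morphisms that agree on the generators. *)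
Lemma TVmapK P Q : P *m Q = 1%:M -> cancel (TVmap Q) (TVmap P).
Proof.
move=> PQ x.
have H (m : fmonom 'Z_n) (c : C) : TVmap P (TVmap Q (mkmalgU m c)) = mkmalgU m c.
  rewrite TVmapU linearZ /= -[in RHS](mulr1 c) -TV_scaleU; congr (_ *: _).
  rewrite TV_monomial rmorph_prod; apply: eq_bigr => i _.
  by rewrite /= TVmap_lincomb PQ lincomb1.
rewrite (TVmap_monalg Q) TVmap_sum [RHS]TV_monalgE.
by apply: eq_bigr => m _; exact: H.
Qed.

(** * The grading of the tensor algebra *)

Lemma TV_deg0 d : TV_deg d (0 : TV R n).
Proof. by move=> m; rewrite mcoeff0 eqxx. Qed.

Lemma TV_degD d x y : TV_deg d x -> TV_deg d y -> TV_deg d (x + y).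
Proof.
move=> hx hy m; rewrite mcoeffD; have [x0|/hx //] := eqVneq (mcoeff m x) 0.
by rewrite x0 add0r => /hy.
Qed.

Lemma TV_degZ d (c : C) x : TV_deg d x -> TV_deg d (c *: x).
Proof.
by move=> hx m; rewrite mcoeffZ mulf_eq0 => /norP[_ /hx].
Qed.

Lemma TV_deg_sum d (I : Type) (s : seq I) (p : pred I) (F : I -> TV R n) :
  (forall j : I, p j -> TV_deg d (F j)) -> TV_deg d (\sum_(j <- s | p j) F j).
Proof.
move=> H; elim/big_rec: _ => [|i x pi hx]; first exact: TV_deg0.
by apply: TV_degD hx; exact: H.
Qed.

Lemma TV_degU m (c : C) : TV_deg (fdeg m) (mkmalgU m c : TV R n).
Proof.
move=> m'; rewrite mcoeffU; have [E|_] := eqVneq m m'; first by rewrite E.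
by rewrite mulr0n eqxx.
Qed.

Lemma TV_degM d1 d2 x y : TV_deg d1 x -> TV_deg d2 y -> TV_deg (d1 + d2)%N (x * y).
Proof.
move=> hx hy; rewrite malgME big_seq; apply: TV_deg_sum => m1 h1.
rewrite big_seq; apply: TV_deg_sum => m2 h2.
rewrite -!mcoeff_neq0 in h1 h2.
by rewrite -(hx _ h1) -(hy _ h2) -fdegM; exact: TV_degU.
Qed.

Lemma TV_deg_1 : TV_deg 0 (1 : TV R n).
Proof. by rewrite -[0%N](@fdeg1 'Z_n); exact: TV_degU. Qed.

Lemma TV_deg_gen i : TV_deg 1 (gen i).
Proof. by rewrite -[1%N](@fdegU 'Z_n i); exact: TV_degU. Qed.

Lemma TV_deg_mon P m : TV_deg (fdeg m) (mon (lincomb P) m).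
Proof.
case: m => s; rewrite /fdeg /mon /=; elim: s => [|i s IH].
  by rewrite big_nil; exact: TV_deg_1.
rewrite big_cons -[size _]/((1 + size s)%N); apply: TV_degM IH; apply: TV_deg_sum => a _.
by apply: TV_degZ; exact: TV_deg_gen.
Qed.

Lemma TVmap_deg P d x : TV_deg d x -> TV_deg d (TVmap P x).
Proof.
move=> hx; rewrite TVmap_monalg big_seq; apply: TV_deg_sum => m.
rewrite -mcoeff_neq0 => /hx <- /=; rewrite TVmapU.
by apply: TV_degZ; exact: TV_deg_mon.
Qed.

(** * Quadratic relations *)

Lemma TVmap_V2 P (v : V2 R n) : TVmap P (TV_of_V2 v) = TV_of_V2 (mxV2 (P *t P) v).
Proof.
rewrite /TV_of_V2 linear_sum /=.
transitivity (\sum_(p : 'Z_n * 'Z_n) \sum_(q : 'Z_n * 'Z_n)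
   ((P q.1 p.1 * P q.2 p.2) * v p) *: (gen q.1 * gen q.2)).
  apply: eq_bigr => p _; rewrite linearZ rmorphM /= !TVmap_gen.
  rewrite /lincomb mulr_suml scaler_sumr -(pair_bigA _ (fun a b =>
    ((P a p.1 * P b p.2) * v p) *: (gen a * gen b))) /=.
  apply: eq_bigr => a _; rewrite mulr_sumr scaler_sumr; apply: eq_bigr => b _.
  exact: TV_scaleM.
rewrite exchange_big /=; apply: eq_bigr => -[a b] _; rewrite ffunE -scaler_suml.
apply: (congr1 (fun t : C => t *: (gen a * gen b))).
by apply: eq_bigr => -[i j] _; rewrite (tensmxE P P a b i j).
Qed.

Lemma Q_relE k tau eta : (1 < n)%N -> 0 < complex.Im tau ->
  Q_rel k tau eta = [set TV_of_V2 (mxV2 (@Emx R n k tau eta) v) | v in [set: V2 R n]].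
Proof.
move=> n1 t0; rewrite /Q_rel (R_diagE k n1 t0 eta).
apply/seteqP; split.
  move=> _ [w /memv_imgP[v _ wE] <-]; exists v; first by [].
  by rewrite wE Eend_E.
move=> _ [v _ <-]; exists (@Eend R n k tau eta v); last by rewrite Eend_E.
exact: (memv_img (@Eend R n k tau eta) (memvf v)).
Qed.

(** An intertwining relation up to a scalar maps the image of one operator into the
    image of the other. *)
Lemma TVmap_rel P k (tau eta tau' eta' f : C) : (1 < n)%N ->
  0 < complex.Im tau -> 0 < complex.Im tau' ->
  (P *t P) *m @Emx R n k tau eta = f *: (@Emx R n k tau' eta' *m (P *t P)) ->
  forall x, Q_rel k tau eta x -> Q_rel k tau' eta' (TVmap P x).
Proof.
move=> n1 t0 t0' E x; rewrite !Q_relE // => -[v _ <-] /=.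
exists (f *: mxV2 (P *t P) v) => //.
by rewrite TVmap_V2 -mxV2M E mxV2Z mxV2M linearZ.
Qed.

End TensorAlgebra.

(** * Isomorphisms of the quotient algebras *)

(** The preimage of a two-sided ideal is a two-sided ideal. *)
Lemma ideal_gen_map (K : comNzRingType) (A B : lalgType K) (S : set A) (T : set B)
    (phi : {rmorphism A -> B}) : (forall x, S x -> T (phi x)) ->
  forall x, x \in ideal_gen S -> phi x \in ideal_gen T.
Proof.
move=> ST x /ideal_genP /(_ (fun x => phi x \in ideal_gen T)); apply; last first.
  by move=> y /ST Ty; apply/ideal_genP => I _; apply.
split=> [|y z hy hz|a y hy|a y hy].
- by rewrite raddf0 rpred0.
- by rewrite raddfB rpredB.
- by rewrite rmorphM ideal_genMl.
- by rewrite rmorphM ideal_genMr.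
Qed.

Section QuotientMap.
Variable R : realType.
Local Notation C := R[i].
Variables (n k : nat) (tau eta tau' eta' : C) (phi : {lrmorphism TV R n -> TV R n}).
Local Notation pi1 := (quot_alg_pi (Q_rel k tau eta) : TV R n -> Q n k tau eta).
Local Notation pi2 := (quot_alg_pi (Q_rel k tau' eta') : TV R n -> Q n k tau' eta').

(** The compatibility with the relations is an argument, so that the algebra
    morphism structure can be inferred from the term. *)
Definition Qmap (_ : forall x, Q_rel k tau eta x -> Q_rel k tau' eta' (phi x))
    (x : Q n k tau eta) : Q n k tau' eta' := pi2 (phi (quot_alg_repr x)).

Variable h : forall x, Q_rel k tau eta x -> Q_rel k tau' eta' (phi x).

Lemma Qmap_pi x : Qmap h (pi1 x) = pi2 (phi x).
Proof.
apply/quot_alg_piP; rewrite -raddfB; apply: (ideal_gen_map h).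
exact: quot_alg_repr_pi.
Qed.

Lemma Qmap_zmod : zmod_morphism (Qmap h).
Proof.
move=> x y; rewrite -[x]quot_alg_reprK -[y]quot_alg_reprK.
have B1 u v : pi1 u - pi1 v = pi1 (u - v) by rewrite -(raddfB (quot_alg_pi (Q_rel k tau eta))).
by rewrite B1 !Qmap_pi !raddfB.
Qed.

Lemma Qmap_monoid : monoid_morphism (Qmap h).
Proof.
split=> [|x y]; first by rewrite [LHS](Qmap_pi 1) rmorph1.
rewrite -[x]quot_alg_reprK -[y]quot_alg_reprK.
have M1 u v : pi1 u * pi1 v = pi1 (u * v) := quot_alg_mulE _ u v.
have M2 u v : pi2 u * pi2 v = pi2 (u * v) := quot_alg_mulE _ u v.
by rewrite M1 !Qmap_pi rmorphM M2.
Qed.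

Lemma Qmap_scalable : scalable (Qmap h).
Proof.
move=> c x; rewrite -[x]quot_alg_reprK.
have Z1 u : c *: pi1 u = pi1 (c *: u) := quot_alg_scaleE _ c u.
have Z2 u : c *: pi2 u = pi2 (c *: u) := quot_alg_scaleE _ c u.
by rewrite Z1 !Qmap_pi linearZ Z2.
Qed.

HB.instance Definition _ :=
  GRing.isZmodMorphism.Build (Q n k tau eta) (Q n k tau' eta') (Qmap h) Qmap_zmod.
HB.instance Definition _ :=
  GRing.isMonoidMorphism.Build (Q n k tau eta) (Q n k tau' eta') (Qmap h) Qmap_monoid.
HB.instance Definition _ :=
  GRing.isScalable.Build C (Q n k tau eta) (Q n k tau' eta') *:%R (Qmap h) Qmap_scalable.

Lemma Qmap_lrmorphism :
  exists f : {lrmorphism Q n k tau eta -> Q n k tau' eta'}, f =1 Qmap h.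
Proof. by exists (Qmap h). Qed.

End QuotientMap.

Lemma QmapK (R : realType) (n k : nat) (tau eta tau' eta' : R[i])
    (phi psi : {lrmorphism TV R n -> TV R n})
    (h : forall x, Q_rel k tau eta x -> Q_rel k tau' eta' (phi x))
    (g : forall x, Q_rel k tau' eta' x -> Q_rel k tau eta (psi x)) :
  cancel phi psi -> cancel (Qmap h) (Qmap g).
Proof. by move=> phiK x; rewrite -[x]quot_alg_reprK !Qmap_pi phiK. Qed.

Lemma Qmap_deg (R : realType) (n k : nat) (tau eta tau' eta' : R[i])
    (phi : {lrmorphism TV R n -> TV R n})
    (h : forall x, Q_rel k tau eta x -> Q_rel k tau' eta' (phi x)) d :
  (forall x, TV_deg d x -> TV_deg d (phi x)) ->
  Qmap h @` Q_deg n k tau eta d `<=` Q_deg n k tau' eta' d.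
Proof.
move=> Hd _ [_ [x xd <-] <-]; rewrite Qmap_pi.
by exists (phi x); first exact: Hd.
Qed.

Lemma tens1mx1 (F : comNzRingType) (m n : nat) : tensmx (1%:M : 'M[F]_m) (1%:M : 'M[F]_n) = 1%:M.
Proof.
apply/matrixP => u v; case: (mxtens_indexP u) => a b; case: (mxtens_indexP v) => i j.
by rewrite tensmxE !mxE (can_eq (@mxtens_indexK m n)) xpair_eqE -natrM mulnb.
Qed.

Theorem theorem1p2 (R : realType) (n k : nat) (hk : (1 <= k)%N) (hkn : (k < n)%N)
    (hcop : coprime n k) (eta tau eta' tau' : R[i])
    (htau : 0 < complex.Im tau) (htau' : 0 < complex.Im tau')
    (mu : {additive ell tau -> ell tau'}) (hmu : ell_iso mu)
    (hxi : forall x : ell tau,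
       mu (x + ell_pi tau eta) = mu x + ell_pi tau' eta') :
  exists f : {lrmorphism Q n k tau eta -> Q n k tau' eta'},
    bijective f /\
    forall d : nat, f @` Q_deg n k tau eta d = Q_deg n k tau' eta' d.
Proof.
have n1 : (1 < n)%N := leq_ltn_trans hk hkn.
have [c [p [q [r [s [c0 Hc c1E ctE det1]]]]]] := ell_isoP htau htau' hmu.
have [P [s1 [s2 [Pu s10 s20 PX1 PX2]]]] := intertwiner R n1 hcop det1.
have lL : eta' - c * eta \in lattice tau'.
  apply/ell_piE; rewrite -Hc; apply: (@addrI _ (mu 0)).
  by rewrite -hxi add0r raddf0 add0r.
have [f f0] := Emx_transport n1 htau htau' c0 c1E ctE det1 s10 s20 PX1 PX2 Pu eta lL.
rewrite addrC subrK => E.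
have Fu : P *t P \in unitmx by rewrite tensmx_unit.
have QP : invmx P *m P = 1%:M by rewrite mulVmx.
have PQ : P *m invmx P = 1%:M by rewrite mulmxV.
have FQ : (invmx P *t invmx P) *m (P *t P) = 1%:M by rewrite tensmx_mul QP tens1mx1.
have QF : (P *t P) *m (invmx P *t invmx P) = 1%:M by rewrite tensmx_mul PQ tens1mx1.
have E1 : (P *t P) *m Emx n k tau eta = f^-1 *: (Emx n k tau' eta' *m (P *t P)).
  by rewrite E scalerA mulVf // scale1r.
have E2 : (invmx P *t invmx P) *m Emx n k tau' eta' =
    f *: (Emx n k tau eta *m (invmx P *t invmx P)).
  rewrite -[LHS]mulmx1 -QF mulmxA -[X in X *m _]mulmxA E -scalemxAr mulmxA FQ mul1mx.
  by rewrite scalemxAl.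
have h1 := TVmap_rel n1 htau htau' E1.
have h2 := TVmap_rel n1 htau' htau E2.
have FK := QmapK h1 h2 (TVmapK QP).
have GK := QmapK h2 h1 (TVmapK PQ).
have [F /funext FE] := Qmap_lrmorphism h1; exists F; rewrite FE.
split; first by exists (Qmap h2).
move=> d; apply/seteqP; split; first exact: Qmap_deg (@TVmap_deg R n P d).
move=> y yd; exists (Qmap h2 y); last exact: GK.
by apply: (Qmap_deg (h := h2) (@TVmap_deg R n (invmx P) d)); exists y.
Qed.
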